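(* Let $\mathcal{A}$ be a central, essential, supersolvable arrangement of linear hyperplanes in $\mathbb{R}^d$, let $F$ be a modular flag for $\mathcal{A}$, and let $c_0$ be a chamber of $\mathcal{A}$ incident to $F$. Then the graph $G_2$ of minimal galleries from $c_0$ to $-c_0$ has diameter exactly $|L_2|$. In particular, the graph $G(w_0)$ of reduced words for the longest element $w_0$ has diameter $\frac{1}{24}n(n-1)(n-2)(3n-5)$ for the symmetric group $\mathfrak{S}_n$ (type $A_{n-1}$), diameter $\frac{1}{6}n(n-1)(3n^2-5n+1)$ for the hyperoctahedral group of type $B_n$, and diameter $1$ for the dihedral group $I_2(m)$; in each case this number equals $|L_2|$ for the corresponding reflection arrangement.
   Context: A central, essential hyperplane arrangement $\mathcal{A}$ in $\mathbb{R}^d$ is a finite set of linear hyperplanes whose common intersection is $\{0\}$. $L$ denotes the set of all intersections of subsets of $\mathcal{A}$, ordered by reverse inclusion, and $L_i$ denotes the set of those intersection subspaces of codimension $i$; thus $L_1=\mathcal{A}$ and $L_{d-1}$ consists of lines. Chambers are the connected components of $\mathbb{R}^d\setminus\bigcup_{H\in\mathcal{A}}H$. For chambers $c,c'$, $L_1(c,c')$ is the set of hyperplanes separating $c$ from $c'$. $G_1$ is the graph on chambers with $c,c'$ adjacent iff $|L_1(c,c')|=1$; a minimal gallery is a shortest path in $G_1$. A minimal gallery from $c_0$ to $-c_0$ crosses every hyperplane of $\mathcal{A}$ exactly once and is determined by the order of crossing. For $X\in L_2$, two minimal galleries $r,r'$ from $c_0$ to $-c_0$ are separated by $X$ if they cross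 the hyperplanes of $\mathcal{A}$ containing $X$ in different orders (equivalently their images in the rank-two localized arrangement $\mathcal{A}_X=\{H/X: H\in\mathcal{A}, H\supseteq X\}$ in $\mathbb{R}^d/X$ differ); $L_2(r,r')$ is the set of such $X$. $G_2$ is the graph whose vertices are the minimal galleries from $c_0$ to $-c_0$, with $r,r'$ adjacent iff $|L_2(r,r')|=1$. Supersolvability: a coatom is an element $\ell\in L_{d-1}$ (a line). It is a modular coatom if for every pair of distinct hyperplanes $H,H'\in\mathcal{A}$ not containing $\ell$, the hyperplane $\ell+(H\cap H')$ belongs to $\mathcal{A}$. $\mathcal{A}$ is supersolvable if $d=1$, or there is a modular coatom $\ell$ such that the localized arrangement $\mathcal{A}_\ell$ in $\mathbb{R}^d/\ell$ is supersolvable. A (maximal) flag is a chain $\{0\}=X_0\subset X_1\subset\cdots\subset X_d=\mathbb{R}^d$ of intersection subspaces with $\dim X_i=i$; it is modular if $X_1$ is a modular coatom of $\mathcal{A}$ and, for each $i$, $X_i/X_{i-1}$ is a modular coatom of $\mathcal{A}_{X_{i-1}}$. A chamber $c$ is incident to a subspace $X$ if the closure of $c$ meets $X$ in a set of the same dimension as $X$, and incident to a flag if it is incident to every $X_i$. Reduced words: for a finite Coxeter group $(W,S)$ and $w\in W$, $G(w)$ is the graph whose vertices are the reduced words for $w$ (sequences of generators of minimum length with product $w$), two words adjacent iff one is obtained from the other by a single braid relation, i.e. replacing a consecutive factor $sts\cdots$ ($m_{st}$ letters) by $tst\cdots$ ($m_{st}$ letters), $m_{st}$ the order of $st$. Type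 $A_{n-1}$: $W=\mathfrak{S}_n$ with adjacent transpositions $s_i=(i,i+1)$, reflection arrangement $x_i=x_j$ in $\mathbb{R}^n/\{x_1=\cdots=x_n\}$. Type $B_n$: signed permutations with $s_0$ the sign change of $x_1$ and $s_i=(i,i+1)$, reflection arrangement $x_i=\pm x_j$, $x_i=0$ in $\mathbb{R}^n$. $I_2(m)$: dihedral group of order $2m$. For a reflection group, $G(w_0)$ is identified with $G_2$ for its reflection arrangement (any base chamber). *)

(* Defs.v *)
From HB Require Import structures.
From mathcomp Require Import all_boot all_order all_algebra all_fingroup.
From mathcomp Require Import all_classical all_reals all_analysis.

Set Implicit Arguments.
Unset Strict Implicit.
Unset Printing Implicit Defensive.

Import Order.TTheory GRing.Theory Num.Theory.
Import numFieldNormedType.Exports.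

Definition walk {T : Type} (V : T -> Prop) (E : T -> T -> Prop)
    (x y : T) (k : nat) : Prop :=
  exists p : seq T,
    [/\ size p = k.+1, nth x p 0 = x, nth x p k = y,
        (forall j, (j <= k)%N -> V (nth x p j))
      & (forall j, (j < k)%N -> E (nth x p j) (nth x p j.+1))].

Definition has_diameter {T : Type} (V : T -> Prop) (E : T -> T -> Prop)
    (N : nat) : Prop :=
  (forall x y, V x -> V y -> exists2 k, (k <= N)%N & walk V E x y k) /\
  (exists x y, [/\ V x, V y & forall k, (k < N)%N -> ~ walk V E x y k]).

Local Open Scope ring_scope.

Section Arr.
Variables (R : realType) (d : nat) (I : finType) (a : I -> 'rV[R]_d).

Definition lform (v x : 'rV[R]_d) : R := (x *m v^T) 0 0.

Definition hyp (v : 'rV[R]_d) : {vspace 'rV[R]_d} :=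
  lker (linfun (fun x : 'rV[R]_d => x *m v^T)).

Definition H (i : I) : {vspace 'rV[R]_d} := hyp (a i).

Definition is_arrangement : Prop :=
  (forall i, a i != 0) /\ injective H.

Definition essential : Prop := (\bigcap_(i : I) H i)%VS = 0%VS.

Definition Lset : seq {vspace 'rV[R]_d} :=
  undup [seq (\bigcap_(i in Z) H i)%VS | Z : {set I}].

Definition L2 : seq {vspace 'rV[R]_d} :=
  [seq X <- Lset | (\dim X + 2 == d)%N].

Local Open Scope classical_set_scope.

Definition complement : set 'rV[R]_d := [set x | forall i, x \notin H i].

Definition chamber (c : set 'rV[R]_d) : Prop :=
  exists2 x, complement x & c = @connected_component 'rV[R]_d complement x.

Definition negset (c : set 'rV[R]_d) : set 'rV[R]_d := [set - x | x in c].

Definition separates (i : I) (c c' : set 'rV[R]_d) : Prop :=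
  exists x y, [/\ c x, c' y & (lform (a i) x * lform (a i) y < 0)%R].

Definition L1sep (c c' : set 'rV[R]_d) : {set I} :=
  [set i | `[< separates i c c' >]].

Definition adj1 (c c' : set 'rV[R]_d) : Prop := #|L1sep c c'| = 1%N.

Definition is_gallery (c c' : set 'rV[R]_d) (g : seq (set 'rV[R]_d)) : Prop :=
  [/\ (0 < size g)%N, nth set0 g 0 = c, last set0 g = c',
      (forall k, (k < size g)%N -> chamber (nth set0 g k))
    & (forall k, (k.+1 < size g)%N -> adj1 (nth set0 g k) (nth set0 g k.+1))].

Definition min_gallery (c c' : set 'rV[R]_d) (g : seq (set 'rV[R]_d)) : Prop :=
  is_gallery c c' g /\
  (forall g', is_gallery c c' g' -> (size g <= size g')%N).

Definition cross (g : seq (set 'rV[R]_d)) (i : I) : nat :=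
  find (fun k => `[< separates i (nth set0 g k) (nth set0 g k.+1) >])
       (iota 0 (size g).-1).

Definition Xsep (X : {vspace 'rV[R]_d}) (g g' : seq (set 'rV[R]_d)) : Prop :=
  exists i j, [/\ (X <= H i)%VS, (X <= H j)%VS &
     ((cross g i < cross g j)%N != (cross g' i < cross g' j)%N)].

Definition L2sep (g g' : seq (set 'rV[R]_d)) : nat :=
  count (fun X => `[< Xsep X g g' >]) L2.

Definition adj2 (g g' : seq (set 'rV[R]_d)) : Prop := L2sep g g' = 1%N.

Definition G2_vertex (c0 : set 'rV[R]_d) : seq (set 'rV[R]_d) -> Prop :=
  min_gallery c0 (negset c0).

(* Y/X is a modular coatom of the localization A_X (expressed inside R^d:
   hyperplanes of A_X are the H_i containing X, and
   Y/X + (H_i/X cap H_j/X) = (Y + (H_i cap H_j))/X) *)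
Definition modular_over (X Y : {vspace 'rV[R]_d}) : Prop :=
  [/\ Y \in Lset, (X <= Y)%VS, \dim Y = (\dim X).+1 &
      forall i j, i != j -> (X <= H i)%VS -> (X <= H j)%VS ->
        ~~ (Y <= H i)%VS -> ~~ (Y <= H j)%VS ->
        exists k, H k = (Y + (H i :&: H j))%VS].

(* ssk k X : the localization A_X, living in R^d/X of dimension k,
   is supersolvable *)
Fixpoint ssk (k : nat) (X : {vspace 'rV[R]_d}) : Prop :=
  match k with
  | 0 => False
  | k'.+1 => if k' is 0 then True
             else exists Y, modular_over X Y /\ ssk k' Y
  end.

Definition supersolvable : Prop := ssk d 0%VS.

Definition modular_flag (F : nat -> {vspace 'rV[R]_d}) : Prop :=
  [/\ F 0%N = 0%VS, F d = fullv,
      (forall i, (i <= d)%N -> F i \in Lset /\ \dim (F i) = i)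
    & (forall i, (i < d)%N -> (F i <= F i.+1)%VS /\ modular_over (F i) (F i.+1))].

(* c is incident to X: closure c meets X in a set whose linear span
   (= dimension, as closure c cap X is a convex cone) equals dim X *)
Definition incident (c : set 'rV[R]_d) (X : {vspace 'rV[R]_d}) : Prop :=
  exists s : seq 'rV[R]_d,
    (forall v, v \in s -> @closure 'rV[R]_d c v /\ v \in X) /\ \dim (span s) = \dim X.

Definition incident_flag (c : set 'rV[R]_d) (F : nat -> {vspace 'rV[R]_d}) : Prop :=
  forall i, (i <= d)%N -> incident c (F i).

End Arr.

Local Open Scope group_scope.

Section Words.
Variables (gT : finGroupType) (J : eqType) (s : J -> gT).

Definition wprod (w : seq J) : gT := \prod_(j <- w) s j.

Definition reduced (g : gT) (w : seq J) : Prop :=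
  wprod w = g /\ (forall w', wprod w' = g -> (size w <= size w')%N).

Definition longest (g : gT) : Prop :=
  exists w, reduced g w /\ (forall h w', reduced h w' -> (size w' <= size w)%N).

Definition alt (i j : J) (k : nat) : seq J :=
  mkseq (fun t => if odd t then j else i) k.

Definition braid_adj (w w' : seq J) : Prop :=
  exists u v i j, [/\ i != j,
     w = u ++ alt i j #[s i * s j] ++ v &
     w' = u ++ alt j i #[s i * s j] ++ v].

Definition GW_diameter (g : gT) (N : nat) : Prop :=
  has_diameter (reduced g) braid_adj N.

End Words.

Definition genA (m : nat) (i : 'I_m) : {perm 'I_m.+1} :=
  tperm (widen_ord (leqnSn m) i) (lift ord0 i).

(* type B_n with n = m.+1 : signed permutations as permutations of
   'I_n * bool (b = true : +x_k, false : -x_k) ;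
   s_0 = sign change of x_1, s_k = (k, k+1) (on both signs) *)
Definition genB (m : nat) (k : 'I_m.+1) : {perm 'I_m.+1 * bool} :=
  if k == ord0 then tperm (ord0, false) (ord0, true)
  else (tperm (inord k.-1, false) (inord k, false) *
        tperm (inord k.-1, true) (inord k, true))%g.

Local Close Scope group_scope.

Definition ltpair (n : nat) := {p : 'I_n * 'I_n | (p.1 < p.2)%N}.

Definition evec (R : realType) (n : nat) (i : 'I_n) : 'rV[R]_n :=
  delta_mx 0 i.

Definition normA (R : realType) (n : nat) (p : ltpair n) : 'rV[R]_n :=
  evec R (val p).1 - evec R (val p).2.

Definition normB (R : realType) (n : nat) (q : (ltpair n * bool) + 'I_n) :
  'rV[R]_n :=
  match q with
  | inl (p, b) => if b then evec R (val p).1 - evec R (val p).2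
                  else evec R (val p).1 + evec R (val p).2
  | inr i => evec R i
  end.

(* I_2(m): the m lines through 0 at angles k pi / m in R^2 *)
Definition normI2 (R : realType) (m : nat) (k : 'I_m) : 'rV[R]_2 :=
  \row_(j < 2) (if j == 0 then - sin (k%:R * pi / m%:R)
                else cos (k%:R * pi / m%:R)).

(* Main.v *)
(** Minimal galleries from c0 to -c0 are the orderings of the hyperplanes all of
    whose prefixes separate some chamber from c0, and two galleries are adjacent
    in G_2 when one reverses a block consisting of all the hyperplanes through
    some X in L_2. A gallery and its reverse are separated by every X, and one
    step changes the number of separating X by one, so the diameter is at least
    |L_2|.

    Conversely, let l be a modular coatom of A and call a hyperplane "base" if it
    contains l and "fiber" otherwise. A line parallel to l crosses the fiber
    hyperplanes in an order which depends only on the base chamber, and crossing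
    a base hyperplane K reverses, for each X in L_2 lying in K but not containing
    l, the block of fiber hyperplanes through X. Let r0 cross first all the fiber
    hyperplanes, and then the base ones as the gallery obtained by induction for
    A_l. If some base
    hyperplane precedes a fiber one in a gallery r, let K be the last such base
    hyperplane: it is followed by a block as above, and moving this block before
    K is a step which decreases by one the number of X separating r from r0.
    Hence d(r, r0) is the number of separating X for every r. Since r -> -r is an
    automorphism which complements the set of X separating r from r0, going from
    r to r' through r0 or through -r0 takes at most |L_2| steps.

    For types A and B the reduced words of w0 are in bijection with the minimal
    galleries by way of the inversions of their prefixes; the letters of a block
    reversed by a step lie in a rank 2 parabolic subgroup, hence alternate, so
    that the step is a braid relation. *)

Require Import Defs.
From HB Require Import structures.
From mathcomp Require Import all_boot all_order all_algebra all_fingroup.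
From mathcomp Require Import all_classical all_reals all_analysis.
From mathcomp Require Import cyclic Rstruct.
From mathcomp Require Import ring lra zify.

Set Implicit Arguments.
Unset Strict Implicit.
Unset Printing Implicit Defensive.

(** The order in which a parallel to l meets two fiber hyperplanes [i] and [j] is governed by one
    base hyperplane: modularity puts a base normal [a k] into the span of [a i] and [a j], and the
    parameters of the two meeting points differ by a nonzero multiple of the form of [a k]. Its sign
    decides the order, and only a change of that sign reverses it. Incidence of the chamber to the
    flag gives a vector of l on which all fiber forms are positive, so that all fiber hyperplanes
    are crossed in the same sense.

    That X cannot separate r0 from both r and -r is a fact of rank 2: of three coplanar normals
    positive on the base chamber, one is a positive combination of the others and is crossed neither
    first nor last. The hyperplanes through X are thus crossed in one of two mutually opposite
    orders.

    The induction never passes to a quotient: it enlarges a set of hyperplanes inside one fixed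
    space and speaks only of normals, signs of forms and orderings. The same step serves for any
    modular flag and for the coordinate flags of types A and B. *)

Section Walks.

(** Recursion on the length makes concatenation, reversal and transport of walks short
    inductions. *)
Fixpoint nwalk {T : Type} (V : T -> Prop) (E : T -> T -> Prop) (n : nat)
    (x y : T) : Prop :=
  if n is n'.+1 then exists z, [/\ V x, E x z & nwalk V E n' z y]
  else V x /\ x = y.

Lemma nwalk_walk T (V : T -> Prop) E n x y :
  nwalk V E n x y <-> walk V E x y n.
Proof.
elim: n x => [|n IH] x /=.
  split=> [[Vx <-]|[[|x' [|? ?]] [] //= _ -> <- Vp _]].
    by exists [:: x]; split=> // -[].
  by split=> //; exact: (Vp 0%N).
split=> [[z [Vx Ez /IH[p [sp p0 pn Vp Ep]]]]|].
  have nthE j : (j <= n)%N -> nth x p j = nth z p j.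
    by move=> jn; apply: set_nth_default; rewrite sp.
  exists (x :: p); split=> //=; first by rewrite sp.
  - by rewrite nthE.
  - by case=> [|j] // jn; rewrite /= nthE //; exact: Vp.
  - case=> [|j] jn /=; first by rewrite nthE // p0.
    by rewrite !nthE // 1?ltnW //; exact: Ep.
case=> -[|x' p] [] //= [sp] -> pn Vp Ep.
have nthE j : (j <= n)%N -> nth x p j = nth (nth x p 0) p j.
  by move=> jn; apply: set_nth_default; rewrite sp.
exists (nth x p 0); split; [exact: (Vp 0%N)|exact: (Ep 0%N)|].
apply/IH; exists p; split=> //.
- by rewrite -[LHS]nthE.
- by rewrite -[LHS]nthE.
- by move=> j jn; rewrite -nthE //; exact: (Vp j.+1).
- by move=> j jn; rewrite -!nthE // 1?ltnW //; exact: (Ep j.+1).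
Qed.

Lemma nwalkL T (V : T -> Prop) E n x y : nwalk V E n x y -> V x.
Proof. by case: n => [|n] [] // z []. Qed.

Lemma nwalkR T (V : T -> Prop) E n x y : nwalk V E n x y -> V y.
Proof. by elim: n x => [|n IH] x /= [] => [|z [_ _ /IH]] // Vx <-. Qed.

Lemma nwalk_cat T (V : T -> Prop) E m n x y z :
  nwalk V E m x y -> nwalk V E n y z -> nwalk V E (m + n) x z.
Proof.
elim: m x => [|m IH] x /=; first by case=> _ ->.
by case=> t [Vx xt tn] yz; exists t; split=> //; exact: IH.
Qed.

Lemma nwalk_sym T (V : T -> Prop) (E : T -> T -> Prop) n x y :
  (forall x y, E x y -> E y x) -> nwalk V E n x y -> nwalk V E n y x.
Proof.
move=> Esym; elim: n x => [|n IH] x /=; first by case=> Vx <-.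
case=> t [Vx xt /IH yt]; rewrite -/(nwalk V E n.+1 y x) -[n.+1]addn1; apply: nwalk_cat (yt) _.
by exists x; split=> //; [exact: nwalkR yt|exact: Esym].
Qed.

Lemma nwalk_map T U (V : T -> Prop) (E : T -> T -> Prop)
    (V' : U -> Prop) (E' : U -> U -> Prop) (f : T -> U) n x y :
  (forall x, V x -> V' (f x)) ->
  (forall x y, V x -> V y -> E x y -> E' (f x) (f y)) ->
  nwalk V E n x y -> nwalk V' E' n (f x) (f y).
Proof.
move=> fV fE; elim: n x => [|n IH] x /=.
  by case=> Vx <-; split=> //; exact: fV.
case=> t [Vx xt ty]; exists (f t); split; [exact: fV| |exact: IH].
exact: fE (nwalkL ty) xt.
Qed.

End Walks.

(** * Orderings as sequences: positions, cuts and blocks *)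

Section Seqs.
Variable I : eqType.
Implicit Types (w u : seq I) (i j : I).

Definition before w i j := (index i w < index j w)%N.

(** Compares two cuts of one sequence; it locates the end of a prefix relative to the blocks of a
    rewritten ordering. *)
Lemma cat_eq_cat w1 w2 u1 u2 : w1 ++ w2 = u1 ++ u2 ->
  (exists t, u1 = w1 ++ t /\ w2 = t ++ u2) \/
  (exists t, w1 = u1 ++ t /\ u2 = t ++ w2).
Proof.
elim: w1 u1 => [|x w1 IH] [|y u1] /= => [<-|->|<-|[<- /IH]].
- by left; exists [::].
- by left; exists (y :: u1).
- by right; exists (x :: w1).
by case=> -[t [-> ->]]; [left|right]; exists t.
Qed.

Lemma before_cat u w i j : before (u ++ w) i j =
  if i \in u then (if j \in u then before u i j else true)
  else (if j \in u then false else before w i j).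
Proof.
rewrite /before !index_cat.
case: ifPn => iu; case: ifPn => ju //.
- by rewrite ltn_addr // index_mem.
- by rewrite ltnNge ltnW // ltn_addr // index_mem.
- by rewrite ltn_add2l.
Qed.

(** An absent element has the default index [size w], so it counts as coming after every element of
    [w]. *)
Lemma before_out w i j : i \notin w -> before w i j = false.
Proof. by move=> /memNindex iw; rewrite /before iw ltnNge index_size. Qed.

Lemma before_inout w i j : i \in w -> j \notin w -> before w i j.
Proof. by move=> iw /memNindex jw; rewrite /before jw index_mem. Qed.

Lemma before_total w i j : i \in w -> i != j -> before w j i = ~~ before w i j.
Proof.
move=> iw ij; rewrite /before -leqNgt ltn_neqAle; case: eqP => //= e.
by case: leqP => // _; move: (ij); rewrite (@index_inj _ i w j i) ?eqxx // -?index_mem ?e ?index_mem.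
Qed.

Lemma beforexx w i : before w i i = false.
Proof. by rewrite /before ltnn. Qed.

Lemma before_split w i j : uniq w -> j \in w -> before w i j ->
  exists w1 w2, [/\ w = w1 ++ w2, i \in w1, j \notin w1 & j \in w2].
Proof.
move=> uw jw ij.
have iw : i \in w by apply: contraLR ij => /before_out ->.
rewrite /before in ij; exists (take (index i w).+1 w), (drop (index i w).+1 w).
split; first by rewrite cat_take_drop.
- by rewrite in_take // ltnS.
- by rewrite in_take // ltnS -ltnNge.
- move: (jw); rewrite -{1}(cat_take_drop (index i w).+1 w) mem_cat in_take //.
  by rewrite ltnS leqNgt ij.
Qed.

(** The cut falls just after [i]: a point realizing the prefix [u] is already beyond [i], but not
    beyond anything later. *)
Lemma cut_after w i : exists u v, w = u ++ v /\
  forall j, j \in w -> (j \in u) = ~~ before w i j.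
Proof.
exists (take (index i w).+1 w), (drop (index i w).+1 w).
split=> [|j jw]; first by rewrite cat_take_drop.
by rewrite in_take // ltnS leqNgt.
Qed.

Lemma before_rev w i j : uniq w -> i \in w -> j \in w ->
  before (rev w) i j = before w j i.
Proof.
move=> uw iw jw; have [->|ij] := eqVneq i j; first by rewrite !beforexx.
have main x y : x \in w -> before w y x -> before (rev w) x y.
  move=> xw /(before_split uw xw)[w1 [w2 [e yw1 xw1 xw2]]].
  rewrite e rev_cat before_cat !mem_rev xw2; case: ifP => // yw2.
  by move: uw; rewrite e cat_uniq => /and3P[_ /hasPn/(_ _ yw2)]; rewrite /= yw1.
have [/(main _ _ iw)//|nb] := boolP (before w j i).
have := main j i jw; rewrite (before_total jw) 1?eq_sym // nb => /(_ isT).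
by rewrite (before_total (w := rev w)) ?mem_rev // => /negbTE.
Qed.

(** With [T] the fiber hyperplanes, [k] is the last base hyperplane that precedes a fiber one; the
    fiber hyperplanes still to come are then consecutive and form [y]. *)
Lemma split_last (T : pred I) w :
  (exists u v, [/\ w = u ++ v, all T u & all (predC T) v]) \/
  (exists u k y z, [/\ w = u ++ k :: y ++ z, ~~ T k, y != [::], all T y
                     & all (predC T) z]).
Proof.
elim: w => [|h w [[u [v [-> Tu Tv]]]|]]; first by left; exists [::], [::].
- have [Th|Th] := boolP (T h).
    by left; exists (h :: u), v; rewrite /= Th.
  case: u Tu => [|x u] Tu.
    by left; exists [::], (h :: v); rewrite /= Th.
  by right; exists [::], h, (x :: u), v.
- by case=> u [k [y [z [-> ? ? ? ?]]]]; right; exists (h :: u), k, y, z.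
Qed.

Lemma filter_prefix (D : pred I) (y : seq I) : uniq y ->
  (forall i j, j \in y -> ~~ D i -> D j -> ~~ before y i j) ->
  y = seq.filter D y ++ seq.filter (predC D) y.
Proof.
elim: y => [|h y IH] //= /andP[hy uy] HD.
have [Dh|Dh] /= := boolP (D h).
  rewrite -IH // => i j jy Di Dj.
  have := HD i j; rewrite inE jy orbT => /(_ isT Di Dj); rewrite /before /=.
  have -> : (h == i) = false by apply/eqP => e; rewrite -e Dh in Di.
  by have -> : (h == j) = false by apply/eqP => e; rewrite e jy in hy.
have noD : seq.filter D y = [::].
  apply/eqP; rewrite -[_ == _]negbK -has_filter; apply/hasPn => j jy.
  apply/negP => Dj; have := HD h j; rewrite inE jy orbT => /(_ isT Dh Dj).
  by rewrite /before /= eqxx; case: eqP => // e; rewrite -e (negbTE Dh) in Dj.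
rewrite noD /=; congr cons; apply/esym/all_filterP/allP => j jy /=.
apply/negP => Dj; have : j \in seq.filter D y by rewrite mem_filter Dj.
by rewrite noD.
Qed.

End Seqs.

(** * Linear forms on row vectors *)

Section Lform.
Import Order.TTheory GRing.Theory Num.Theory.
Local Open Scope ring_scope.
Variables (R : realType) (d : nat).
Implicit Types (u v x y : 'rV[R]_d) (c : R).

Lemma lformE v x : lform v x = \sum_k x 0 k * v 0 k.
Proof. by rewrite /lform mxE; apply: eq_bigr => k _; rewrite mxE. Qed.

Lemma lformC v x : lform v x = lform x v.
Proof. by rewrite !lformE; apply: eq_bigr => k _; rewrite mulrC. Qed.

Lemma lformDr v x y : lform v (x + y) = lform v x + lform v y.
Proof. by rewrite /lform mulmxDl mxE. Qed.

Lemma lformZr v c x : lform v (c *: x) = c * lform v x.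
Proof. by rewrite /lform -scalemxAl mxE. Qed.

Lemma lformDl u v x : lform (u + v) x = lform u x + lform v x.
Proof. by rewrite !(lformC _ x) lformDr. Qed.

Lemma lformZl v c x : lform (c *: v) x = c * lform v x.
Proof. by rewrite !(lformC _ x) lformZr. Qed.

Lemma lformNr v x : lform v (- x) = - lform v x.
Proof. by rewrite -scaleN1r lformZr mulN1r. Qed.

Lemma lformNl v x : lform (- v) x = - lform v x.
Proof. by rewrite !(lformC _ x) lformNr. Qed.

Lemma lform0r v : lform v 0 = 0.
Proof. by rewrite -(scale0r 0) lformZr mul0r. Qed.

Lemma span2P x u v :
  reflect (exists b c, x = b *: u + c *: v) (x \in <<[:: u; v]>>%VS).
Proof.
rewrite span_cons span_seq1; apply: (iffP memv_addP).
  by case=> ? /vlineP[b ->] [? /vlineP[c ->] ->]; exists b, c.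
by case=> b [c ->]; exists (b *: u); rewrite ?memvZ ?memv_line //;
  exists (c *: v); rewrite ?memvZ ?memv_line.
Qed.

(** Provides the parameter at which to stop on a line, between the crossings already made and those
    to come. *)
Lemma separating_value (A B : seq R) :
  (forall x y : R, x \in A -> y \in B -> x < y) ->
  exists c : R, (forall x : R, x \in A -> x < c) /\ (forall y : R, y \in B -> c < y).
Proof.
elim: A => [|x A IH] AB.
  elim: {AB} B => [|y B [c [_ cB]]]; first by exists 0%R.
  exists (Num.min c (y - 1))%R; split=> // z; rewrite inE => /orP[/eqP->|/cB cz];
    rewrite gt_min; apply/orP; [right; lra|by left].
have [|c [cA cB]] := IH; first by move=> y z yA; apply: AB; rewrite inE yA orbT.
have [cx|xc] := ltP x c.
  by exists c; split=> // z; rewrite inE => /orP[/eqP->|/cA].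
have {AB} xB (y : R) : y \in B -> x < y by apply: AB; rewrite inE eqxx.
have [e [e0 eB]] : exists e, x < e /\ (forall y : R, y \in B -> e < y).
  elim: B xB {cB IH} => [|y B IHB] xB; first by exists (x + 1)%R; split=> //; lra.
  have [|e [xe eB]] := IHB; first by move=> z zB; apply: xB; rewrite inE zB orbT.
  have xy := xB y (mem_head _ _).
  exists (Num.min e ((x + y) / 2))%R; split; first by rewrite lt_min xe /=; lra.
  by move=> z; rewrite inE gt_min => /orP[/eqP->|/eB->//]; apply/orP; right; lra.
exists e; split=> // z; rewrite inE => /orP[/eqP->//|/cA]; lra.
Qed.

End Lform.

(** * Orderings of the hyperplanes *)

Section Core.
Import Order.TTheory GRing.Theory Num.Theory.
Local Open Scope ring_scope.
Variables (R : realType) (d : nat) (I : finType) (a : I -> 'rV[R]_d).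

Implicit Types (X Y S : {set I}) (w : seq I) (i j k l : I).

(* The codimension 2 intersections X are encoded by the sets of hyperplanes that
   contain them, the rank 2 flats of the matroid of the normals. *)
Definition line i j : {set I} := [set k | a k \in <<[:: a i; a j]>>%VS].

Definition lines : {set {set I}} :=
  [set line p.1 p.2 | p in [set p : I * I | p.1 != p.2]].

(** Realizability of a sign vector. [P] may have elements outside [S], so that a prefix of a word on
    a larger set can be tested on [S] as it stands. *)
Definition real (S : {set I}) (P : seq I) (x : 'rV[R]_d) : Prop :=
  forall i, i \in S -> if i \in P then lform (a i) x < 0 else 0 < lform (a i) x.

(* Identifies a minimal gallery with the sequence of hyperplanes it crosses:
   each prefix has to be the set of hyperplanes separating a chamber from the
   base chamber, on which all the forms [a i] are positive. *)
Definition gword (S : {set I}) (w : seq I) : Prop :=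
  [/\ uniq w, w =i S & forall u v, w = u ++ v -> exists x, real S u x].

(** The two ways around a face of codimension 2. The block must be a whole flat; that both ends are
    realizable is left to the vertex condition of walks. *)
Definition flip (w w' : seq I) : Prop := exists u p v X,
  [/\ X \in lines, p =i X, w = u ++ p ++ v & w' = u ++ rev p ++ v].

Definition sepw (X : {set I}) (w w' : seq I) : bool :=
  [exists i in X, exists j in X, before w i j != before w' i j].

Definition sepn (w w' : seq I) : nat := #|[set X in lines | sepw X w w']|.

Lemma sepwP X w w' : reflect (exists i j, [/\ i \in X, j \in X &
  before w i j != before w' i j]) (sepw X w w').
Proof.
apply: (iffP existsP) => [[i /andP[iX /existsP[j /andP[jX ij]]]]|[i [j [iX jX ij]]]].
  by exists i, j.
by exists i; rewrite iX; apply/existsP; exists j; rewrite jX.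
Qed.

Lemma sepn_tri w w' w'' : (sepn w w'' <= sepn w w' + sepn w' w'')%N.
Proof.
apply: leq_trans (leq_card_setU _ _); apply/subset_leq_card/fintype.subsetP => X.
rewrite !inE => /andP[-> /=] /sepwP[i [j [iX jX]]] ij.
have [e|ne] := eqVneq (before w i j) (before w' i j).
  by apply/orP; right; apply/sepwP; exists i, j; rewrite -e.
by apply/orP; left; apply/sepwP; exists i, j.
Qed.

Hypothesis afree : forall i j, i != j -> free [:: a i; a j].

Lemma a_neq0 i j : i != j -> a j != 0.
Proof. by move=> /afree; rewrite free_cons seq1_free => /andP[]. Qed.

Lemma a_indep i j b c : i != j -> b *: a i + c *: a j = 0 -> b = 0 /\ c = 0.
Proof.
move=> ij; have /eqP := a_neq0 ij; have := afree ij; rewrite free_cons span_seq1.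
case/andP=> ai _ aj e; have b0 : b = 0.
  apply/eqP; apply: contraNT ai => b0; apply/vlineP; exists (- (b^-1 * c)).
  apply: (scalerI b0); rewrite scalerA mulrN mulrA mulfV // mul1r scaleNr.
  by apply/eqP; rewrite -subr_eq0 opprK e.
split=> //; move: e; rewrite b0 scale0r add0r => /eqP.
by rewrite scaler_eq0 => /orP[/eqP//|/eqP].
Qed.

Lemma lineP i j k :
  reflect (exists b c, a k = b *: a i + c *: a j) (k \in line i j).
Proof. by rewrite inE; exact: span2P. Qed.

Lemma line_l i j : i \in line i j.
Proof. by apply/lineP; exists 1, 0; rewrite scale1r scale0r addr0. Qed.

Lemma line_r i j : j \in line i j.
Proof. by apply/lineP; exists 0, 1; rewrite scale1r scale0r add0r. Qed.

Lemma lineC i j : line i j = line j i.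
Proof.
apply/setP => k; apply/lineP/lineP => -[b [c ->]]; exists c, b; exact: addrC.
Qed.

Lemma line_eq i j k l : i != j -> k != l -> k \in line i j -> l \in line i j ->
  line k l = line i j.
Proof.
rewrite !inE => ij kl ka la.
suff e : <<[:: a k; a l]>>%VS = <<[:: a i; a j]>>%VS.
  by apply/setP => x; rewrite !inE e.
apply/eqP; rewrite eqEdim; apply/andP; split.
  by rewrite span_cons span_seq1 subv_add -!memvE ka la.
by have := afree ij; have := afree kl; rewrite /free => /eqP-> /eqP->.
Qed.

Lemma linesP X : reflect (exists i j, i != j /\ X = line i j) (X \in lines).
Proof.
apply: (iffP imsetP) => [[[i j]]|[i [j [ij ->]]]]; first by rewrite inE; exists i, j.
by exists (i, j); rewrite ?inE.
Qed.

Lemma lines_eq X i j : X \in lines -> i != j -> i \in X -> j \in X ->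
  X = line i j.
Proof.
by case/linesP => k [l [kl ->]] ij iX jX; rewrite (line_eq kl ij).
Qed.

Lemma line_lines i j : i != j -> line i j \in lines.
Proof. by move=> ij; apply/linesP; exists i, j. Qed.

Lemma flip_sym w w' : flip w w' -> flip w' w.
Proof.
case=> u [p [v [X [XL pX -> ->]]]]; exists u, (rev p), v, X; split=> //.
  by move=> i; rewrite mem_rev.
by rewrite revK.
Qed.

Lemma flip_rev w w' : flip w w' -> flip (rev w) (rev w').
Proof.
case=> u [p [v [X [XL pX -> ->]]]]; exists (rev v), (rev p), (rev u), X.
by split=> [//|i||]; rewrite ?mem_rev // !rev_cat catA.
Qed.

(** The antipodal map: a prefix of the reversed word is the complement of a prefix of [w], and is
    realized by the opposite point. *)
Lemma gword_rev S w : gword S w -> gword S (rev w).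
Proof.
case=> uw wS gw; split=> [|i|u v e]; rewrite ?rev_uniq ?mem_rev //.
have {}e : w = rev v ++ rev u by rewrite -rev_cat -e revK.
have [x xr] := gw _ _ e; exists (- x) => i iS; have := xr i iS.
rewrite lformNr oppr_gt0 oppr_lt0.
have : i \in w by rewrite wS.
move: uw; rewrite e cat_uniq mem_cat !mem_rev => /and3P[_ /hasPn nd _].
case: ifPn => [iv _|iv /= iu]; last by rewrite iu.
by case: ifPn => // iu; have /= := nd i; rewrite !mem_rev iu iv => /(_ isT).
Qed.

Lemma before_flip u p v i j : uniq (u ++ p ++ v) ->
  before (u ++ rev p ++ v) i j = if (i \in p) && (j \in p) then before p j i
                                 else before (u ++ p ++ v) i j.
Proof.
rewrite !cat_uniq !has_cat negb_or => /and5P[_ /andP[/hasPn nd _] up _ _].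
rewrite !before_cat !mem_rev.
have [ip|ip] := boolP (i \in p); have [jp|jp] //= := boolP (j \in p).
by rewrite (negbTE (nd _ ip)) (negbTE (nd _ jp)) before_rev.
Qed.

(** Two elements of the reversed block already determine [X], so no other flat sees a change. *)
Lemma flip_sep S w w' : gword S w -> flip w w' -> sepn w w' = 1%N.
Proof.
case=> uw _ _ [u [p [v [X [XL pX e e']]]]]; rewrite e in uw.
apply/eqP/cards1P; exists X; apply/setP => Y; rewrite !inE.
have /and5P[_ nd up _ _] : [&& uniq u, ~~ has (in_mem^~ (mem u)) (p ++ v), uniq p,
  ~~ has (in_mem^~ (mem p)) v & uniq v] by move: uw; rewrite !cat_uniq.
apply/andP/eqP => [[YL /sepwP[i [j [iY jY]]]]|-> {Y}].
  rewrite e e' (before_flip _ _ uw); case: ifP => [/andP[ip jp]|]; last by rewrite eqxx.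
  have [->|ij _] := eqVneq i j; first by rewrite !beforexx.
  by rewrite (lines_eq YL ij) // (lines_eq XL ij) // -pX.
split=> //; have /linesP[i [j [ij eX]]] := XL.
have ip : i \in p by rewrite pX eX line_l.
have jp : j \in p by rewrite pX eX line_r.
apply/sepwP; exists i, j; split; rewrite -?pX // e e' (before_flip _ _ uw) ip jp /=.
move: nd; rewrite has_cat negb_or => /andP[/hasPn nd _].
rewrite !before_cat ip jp (negbTE (nd _ ip)) (negbTE (nd _ jp)) (before_total ip) //.
by case: before.
Qed.

Lemma sepw_rev S X w : gword S w -> X \in lines -> X \subset S -> sepw X w (rev w).
Proof.
case=> uw wS _ /linesP[i [j [ij ->]]] /fintype.subsetP XS.
have iw : i \in w by rewrite wS XS ?line_l.
have jw : j \in w by rewrite wS XS ?line_r.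
apply/sepwP; exists i, j; rewrite line_l line_r; split=> //.
by rewrite before_rev // (before_total iw ij); case: before.
Qed.

(* Of three coplanar vectors in an open half space one is a positive
   combination of the two others. *)
Lemma middle x0 i j k : (forall i, 0 < lform (a i) x0) ->
  i != j -> k != i -> k != j -> k \in line i j ->
  exists m l r, [/\ perm_eq [:: m; l; r] [:: i; j; k] &
    exists b c, [/\ 0 < b, 0 < c & a m = b *: a l + c *: a r]].
Proof.
move=> x0P ij ki kj /lineP[b [c e]].
have b0 : b != 0.
  apply/eqP => b0; have [|+ _] := @a_indep k j 1 (- c) kj.
    by rewrite e b0 scale0r add0r scale1r scaleNr subrr.
  by move=> /eqP; rewrite oner_eq0.
have c0 : c != 0.
  apply/eqP => c0; have [|+ _] := @a_indep k i 1 (- b) ki.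
    by rewrite e c0 scale0r addr0 scale1r scaleNr subrr.
  by move=> /eqP; rewrite oner_eq0.
have := x0P k; rewrite e lformDl !lformZl; have := x0P i; have := x0P j.
move: (lform (a i) x0) (lform (a j) x0) => p q q0 p0 s0.
(* The signs of [b] and [c] tell which of the three vectors is the middle one; positivity at [x0]
   excludes that neither is positive. *)
have [bp|bn] := ltP 0 b; have [cp|cn] := ltP 0 c.
- exists k, i, j; split; last by exists b, c.
  by apply/seq.permP => P /=; rewrite !addn0 addnC -addnA.
- exists i, k, j; split; first by apply/seq.permP => P /=; rewrite !addn0 [(P k + _)%N]addnC.
  exists b^-1, (- (b^-1 * c)); split; rewrite ?invr_gt0 // ?oppr_gt0.
    by rewrite pmulr_rlt0 ?invr_gt0 // lt_neqAle c0.
  by rewrite e scalerDr !scalerA mulVf // scale1r scaleNr addrK.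
- exists j, i, k; split; first by apply/seq.permP => P /=; rewrite addnCA.
  exists (- (c^-1 * b)), c^-1; split; rewrite ?invr_gt0 // ?oppr_gt0.
    by rewrite pmulr_rlt0 ?invr_gt0 // lt_neqAle b0.
  by rewrite e scalerDr !scalerA mulVf // scale1r scaleNr addrA addNr add0r.
- by move: s0; rewrite ltNge -oppr_ge0 opprD addr_ge0 // oppr_ge0 mulr_le0_ge0 // ltW.
Qed.

(** Right after [m] is crossed its form is negative, so those of [l] and [r] cannot both be
    positive: [m] does not precede both. Reversing the word, it does not follow both. *)
Lemma middle_before S w l m r b c : gword S w ->
  l \in S -> m \in S -> r \in S -> l != m -> m != r ->
  0 < b -> 0 < c -> a m = b *: a l + c *: a r ->
  before w m r = before w l m /\ before w l r = before w l m.
Proof.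
move=> gw lS mS rS lm mr b0 c0 e.
have notfirst w' : gword S w' -> before w' m l -> before w' m r -> False.
  case=> uw wS gw' ml mr'; have [u [v [/gw'[x xr] uE]]] := cut_after w' m.
  have := xr m mS; have := xr l lS; have := xr r rS.
  rewrite !uE ?wS // beforexx ml mr' /= e lformDl !lformZl => r0 l0.
  by rewrite ltNge addr_ge0 // mulr_ge0 // ltW.
have [lw mw rw] : [/\ l \in w, m \in w & r \in w] by case: gw => _ wS _; rewrite !wS.
have [uw _ _] := gw.
have nf := notfirst _ gw.
have := notfirst _ (gword_rev gw); rewrite !before_rev // => nl.
move: nf nl; rewrite (before_total lw lm) (before_total mw mr).
rewrite /before; case: ltnP => h1; case: ltnP => h2 /= nf nl; split=> //;
  do ?[by case: nf|by case: nl].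
- exact: ltn_trans h1 h2.
- by apply/negbTE; rewrite -leqNgt (leq_trans h2 h1).
Qed.

(** [eps] tells whether the two words order a pair of [X] alike. It takes the same value on all
    pairs, since any two pairs are joined through triples; reversing one word changes this value. *)
Lemma two_orders S w w' X x0 : (forall i, 0 < lform (a i) x0) ->
  gword S w -> gword S w' -> X \in lines -> X \subset S ->
  sepw X w w' -> sepw X (rev w) w' -> False.
Proof.
move=> x0P gw gw' XL XS.
pose eps i j := before w i j == before w' i j.
have inw i : i \in X -> i \in w by case: gw => _ -> _; move/fintype.subsetP: XS; exact.
have inw' i : i \in X -> i \in w' by case: gw' => _ -> _; move/fintype.subsetP: XS; exact.
have epsC i j : i \in X -> j \in X -> eps j i = eps i j.
  move=> iX jX; have [->//|ij] := eqVneq i j.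
  rewrite /eps (before_total (inw i iX) ij) (before_total (inw' i iX) ij).
  by case: before; case: before.
(* Within a triple the order of one pair determines the two others, in both words by the same
   rule. *)
have eps3 i j k : i \in X -> j \in X -> k \in X -> i != j -> k != i -> k != j ->
    eps i k = eps i j.
  move=> iX jX kX ij ki kj.
  have kij : k \in line i j by rewrite -(lines_eq XL ij).
  have [m [l [r [p [b [c [b0 c0 e]]]]]]] := middle x0P ij ki kj kij.
  have uq : uniq [:: m; l; r].
    by rewrite (perm_uniq p) /= !inE negb_or ij [i == k]eq_sym [j == k]eq_sym ki kj.
  have inX z : z \in [:: m; l; r] -> z \in X.
    by rewrite (perm_mem p) !inE => /or3P[] /eqP->.
  have [mX lX rX] : [/\ m \in X, l \in X & r \in X].
    by split; apply: inX; rewrite !inE eqxx ?orbT.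
  have sub := fintype.subsetP XS.
  have [ml [mr lr]] : m != l /\ m != r /\ l != r.
    by move: uq; rewrite /= !inE negb_or => /and3P[/andP[-> ->] -> _].
  have lm : l != m by rewrite eq_sym.
  have [e1 e2] := middle_before gw (sub _ lX) (sub _ mX) (sub _ rX) lm mr b0 c0 e.
  have [e1' e2'] := middle_before gw' (sub _ lX) (sub _ mX) (sub _ rX) lm mr b0 c0 e.
  have E1 : eps m r = eps l m by rewrite /eps e1 e1'.
  have E2 : eps l r = eps l m by rewrite /eps e2 e2'.
  have all2 x y : x \in [:: m; l; r] -> y \in [:: m; l; r] -> x != y -> eps x y = eps l m.
    rewrite !inE => /or3P[] /eqP-> /or3P[] /eqP->; rewrite ?eqxx // => _.
    - exact: epsC.
    - by rewrite epsC // E1.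
    - by rewrite epsC // E2.
  by rewrite (all2 i k) ?(all2 i j) // ?(perm_mem p) ?inE ?eqxx ?orbT // eq_sym.
case/sepwP=> i [j [iX jX]]; rewrite -[_ == _]/(eps i j) => nij.
case/sepwP=> k [l [kX lX]]; have [->|kl] := eqVneq k l.
  by rewrite !beforexx eqxx.
have ij : i != j by apply: contraNneq nij => ->; rewrite /eps !beforexx.
have [uw _ _] := gw.
rewrite before_rev ?inw // (before_total (inw k kX) kl) => neg.
have {neg} : eps k l by rewrite /eps; case: before neg; case: before.
suff -> : eps k l = eps i j by rewrite (negbTE nij).
have one x y z : x \in X -> y \in X -> z \in X -> x != y -> z != x -> eps x z = eps x y.
  by move=> xX yX zX xy zx; have [->//|zy] := eqVneq z y; exact: eps3.
have [li|li] := eqVneq l i; first by rewrite li in kl *; rewrite -epsC // (one i j k).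
by rewrite -epsC // (one l i k) // 1?epsC // (one i j l).
Qed.

(* Some gallery is joined to every other one by a walk which is as short as the
   number of separating flats allows. *)
Definition core S : Prop := exists r, gword S r /\
  forall w, gword S w -> exists2 n, (n <= sepn w r)%N & nwalk (gword S) flip n w r.

Lemma core0 : core finset.set0.
Proof.
have gw0 : gword finset.set0 [::].
  split=> [//|i|u v _]; first by rewrite finset.in_set0.
  by exists 0 => i; rewrite finset.in_set0.
exists [::]; split=> // w [_ wS _]; exists 0%N => //=.
suff -> : w = [::] by [].
by case: w wS => // i w /(_ i); rewrite finset.in_set0 mem_head.
Qed.

(** * One step of the flag: fiber hyperplanes [T] added to base hyperplanes [B] *)

Section Step.
Variables (S B : {set I}) (v x0 : 'rV[R]_d).
Hypothesis BS : B \subset S.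
Let T := S :\: B.
Hypothesis x0P : forall i, 0 < lform (a i) x0.
Hypothesis Sclosed : forall i j, i \in S -> j \in S -> line i j \subset S.
Hypothesis Bv : forall i, i \in B -> lform (a i) v = 0.
Hypothesis Tv : forall i, i \in T -> 0 < lform (a i) v.
(** Modularity read on normals: a hyperplane contains the intersection of those of [i] and [j] when
    its normal lies in the span of theirs. *)
Hypothesis Tline : forall i j, i \in T -> j \in T -> i != j ->
  exists2 k, k \in B & k \in line i j.

(* The line [x + R v] meets the hyperplane of [i \in T] at [x - val i x *: v]. *)
Let val i x := lform (a i) x / lform (a i) v.

Let TS i : i \in T -> i \in S.
Proof. by rewrite inE => /andP[]. Qed.

Let TB i : i \in T -> (i \in B) = false.
Proof. by rewrite inE => /andP[/negbTE]. Qed.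

Let STB i : i \in S -> i \in T = (i \notin B).
Proof. by rewrite inE => ->; rewrite andbT. Qed.

Let BSi i : i \in B -> i \in S.
Proof. exact: (fintype.subsetP BS). Qed.

Let BT i j : i \in B -> j \in T -> i != j.
Proof. by move=> iB jT; apply/eqP => e; move: (TB jT); rewrite -e iB. Qed.

(** A combination of [a i] and [a j] that vanishes at [v] is proportional to the difference of the
    two forms normalized by their values at [v]. *)
Lemma base_form i j k : i \in T -> j \in T -> i != j -> k \in B -> k \in line i j ->
  exists2 g, g != 0 & forall x, lform (a k) x = g * (val i x - val j x).
Proof.
move=> iT jT ij kB /lineP[b [c e]].
have pi := Tv iT; have pj := Tv jT.
have := Bv kB; rewrite e lformDl !lformZl => /eqP; rewrite addrC addr_eq0 => /eqP ev.
exists (b * lform (a i) v).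
  rewrite mulf_neq0 ?(gt_eqF pi) //; apply/eqP => b0; move/eqP: ev.
  rewrite b0 mul0r oppr0 mulf_eq0 (gt_eqF pj) orbF => /eqP c0.
  have ik : i != k by rewrite eq_sym (BT kB iT).
  by have := a_neq0 ik; rewrite e b0 c0 !scale0r addr0 eqxx.
move=> x; rewrite lformDl !lformZl /val.
move: pi pj ev (lform (a i) x) (lform (a j) x).
move: (lform (a i) v) (lform (a j) v) => p q p0 q0 ev y z.
have {ev} -> : c = - (b * p) / q by rewrite -ev mulfK ?gt_eqF.
by field; rewrite !gt_eqF.
Qed.

Lemma val_lt_same i j k x y : i \in T -> j \in T -> i != j -> k \in B -> k \in line i j ->
  0 < lform (a k) x * lform (a k) y -> (val i x < val j x) = (val i y < val j y).
Proof.
move=> iT jT ij kB kl; have [g g0 E] := base_form iT jT ij kB kl.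
have gg : 0 < g * g by rewrite lt0r mulf_neq0 //= -expr2 sqr_ge0.
rewrite !E mulrACA pmulr_rgt0 //.
rewrite -[val i x < _]subr_lt0 -[val i y < _]subr_lt0.
move: (val i x - _) (val i y - _) => p q.
have [p0|p0|->] := ltrgt0P p; last by rewrite mul0r ltxx.
  by rewrite pmulr_rgt0 // => q0; rewrite (lt_gtF q0).
by rewrite nmulr_rgt0.
Qed.

Lemma val_lt_opp i j k x y : i \in T -> j \in T -> i != j -> k \in B -> k \in line i j ->
  lform (a k) x * lform (a k) y < 0 -> (val i x < val j x) = (val j y < val i y).
Proof.
move=> iT jT ij kB kl; have [g g0 E] := base_form iT jT ij kB kl.
have gg : 0 < g * g by rewrite lt0r mulf_neq0 //= -expr2 sqr_ge0.
rewrite !E mulrACA pmulr_rlt0 //.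
rewrite -[val i x < _]subr_lt0 -[val j y < _]subr_gt0.
move: (val i x - _) (val i y - _) => p q.
have [p0|p0|->] := ltrgt0P p; last by rewrite mul0r ltxx.
  by rewrite pmulr_rlt0 // => q0; rewrite (lt_gtF q0).
by rewrite nmulr_rlt0.
Qed.

Lemma real_sub S' P x : S' \subset S -> real S P x -> real S' P x.
Proof. by move=> /fintype.subsetP SS xr i /SS; exact: xr. Qed.

Lemma real_eq S' P P' x : {in S', P =i P'} -> real S' P x -> real S' P' x.
Proof. by move=> PP xr i iS; rewrite -PP //; exact: xr. Qed.

Lemma real_same i P x y : i \in B -> real B P x -> real B P y ->
  0 < lform (a i) x * lform (a i) y.
Proof.
move=> iB /(_ i iB) + /(_ i iB); case: ifP => _ x0' y0; [by rewrite nmulr_rgt0|exact: mulr_gt0].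
Qed.

(** At [x] itself [val i] is negative and [val j] positive; their order is the same at [y], which
    lies in the same base chamber. *)
Lemma val_prefix P P' x y i j : i \in T -> j \in T -> i \in P -> j \notin P ->
  real S P x -> {in B, P =i P'} -> real B P' y -> val i y < val j y.
Proof.
move=> iT jT iP jP xr PP yr; have ij : i != j by apply: contraNneq jP => <-.
have [k kB kl] := Tline iT jT ij.
have xr' : real B P' x by apply: real_eq PP _; exact: real_sub BS xr.
rewrite -(val_lt_same iT jT ij kB kl (real_same kB xr' yr)).
have := xr i (TS iT); have := xr j (TS jT); rewrite iP (negbTE jP) => j0 i0.
apply: (@lt_trans _ _ 0); last by rewrite divr_gt0 ?Tv.
by rewrite pmulr_llt0 ?invr_gt0 ?Tv.
Qed.

(** Moving [x] along [v] keeps the base signs and shifts all values together, so it is enough to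
    stop between the values of [P] and the others. *)
Lemma real_lift P x : real B P x ->
  (forall i j, i \in T -> j \in T -> i \in P -> j \notin P -> val i x < val j x) ->
  exists y, real S P y.
Proof.
move=> xr xv.
have [|c [cP cN]] := @separating_value R [seq val i x | i <- enum T & i \in P]
    [seq val i x | i <- enum T & i \notin P].
  move=> _ _ /mapP[i + ->] /mapP[j + ->].
  rewrite mem_filter mem_enum => /andP[iP iT].
  by rewrite mem_filter mem_enum => /andP[jP jT]; exact: xv.
exists (x - c *: v) => i iS; rewrite lformDr lformNr lformZr.
have [iB|iB] := boolP (i \in B); first by rewrite Bv // mulr0 subr0; exact: xr.
have iT : i \in T by rewrite STB.
have -> : lform (a i) x - c * lform (a i) v = (val i x - c) * lform (a i) v.
  by rewrite mulrBl /val divfK // gt_eqF // Tv.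
case: ifPn => iP.
  rewrite pmulr_llt0 ?Tv // subr_lt0 cP //; apply/mapP; exists i => //.
  by rewrite mem_filter iP mem_enum.
rewrite pmulr_lgt0 ?Tv // subr_gt0 cN //; apply/mapP; exists i => //.
by rewrite mem_filter iP mem_enum.
Qed.

Let Tfirst r := forall i j, i \in T -> j \in B -> before r i j.

(** While the fiber hyperplanes are being crossed no base hyperplane has been, so their order can be
    read at [x0]. *)
Lemma Tfirst_val r i j : gword S r -> Tfirst r -> i \in T -> j \in T ->
  before r i j -> val i x0 < val j x0.
Proof.
move=> [ur rS gr] Tr iT jT ij; have [u [t [e uE]]] := cut_after r i.
have [x xr] := gr _ _ e.
apply: (@val_prefix u [::] x) => //.
- by rewrite uE ?rS ?TS // beforexx.
- by rewrite uE ?rS ?TS // ij.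
- by move=> k kB; rewrite uE ?rS ?BSi // Tr.
- by move=> k kB; rewrite in_nil x0P.
Qed.

(** A combination of [a k] and [a j] that vanishes at [v] has no component along [a j]. *)
Lemma line_base k j l : k \in B -> j \in T -> l \in B -> l \in line k j -> l = k.
Proof.
move=> kB jT lB /lineP[b [c e]]; have := Bv lB.
rewrite e lformDl !lformZl (Bv kB) mulr0 add0r => /eqP.
rewrite mulf_eq0 (gt_eqF (Tv jT)) orbF => /eqP c0.
apply/eqP; apply: contraT => lk; have [|+ _] := @a_indep l k 1 (- b) lk.
  by rewrite e c0 scale0r addr0 scale1r scaleNr subrr.
by move=> /eqP; rewrite oner_eq0.
Qed.

(* The last base hyperplane [k] crossed before some fiber hyperplane is
   followed by all the remaining fiber hyperplanes; those of them that contain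
   the codimension 2 subspace spanned with the first one come first, and can be
   moved in reverse order before [k]. *)
Lemma descent w r u k y z : gword S w -> gword S r -> Tfirst r ->
  w = u ++ k :: y ++ z -> k \notin T -> y != [::] -> {subset y <= T} ->
  (forall i, i \in z -> i \notin T) ->
  exists w', [/\ gword S w', flip w w' & (sepn w' r < sepn w r)%N].
Proof.
move=> gww gr Tr ew kT y0 yT zT; have [uw wS gw] := gww; have [ur rS _] := gr.
have kB : k \in B.
  by have := STB (i := k); rewrite (negbTE kT) -wS ew mem_cat mem_head orbT => /(_ isT); case: (k \in B).
move: (uw); rewrite ew cat_uniq /= has_cat !negb_or mem_cat negb_or.
case/and3P=> _ /and3P[ku /hasPn yu _] /andP[/andP[ky kz] uyz].
have uy : uniq y by move: uyz; rewrite cat_uniq => /andP[].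
have Ty i : i \in T -> i \notin u -> i \in y.
  move=> iT iu; have : i \in w by rewrite wS TS.
  rewrite ew mem_cat (negbTE iu) inE mem_cat /= => /or3P[/eqP ik|//|iz].
    by rewrite -ik iT in kT.
  by rewrite (negbTE (zT _ iz)) in iT.
(* [x] and [x'] lie in the chambers just before and just after the crossing of [k]. *)
have [x xr] := gw _ _ ew.
have [x' xr'] : exists x', real S (rcons u k) x' by apply: (gw _ (y ++ z)); rewrite cat_rcons.
have kx : 0 < lform (a k) x by have := xr k (BSi kB); rewrite (negbTE ku).
have kx' : lform (a k) x' < 0.
  by have := xr' k (BSi kB); rewrite mem_rcons mem_head.
have bs j : j \in B -> j != k -> 0 < lform (a j) x * lform (a j) x'.
  move=> jB jk; have := xr' j (BSi jB); have := xr j (BSi jB).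
  rewrite mem_rcons inE (negbTE jk) /=.
  by case: ifP => _ lx lx'; [rewrite nmulr_rgt0|exact: mulr_gt0].
have F1 i j : i \in T -> i \in u -> j \in y -> val i x < val j x /\ val i x' < val j x'.
  move=> iT iu jy; have ju : j \notin u by exact: yu.
  have jk : j != k by rewrite eq_sym; apply: BT => //; exact: yT.
  split; [apply: (val_prefix (P := u) _ _ _ _ xr)|
          apply: (val_prefix (P := rcons u k) _ _ _ _ xr')] => //; try exact: yT.
  - exact: real_sub xr.
  - by rewrite mem_rcons inE iu orbT.
  - by rewrite mem_rcons inE negb_or jk.
  - exact: real_sub xr'.
(* No base hyperplane is crossed along [y], which is therefore sorted by the values at [x']. *)
have F2 i j : i \in y -> j \in y -> before y i j -> val i x' < val j x'.
  move=> iy jy ij; have [y1 [y2 [ey y1E]]] := cut_after y i.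
  have [t tr] : exists t, real S (rcons u k ++ y1) t.
    by apply: (gw _ (y2 ++ z)); rewrite ew ey cat_rcons -!catA.
  apply: (val_prefix (P := rcons u k ++ y1) (P' := rcons u k) _ _ _ _ tr);
    try exact: yT.
  - by rewrite mem_cat y1E // beforexx orbT.
  - rewrite mem_cat mem_rcons inE !negb_or y1E // ij eq_sym BT ?yT //=.
    by rewrite andbT; exact: yu.
  - move=> l lB; rewrite mem_cat; case: (l \in rcons _ _) => //=.
    apply/negP => ly1; have : l \in T by apply: yT; rewrite ey mem_cat ly1.
    by move=> /TB; rewrite lB.
  - exact: real_sub xr'.
have [h hy hfirst] : exists2 h, h \in y & forall i, h != i -> before y h i.
  case: (y) y0 => // h y' _; exists h; rewrite ?mem_head // => i hi.
  by rewrite /before /= eqxx (negbTE hi).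
have hT := yT _ hy; have kh := BT kB hT.
pose X := line k h; pose D := [pred i in T | i \in X].
have XL : X \in lines by exact: line_lines.
have Dk i : D i -> line k i = X.
  by move=> /andP[iT iX]; rewrite (line_eq kh) ?line_l // BT.
(* Pairs in [D] are decided by [k], hence reversed between [x] and [x']. *)
have F3 i j s : D i -> D j -> i != j -> lform (a k) x * lform (a k) s < 0 ->
    (val i x < val j x) = (val j s < val i s).
  move=> /andP[iT iX] /andP[jT jX] ij; apply: (val_lt_opp iT jT ij kB).
  by rewrite (line_eq kh ij iX jX) line_l.
have F3' i j s : D i -> D j -> i != j -> 0 < lform (a k) x * lform (a k) s ->
    (val i x < val j x) = (val i s < val j s).
  move=> /andP[iT iX] /andP[jT jX] ij; apply: (val_lt_same iT jT ij kB).
  by rewrite (line_eq kh ij iX jX) line_l.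
have kxx' : lform (a k) x * lform (a k) x' < 0 by rewrite pmulr_rlt0.
(* A pair with just one element in [D] is decided by a base hyperplane other than [k]: with [k] on
   its flat, the second element would also be in [X]. *)
have F4 i j : D i -> j \in T -> ~~ D j -> (val i x < val j x) = (val i x' < val j x') /\
    (val j x < val i x) = (val j x' < val i x').
  move=> Di jT; rewrite /D /= jT /= => jX; have /andP[iT iX] := Di.
  have ij : i != j by apply: contraNneq jX => <-.
  have [l lB lij] := Tline iT jT ij.
  have lk : 0 < lform (a l) x * lform (a l) x'; last first.
    split; first exact: (val_lt_same iT jT ij lB lij).
    by apply: (val_lt_same jT iT _ lB _ lk); rewrite 1?eq_sym // lineC.
  apply: bs => //; apply: contraNneq jX => lk; rewrite -(Dk i Di) -lk.
  by rewrite (line_eq ij) ?line_r ?line_l // BT.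
have Dh : D h by rewrite /D /= hT line_r.
(* An element of [D] crossed before [k] would precede [h] both at [x] and at [x'], whereas [k]
   reverses this pair. *)
have Dy i : D i -> i \in y.
  move=> Di; have /andP[iT iX] := Di; apply: Ty => //; apply/negP => iu.
  have [l1 l2] := F1 i h iT iu hy.
  have ih : i != h.
    by apply: contraTneq iu => ->; exact: yu.
  by move: l1; rewrite (F3 i h x') // ltNge ltW.
(* [D] is a prefix of [y]: some [i] outside [D] between [h] and [j] would stay between them at [x],
   so the pair [h], [j] would not be reversed. *)
have [p [q [ey pD]]] : exists p q, y = p ++ q /\ forall i, (i \in p) = D i.
  exists [seq i <- y | D i], [seq i <- y | predC D i]; split.
  - apply: filter_prefix => // i j jy nDi Dj; apply/negP => ij.
    have iy : i \in y.
      by apply: contraLR ij => /before_out->.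
    have hi : h != i by apply: contraNneq nDi => <-.
    have hj := hfirst i hi.
    have jh : h != j.
      by apply: contraTneq ij => <-; rewrite (before_total hy hi) hj.
    have v1 : val h x < val i x by have [-> _] := F4 h i Dh (yT _ iy) nDi; exact: F2.
    have v2 : val i x < val j x.
      by have [_ ->] := F4 j i Dj (yT _ iy) nDi; exact: F2.
    have := F3 _ _ x' Dh Dj jh kxx'; rewrite (lt_trans v1 v2).
    by move=> /esym; rewrite ltNge ltW // F2 // hfirst.
  - by move=> i; rewrite mem_filter; case Di : (D i) => //=; rewrite Dy.
have py i : i \in p -> i \in y by rewrite ey mem_cat => ->.
have pT i : i \in p -> i \in T by move=> /py; exact: yT.
have kp : k \notin p by apply: contra ky; exact: py.
have up : uniq p by move: uy; rewrite ey cat_uniq => /andP[].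
have XE i : i \in X -> i != k -> i \in p.
  move=> iX ik; rewrite pD /D /= iX andbT STB.
    by apply: contra ik => iB; apply/eqP; exact: line_base iX.
  by have /fintype.subsetP -> := Sclosed (BSi kB) (TS hT).
have pX : k :: p =i X.
  move=> i; rewrite inE; have [->|ik] /= := eqVneq i k; first by rewrite line_l.
  by apply/idP/idP => [|iX]; [rewrite pD => /andP[]|exact: XE].
have before_p i j : i \in p -> j \in p -> i != j -> before p i j -> val j x < val i x.
  move=> ip jp ij bij; have Di : D i by rewrite -pD.
  have Dj : D j by rewrite -pD.
  rewrite (F3 j i x') // 1?eq_sym //; apply: F2; rewrite ?py //.
  by rewrite ey before_cat ip jp.
pose w' := u ++ rev (k :: p) ++ (q ++ z).
have ew2 : w = u ++ (k :: p) ++ (q ++ z) by rewrite ew ey -!catA.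
have uw2 : uniq (u ++ (k :: p) ++ (q ++ z)) by rewrite -ew2.
have fl : flip w w' by exists u, (k :: p), (q ++ z), X.
exists w'; rewrite -ew; split=> //.
  (* With [k] not yet crossed, the cut is made on the parallel to [v] through [x], where [u] comes
     first and [rev p] follows by increasing values, before the rest of [y]. *)
  have b1 s1 t1 : rev p = s1 ++ t1 -> exists t, real S (u ++ s1) t.
    move=> es; have s1p i : i \in s1 -> i \in p.
      by move=> is1; rewrite -mem_rev es mem_cat is1.
    have t1p i : i \in t1 -> i \in p.
      by move=> it1; rewrite -mem_rev es mem_cat it1 orbT.
    apply: (@real_lift _ x).
      apply: (real_eq (P := u)); last exact: real_sub xr.
      move=> i iB; rewrite mem_cat; case: (i \in u) => //=.
      by apply/esym/negP => /s1p/pT/TB; rewrite iB.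
    move=> i j iT jT; rewrite !mem_cat negb_or => + /andP[ju js1].
    have jy := Ty _ jT ju.
    case iu : (i \in u) => /=; first by case: (F1 _ _ iT iu jy).
    move=> is1; have ip := s1p _ is1; have Di : D i by rewrite -pD.
    have [Dj|nDj] := boolP (D j).
      have jp : j \in p by rewrite pD.
      have jt1 : j \in t1.
        by move: jp; rewrite -mem_rev es mem_cat (negbTE js1).
      apply: before_p => //; first by apply: contraNneq js1 => ->.
      have -> : p = rev t1 ++ rev s1 by rewrite -rev_cat -es revK.
      rewrite before_cat !mem_rev jt1; case: ifPn => // it1.
      by move: up; rewrite -rev_uniq es cat_uniq => /and3P[_ /hasPn/(_ _ it1)]; rewrite /= is1.
    have [-> _] := F4 i j Di jT nDj; apply: F2 => //; first exact: py.
    rewrite ey before_cat ip; case: ifP => // jp.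
    by move: nDj; rewrite -pD jp.
  have pw : perm_eq w' w.
    by rewrite ew2 perm_cat2l perm_cat2r perm_rev.
  split; [by rewrite (perm_uniq pw)|by move=> i; rewrite (perm_mem pw) wS|].
  (* A cut of [w'] falls inside [u], inside [rev p], or after [k]; in the last case the prefix has
     the same elements as a prefix of [w]. *)
  move=> s t; rewrite /w' rev_cons cat_rcons => /cat_eq_cat.
  case=> [[s1 [-> /cat_eq_cat[]]]|[s1 [eu _]]]; last first.
  - by apply: (gw _ (s1 ++ (k :: p) ++ (q ++ z))); rewrite ew2 eu -catA.
  - by case=> t1 [es _]; exact: (b1 _ t1).
  - case=> -[|k' t1] [-> /=]; first by rewrite cats0 => _; apply: (b1 _ [::]); rewrite cats0.
    case=> <- eqz; have [|s' sr] := gw (u ++ (k :: p) ++ t1) t.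
      by rewrite ew2 eqz -!catA.
    exists s'; apply: real_eq sr => i _. rewrite !(mem_cat, inE, mem_rev).
    by case: (i \in u); case: (i == k); case: (i \in p).
have before_w' i j : before w' i j =
    if (i \in k :: p) && (j \in k :: p) then before (k :: p) j i else before w i j.
  by rewrite /w' ew2 (before_flip _ _ uw2).
have kr j : j \in p -> before r k j = false /\ before r j k.
  move=> /pT jT; have jk : j != k by rewrite eq_sym BT.
  have jkr := Tr j k jT kB; split=> //.
  by rewrite (before_total _ jk) ?jkr // rS TS.
(* [x] and [x0] are both on the positive side of [k], so the order at [x], that of [rev p], is also
   the order in [r]. *)
have agree i j : i \in p -> j \in p -> i != j -> before p j i -> before r i j.
  move=> ip jp ij bji.
  have v1 : val i x < val j x by apply: before_p; rewrite // eq_sym.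
  have Di : D i by rewrite -pD.
  have Dj : D j by rewrite -pD.
  have v2 : val i x0 < val j x0 by rewrite -(F3' i j) // pmulr_rgt0.
  have ir : i \in r by rewrite rS TS // pT.
  apply: contraLR v2; rewrite -(before_total ir ij) => /(Tfirst_val gr Tr).
  by move=> /(_ (pT _ jp) (pT _ ip)) /ltW; rewrite leNgt.
have nX : ~~ sepw X w' r.
  apply/sepwP => -[i [j [iX jX]]]; apply/negP/negPn.
  have [->|ij] := eqVneq i j; first by rewrite !beforexx.
  rewrite before_w' !pX iX jX /=.
  have [ik|ik] := eqVneq i k; have [jk|jk] := eqVneq j k.
  - by rewrite ik jk eqxx in ij.
  - rewrite ik; have [-> _] := kr _ (XE _ jX jk).
    by rewrite /before /= eqxx.
  - rewrite jk; have [_ ->] := kr _ (XE _ iX ik).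
    by rewrite /before /= eqxx [k == i]eq_sym (negbTE ik).
  - have ip := XE _ iX ik; have jp := XE _ jX jk.
    have -> : before (k :: p) j i = before p j i.
      by rewrite /before /= ![k == _]eq_sym (negbTE ik) (negbTE jk) ltnS.
    have ir : i \in r by rewrite rS TS // pT.
    have [bji|] := boolP (before p j i); first by rewrite agree.
    rewrite (before_total ip ij) negbK => bij.
    have := agree j i jp ip; rewrite eq_sym => /(_ ij bij).
    by rewrite (before_total ir ij) => /negbTE->.
(* [X] separates [w] from [r] because [k] precedes [h] in [w] only; any other flat sees the same
   order in [w] and [w']. *)
apply: proper_card; apply/properP; split; last first.
  exists X; rewrite inE XL //=.
  apply/sepwP; exists k, h; rewrite line_l line_r; split=> //.
    have hp : h \in p by rewrite pD.
    have [-> _] := kr _ hp.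
    by rewrite ew2 !before_cat (negbTE ku) (negbTE (yu _ hy)) !inE eqxx hp orbT /= /before /= eqxx (negbTE kh).
apply/fintype.subsetP => Y; rewrite !inE => /andP[YL sY]; rewrite YL /=.
have /sepwP[i [j [iY jY]]] := sY; rewrite before_w'; case: ifP => [/andP[]|_].
  rewrite !pX => iX jX; have [->|ij] := eqVneq i j; first by rewrite !beforexx eqxx.
  have YX : Y = X by rewrite (lines_eq YL ij iY jY) (lines_eq XL ij iX jX).
  by move: sY; rewrite YX (negbTE nX).
by move=> bij; apply/sepwP; exists i, j.
Qed.

(** The order in which the fiber hyperplanes are met on leaving [x0] in the direction [- v]. *)
Let tau := sort (fun i j => val i x0 <= val j x0) (enum T).

Let mem_tau : tau =i T.
Proof. by move=> i; rewrite mem_sort mem_enum. Qed.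

(** Equal values would make a base form vanish at [x0], so the order is strict and [tau] is the only
    sorted arrangement of [T]. *)
Let pairwise_tau : pairwise (fun i j => val i x0 < val j x0) tau.
Proof.
have utau : uniq tau by rewrite sort_uniq enum_uniq.
have ptau : pairwise (fun i j => val i x0 <= val j x0) tau.
  rewrite -sorted_pairwise; last by move=> j i k; exact: le_trans.
  by apply: sort_sorted => i j; exact: le_total.
move: ptau utau; rewrite uniq_pairwise.
have : {subset tau <= T} by move=> i; rewrite mem_tau.
elim: (tau) => //= i s IH sT /andP[ils ps] /andP[ins pn].
rewrite IH ?andbT => [|j js||] //; last by apply: sT; rewrite inE js orbT.
apply/allP => j js; rewrite lt_neqAle (allP ils) // andbT.
have ij : i != j by have := allP ins j js.
have iT : i \in T by apply: sT; rewrite mem_head.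
have jT : j \in T by apply: sT; rewrite inE js orbT.
have [k kB kl] := Tline iT jT ij; have [g _ E] := base_form iT jT ij kB kl.
have := x0P k; rewrite E -subr_eq0; case: eqP => // ->.
by rewrite mulr0 ltxx.
Qed.

Let gword_lift w : gword B w -> gword S (tau ++ w).
Proof.
case=> uw wB gw; split.
- rewrite cat_uniq sort_uniq enum_uniq uw andbT /=.
  apply/hasPn => i; rewrite wB => iB; apply/negP => /=.
  by rewrite mem_tau => /TB; rewrite iB.
- move=> i; rewrite mem_cat mem_tau wB inE.
  by have [/BSi->|_] := boolP (i \in B); rewrite ?orbF.
- move=> s t /cat_eq_cat[] [s1 [e1 e2]].
    have [x xr] := gw _ _ e2; apply: (@real_lift _ x).
      apply: real_eq xr => i iB; rewrite e1 mem_cat mem_tau.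
      by rewrite inE iB.
    by move=> i j iT jT _; rewrite e1 mem_cat mem_tau jT.
  have := pairwise_tau; rewrite e1 pairwise_cat => /and3P[/allrelP ss1 _ _].
  apply: (@real_lift _ x0).
    move=> i iB; case: ifP => // si.
    by have := TB (i := i); rewrite -mem_tau e1 mem_cat si iB => /(_ isT).
  move=> i j iT jT si sj; apply: ss1 => //.
  by have := mem_tau j; rewrite jT e1 mem_cat (negbTE sj).
Qed.

Let flip_lift w w' : flip w w' -> flip (tau ++ w) (tau ++ w').
Proof.
case=> u [p [t [X [XL pX -> ->]]]].
by exists (tau ++ u), p, t, X; split; rewrite -?catA.
Qed.

Let sepn_lift w w' : gword B w -> gword B w' -> sepn (tau ++ w) (tau ++ w') = sepn w w'.
Proof.
case=> _ wB _ [_ wB' _].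
have outw i : i \in tau -> (i \in w = false) * (i \in w' = false).
  by rewrite mem_tau wB wB' => /TB.
suff E X : sepw X (tau ++ w) (tau ++ w') = sepw X w w'.
  by apply: eq_card => X; rewrite !inE E.
apply: eq_existsb => i; congr (_ && _); apply: eq_existsb => j; congr (_ && _).
rewrite !before_cat.
have [it|it] := boolP (i \in tau).
  by rewrite (before_out j (w := w)) ?(before_out j (w := w')) ?outw // !eqxx.
case: ifP => // jt; rewrite eqxx; apply/esym/negbTE; rewrite negbK.
have jt' : j \in T by rewrite -mem_tau.
have [iB|iB] := boolP (i \in B).
  by rewrite (before_inout (w := w)) ?(before_inout (w := w')) ?wB ?wB' ?(TB jt').
by rewrite (before_out _ (w := w)) ?(before_out _ (w := w')) ?wB ?wB'.
Qed.

(** Induction on the number of separating flats. [descent] applies until the fiber hyperplanes come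
    first; then their order is forced and the base walk can be lifted. *)
Lemma core_step : core B -> core S.
Proof.
case=> r0 [gr0 Hr0]; exists (tau ++ r0); split; first exact: gword_lift.
have gr := gword_lift gr0.
have Tr : Tfirst (tau ++ r0).
  move=> i j iT jB; rewrite before_cat !mem_tau iT.
  by case: ifP => // /TB; rewrite jB.
move=> w; have [m] := ubnP (sepn w (tau ++ r0)); elim: m w => // m IH w lem gw.
have [uw wS gwr] := gw.
case: (split_last (mem T) w) => [[u [z [e uT zT]]]|[u [k [y [z [e kT y0 yT zT]]]]]].
  have uE i : i \in w -> (i \in u) = (i \in T).
    move=> iw; apply/idP/idP => [/(allP uT)//|iT]; move: iw; rewrite e mem_cat.
    by case/orP=> // /(allP zT); rewrite /= iT.
  have zB : z =i B.
    move=> i; have := wS i; rewrite e mem_cat => iS; apply/idP/idP => [iz|iB].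
      have : i \in S by rewrite -iS iz orbT.
      have iT : i \notin T := allP zT _ iz.
      by move=> iS'; move: iT; rewrite STB // negbK.
    have := iS; rewrite BSi // => /orP[/(allP uT)/= /TB|//]; by rewrite iB.
  have ut : u = tau.
    apply: (@irr_sorted_eq _ (fun i j => val i x0 < val j x0)).
    - by move=> j i k; exact: lt_trans.
    - by move=> i; exact: ltxx.
    - case eu : u => [//|h u']; rewrite -eu; apply/(sortedP h) => n ns.
      have n1 := ltnW ns; have m1 := mem_nth h n1; have m2 := mem_nth h ns.
      apply: (@Tfirst_val w) => //.
      + move=> i j iT jB; rewrite e before_cat.
        have -> : i \in u by rewrite uE // wS TS.
        by case: ifP => // /(allP uT) /= /TB; rewrite jB.
      + exact: (allP uT).
      + exact: (allP uT).
      + rewrite e before_cat m1 m2 /before !index_uniq //.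
        * by move: uw; rewrite e cat_uniq => /andP[].
        * by move: uw; rewrite e cat_uniq => /andP[].
    - exact: pairwise_sorted pairwise_tau.
    - move=> i; rewrite mem_tau.
      apply/idP/idP => [/(allP uT)//|iT]; by rewrite uE // wS TS.
  have gz : gword B z.
    split=> //; first by move: uw; rewrite e cat_uniq => /and3P[].
    move=> s t ez; have [|x xr] := gwr (u ++ s) t; first by rewrite e ez catA.
    exists x; apply: (real_eq (P := u ++ s)); last exact: real_sub xr.
    move=> i iB; rewrite mem_cat; case: (i \in s); rewrite ?orbT ?orbF //.
    by apply/negP => /(allP uT) /= /TB; rewrite iB.
  have [n nle nw] := Hr0 z gz; exists n.
    by rewrite e ut sepn_lift.
  by rewrite e ut; apply: nwalk_map nw => // *; exact: flip_lift.
have [w' [gw' fw' lw']] := descent gw gr Tr e kT y0 (allP yT) (allP zT).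
have [|n nle nw] := IH w' _ gw'; first exact: leq_trans lw' _.
exists n.+1; first exact: leq_ltn_trans nle lw'.
by exists w'.
Qed.

End Step.

(** Each flat is counted at most once for [w] and [rev w], and likewise for [w']. The two possible
    routes thus have total length at most twice [#|lines|], and the shorter one is taken. *)
Lemma core_diameter x0 w w' : (forall i, 0 < lform (a i) x0) -> core [set: I] ->
  gword [set: I] w -> gword [set: I] w' ->
  exists2 n, (n <= #|lines|)%N & nwalk (gword [set: I]) flip n w w'.
Proof.
move=> x0P [r [gr Hr]] gw gw'.
have rev_le t : gword [set: I] t -> (sepn t r + sepn (rev t) r <= #|lines|)%N.
  move=> gt; rewrite -cardsUI.
  have -> : [set X in lines | sepw X t r] :&: [set X in lines | sepw X (rev t) r]
      = finset.set0.
    apply/setP => X; rewrite !inE; apply/negP => /andP[/andP[XL X1] /andP[_ X2]].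
    by apply: (two_orders x0P gt gr XL _ X1 X2); rewrite finset.subsetT.
  rewrite cards0 addn0; apply/subset_leq_card/fintype.subsetP => X.
  by rewrite !inE => /orP[] /andP[].
have close t t' : gword [set: I] t -> gword [set: I] t' ->
    exists2 n, (n <= sepn t r + sepn t' r)%N & nwalk (gword [set: I]) flip n t t'.
  move=> /Hr[m lm wm] /Hr[n ln wn]; exists (m + n)%N; first exact: leq_add.
  by apply: nwalk_cat wm _; apply: nwalk_sym wn; exact: flip_sym.
have [le|gt] := leqP (sepn w r + sepn w' r) #|lines|.
  by have [n ln nw] := close _ _ gw gw'; exists n => //; exact: leq_trans ln le.
have [n ln nw] := close _ _ (gword_rev gw) (gword_rev gw').
exists n; first by have := rev_le _ gw; have := rev_le _ gw'; lia.
rewrite -[w]revK -[w']revK; apply: nwalk_map nw => [t|t t' _ _].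
- exact: gword_rev.
- exact: flip_rev.
Qed.

Lemma sepn_rev w : gword [set: I] w -> sepn w (rev w) = #|lines|.
Proof.
move=> gw; apply: eq_card => X; rewrite !inE; case XL : (X \in lines) => //=.
by rewrite (sepw_rev gw XL) // finset.subsetT.
Qed.

End Core.

(** * Codimension 2 intersections and rank 2 flats of normals *)

Section Flats.
Import Order.TTheory GRing.Theory Num.Theory.
Local Open Scope ring_scope.
Variables (R : realType) (d : nat).

Lemma mem_hyp (v x : 'rV[R]_d) : (x \in hyp v) = (lform v x == 0).
Proof.
rewrite memv_ker (lfunE (mulmxr v^T)) /= /lform.
apply/eqP/eqP => [->|e]; first by rewrite mxE.
by apply/rowP => i; rewrite ord1 e mxE.
Qed.

Lemma dim_cap_hyp (U : {vspace 'rV[R]_d}) (v : 'rV[R]_d) :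
  ~~ (U <= hyp v)%VS -> (\dim (U :&: hyp v)).+1 = \dim U.
Proof.
move=> Uv; rewrite -(limg_ker_dim (linfun (mulmxr v^T)) U) -/(hyp v) -addn1.
congr addn; apply/eqP; rewrite eqn_leq; apply/andP; split; first by rewrite lt0n dimv_eq0 -lkerE.
by apply: leq_trans (dimvS (subvf _)) _; rewrite dimvf.
Qed.

Lemma hyp_scale (v : 'rV[R]_d) c : c != 0 -> hyp (c *: v) = hyp v.
Proof.
by move=> c0; apply/vspaceP => x; rewrite !mem_hyp lformZl mulf_eq0 (negbTE c0).
Qed.

(** Duality between subspaces and forms: a form that vanishes on the common kernel of two others is
    a combination of them. *)
Lemma hyp_cap_sub (u v w : 'rV[R]_d) :
  (hyp u :&: hyp v <= hyp w)%VS = (w \in <<[:: u; v]>>%VS).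
Proof.
apply/subvP/span2P => [h|[b [c ->]] x]; last first.
  rewrite memv_cap !mem_hyp lformDl !lformZl => /andP[/eqP-> /eqP->].
  by rewrite !mulr0 addr0.
have : (w <= col_mx u v)%MS.
  rewrite submxE; apply/eqP/matrixP => i j; rewrite !ord1 [RHS]mxE.
  (* Each column of the cokernel is a vector orthogonal to [u] and [v], hence a test point for the
     inclusion. *)
  pose x := (col j (cokermx (col_mx u v)))^T.
  have ortho (z : 'rV[R]_d) : lform z x = (z *m cokermx (col_mx u v)) 0 j.
    by rewrite lformC /lform /x trmxK colE mulmxA -colE mxE.
  rewrite -ortho; apply/eqP; rewrite -mem_hyp; apply: h.
  have := mulmx_coker (col_mx u v); rewrite mul_col_mx.
  move/(congr1 (fun M => (usubmx M, dsubmx M))); rewrite col_mxKu col_mxKd.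
  rewrite memv_cap !mem_hyp !ortho => -[-> ->].
  by rewrite !mxE eqxx.
case/submxP=> D ->; rewrite -[D]hsubmxK mul_row_col.
exists (lsubmx D 0 0), (rsubmx D 0 0).
by rewrite {1}[lsubmx D]mx11_scalar {1}[rsubmx D]mx11_scalar !mul_scalar_mx.
Qed.

Section Arrangement.
Variables (I : finType) (a : I -> 'rV[R]_d).
Hypothesis aP : is_arrangement a.

Lemma arrangement_free i j : i != j -> free [:: a i; a j].
Proof.
have [a0 Hinj] := aP; move=> ij; rewrite free_cons span_seq1 seq1_free a0 andbT.
apply: contra ij => /vlineP[c e]; apply/eqP/Hinj; rewrite /H e hyp_scale //.
by apply: contraNneq (a0 i) => c0; rewrite e c0 scale0r.
Qed.

Definition flat (X : {vspace 'rV[R]_d}) : {set I} := [set k | (X <= H a k)%VS].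

Lemma flat_cap i j : flat (H a i :&: H a j)%VS = line a i j.
Proof. by apply/setP => k; rewrite !inE hyp_cap_sub. Qed.

Lemma LsetP X : reflect (exists Z : {set I}, X = (\bigcap_(i in Z) H a i)%VS)
  (X \in Lset a).
Proof.
rewrite mem_undup; apply: (iffP mapP) => [[Z _ ->]|[Z ->]]; exists Z => //.
by rewrite mem_enum.
Qed.

Lemma flatK X : X \in Lset a -> (\bigcap_(i in flat X) H a i)%VS = X.
Proof.
move=> /LsetP[Z eX]; apply/eqP; rewrite eqEsubv; apply/andP; split.
  rewrite {2}eX; apply/subv_bigcapP => i iZ; apply: (bigcapv_inf i) => //.
  by rewrite inE eX; apply: (bigcapv_inf i).
by apply/subv_bigcapP => i; rewrite inE.
Qed.

Lemma dim_hyp i : (\dim (H a i)).+1 = d.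
Proof.
have := @dim_cap_hyp fullv (a i); rewrite capfv dimvf [dim _]mul1n; apply.
apply/negP => /subvP /(_ (a i) (memvf _)); rewrite mem_hyp => /eqP.
rewrite lformE => /eqP; rewrite psumr_eq0; last by move=> j _; rewrite -expr2 sqr_ge0.
move=> /allP z; have [a0 _] := aP; case/eqP: (a0 i); apply/rowP => j.
by have := z j (mem_index_enum _); rewrite /= mulf_eq0 orbb mxE => /eqP.
Qed.

Lemma dim_cap2 i j : i != j -> (\dim (H a i :&: H a j) + 2)%N = d.
Proof.
move=> ij; rewrite addn2 (@dim_cap_hyp (H a i) (a j)) ?dim_hyp //.
apply: contra ij => ij; have [_ Hinj] := aP; apply/eqP/Hinj/eqP.
by rewrite eqEdim ij -ltnS !dim_hyp leqnn.
Qed.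

Lemma L2P X : reflect (exists i j, i != j /\ X = (H a i :&: H a j)%VS) (X \in L2 a).
Proof.
rewrite mem_filter; apply: (iffP andP) => [[/eqP dX XL]|[i [j [ij ->]]]].
  have eX := flatK XL.
  have [i iX] : exists i, i \in flat X.
    apply/existsP; apply: contraT; rewrite negb_exists => /forallP noX.
    move: dX; rewrite -eX big_pred0 => [|i]; last exact/negbTE.
    by rewrite dimvf [dim _]mul1n addn2; lia.
  have [j /andP[jX ij]] : exists j, (j \in flat X) && (j != i).
    apply/existsP; apply: contraT; rewrite negb_exists => /forallP noX.
    have : (H a i <= X)%VS.
      rewrite -eX; apply/subv_bigcapP => j jX; have := noX j.
      by rewrite jX negbK => /eqP->.
    by move/dimvS; have := dim_hyp i; lia.
  exists i, j; rewrite eq_sym; split=> //; apply/eqP; rewrite eqEdim subv_cap.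
  move: iX jX; rewrite !inE => -> -> /=.
  by have := dim_cap2 ij; rewrite capvC; lia.
split; first by rewrite dim_cap2.
apply/LsetP; exists [set i; j]; rewrite big_setU1 ?inE //= big_set1 //.
Qed.

(** An intersection is recovered from the set of hyperplanes containing it, so counting over [L2]
    becomes counting over [lines]. *)
Lemma perm_flat : perm_eq (map flat (L2 a)) (enum (lines a)).
Proof.
apply: uniq_perm; rewrite ?enum_uniq //.
  rewrite map_inj_in_uniq ?filter_uniq ?undup_uniq // => X Y.
  rewrite !mem_filter => /andP[_ XL] /andP[_ YL] e.
  by rewrite -(flatK XL) e flatK.
move=> X; rewrite mem_enum; apply/mapP/linesP => [[Y /L2P[i [j [ij ->]]] ->]|].
  by exists i, j; rewrite flat_cap.
case=> i [j [ij ->]]; exists (H a i :&: H a j)%VS; last by rewrite flat_cap.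
by apply/L2P; exists i, j.
Qed.

Lemma card_lines : #|lines a| = size (L2 a).
Proof. by rewrite cardE -(perm_size perm_flat) size_map. Qed.

Lemma count_lines (P : pred {set I}) :
  count (P \o flat) (L2 a) = #|[set X in lines a | P X]|.
Proof.
rewrite -count_map (seq.permP perm_flat) -size_filter cardE.
rewrite /enum_mem -!filter_predI; congr size; apply: eq_filter => X /=.
by rewrite !inE andbC.
Qed.

End Arrangement.

Lemma lines_scale (I : finType) (a b : I -> 'rV[R]_d) :
  (forall i, exists2 c, c != 0 & b i = c *: a i) -> lines b = lines a.
Proof.
move=> ab; suff E i j : line b i j = line a i j.
  by apply/setP => X; apply/linesP/linesP => -[i [j [ij ->]]]; exists i, j.
apply/setP => k; rewrite !inE -!hyp_cap_sub.
have hE l : hyp (b l) = hyp (a l) by have [c c0 ->] := ab l; rewrite hyp_scale.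
by rewrite !hE.
Qed.

End Flats.

(** * Chambers and galleries *)

Section Chambers.
Import Order.TTheory GRing.Theory Num.Theory numFieldNormedType.Exports.
Local Open Scope ring_scope.
Local Open Scope classical_set_scope.
Variables (R : realType) (d : nat).

Lemma lform_continuous (v : 'rV[R]_d) : continuous (lform v : 'rV[R]_d -> R).
Proof.
have -> : lform v = fun y : 'rV[R]_d => \sum_k y 0 k * v 0 k.
  by apply/funext => y; exact: lformE.
elim: (index_enum _) => [|k s IH] x.
  have -> : (fun y : 'rV[R]_d => \sum_(k <- [::]) y 0 k * v 0 k) = cst 0.
    by apply/funext => y; rewrite big_nil.
  exact: cst_continuous.
have -> : (fun y : 'rV[R]_d => \sum_(i <- k :: s) y 0 i * v 0 i) =
    (fun y => y 0 k * v 0 k + \sum_(i <- s) y 0 i * v 0 i).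
  by apply/funext => y; rewrite big_cons.
apply: cvgD (IH x); apply: cvgMr_tmp; exact: coord_continuous.
Qed.

Variables (I : finType) (a : I -> 'rV[R]_d).

Lemma complementP x : complement a x <-> forall i, lform (a i) x != 0.
Proof. by split=> xP i; have := xP i; rewrite mem_hyp. Qed.

(** A form without zeros on a connected set keeps its sign there; conversely, the segment joining
    two points with the same signs avoids all hyperplanes. *)
Lemma component_cell x : complement a x -> connected_component (complement a) x =
  [set y | forall i, 0 < lform (a i) x * lform (a i) y].
Proof.
move=> xC; apply/seteqP; split=> y.
  case=> C [Cx Csub Cc] Cy i.
  have Ic : is_interval (lform (a i) @` C).
    apply/connected_intervalP; apply: connected_continuous_connected => //.
    exact/continuous_subspaceT/lform_continuous.
  have C0 z : C z -> lform (a i) z != 0 by move=> /Csub/complementP.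
  have nz : ~ (lform (a i) @` C) 0 by case=> z /C0/eqP.
  have [p q] : (lform (a i) @` C) (lform (a i) x) /\ (lform (a i) @` C) (lform (a i) y).
    by split; [exists x|exists y].
  move: (C0 _ Cx) (C0 _ Cy); rewrite !neq_lt => /orP[x0|x0] /orP[y0|y0].
  - by rewrite nmulr_rgt0.
  - by case: nz; apply: (Ic _ _ p q); rewrite !ltW.
  - by case: nz; apply: (Ic _ _ q p); rewrite !ltW.
  - by rewrite pmulr_rgt0.
move=> yP; pose f t : 'rV[R]_d := x + t *: (y - x).
exists (f @` `[0, 1]); last by exists 1; rewrite /f /= ?in_itv /= ?lexx ?ler01 // scale1r addrC subrK.
split.
- by exists 0; rewrite /f /= ?in_itv /= ?lexx ?ler01 // scale0r addr0.
- move=> _ [t + <-]; rewrite /= in_itv /= => /andP[t0 t1]; apply/complementP => i.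
  have := yP i; rewrite /f lformDr lformZr lformDr lformNr.
  have := (complementP x).1 xC i.
  move: (lform _ x) (lform _ y) => p q p0 pq; apply/eqP => e.
  have pp : 0 < p ^+ 2 by rewrite lt0r sqr_ge0 expf_neq0.
  have : p * (p + t * (q - p)) = (1 - t) * p ^+ 2 + t * (p * q) by ring.
  rewrite e mulr0 => /esym/eqP; have [t1'|t1'] := ltP t 1.
    rewrite gt_eqF //; apply: ltr_wpDr; first by rewrite mulr_ge0 // ltW.
    by rewrite mulr_gt0 // subr_gt0.
  have -> : t = 1 by apply/eqP; rewrite eq_le t1.
  by rewrite subrr mul0r add0r mul1r gt_eqF.
- apply: connected_continuous_connected; first exact: segment_connected.
  apply: continuous_subspaceT => t; apply: cvgD; first exact: cvg_cst.
  exact: scalel_continuous.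
Qed.

Lemma closure_halfspace (v z : 'rV[R]_d) (c : set 'rV[R]_d) :
  (forall y, c y -> 0 <= lform v y) -> closure c z -> 0 <= lform v z.
Proof.
move=> cv; have cl : closed [set y : 'rV[R]_d | 0 <= lform v y].
  apply: (@preimage_closed _ _ (lform v) [set y | 0 <= y]).
    by move=> y _; exact: lform_continuous.
  exact: closed_ge.
suff sub : closure c `<=` [set y : 'rV[R]_d | 0 <= lform v y] by move/sub.
by rewrite [X in _ `<=` X]((closure_id _).1 cl); exact: closureS.
Qed.

End Chambers.

(** Reads an ordering off a chain of sets; applied to the sets of hyperplanes separating the
    successive chambers of a gallery from the base. *)
Lemma seq_of_sets (I : finType) (S : nat -> {set I}) n : S 0 = finset.set0 ->
  (forall k, k < n -> exists2 i, i \notin S k & S k.+1 = i |: S k) ->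
  exists w, [/\ uniq w, size w = n & forall k, k <= n -> take k w =i S k].
Proof.
move=> S0; elim: n => [|n IH] Sn.
  by exists [::]; split=> // -[|//] _ i; rewrite S0 finset.in_set0.
have [k kn|w [uw sw wS]] := IH; first by apply: Sn; exact: ltnW.
have [i iS eS] := Sn n (leqnn _).
have wSn : w =i S n by move=> j; rewrite -wS // -sw take_size.
exists (rcons w i); split; first by rewrite rcons_uniq uw wSn iS.
  by rewrite size_rcons sw.
move=> k; rewrite leq_eqVlt => /orP[/eqP->|].
  by move=> j; rewrite take_oversize ?size_rcons ?sw // mem_rcons inE eS !inE wSn.
rewrite ltnS => kn j; rewrite -cats1 take_cat sw; case: ltnP => nk; first by rewrite wS.
have -> : k = n by apply/eqP; rewrite eqn_leq kn.
by rewrite subnn take0 cats0.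
Qed.

Section Galleries.
Import Order.TTheory GRing.Theory Num.Theory.
Local Open Scope ring_scope.
Variables (R : realType) (d : nat) (I : finType) (a : I -> 'rV[R]_d) (p0 : 'rV[R]_d).
Hypothesis p0C : complement a p0.

(** The hyperplanes are unchanged, but the chamber of [p0] becomes the one where all forms are
    positive. *)
Definition oriented i : 'rV[R]_d := lform (a i) p0 *: a i.
Local Notation b := oriented.

Lemma lform_oriented i y : lform (b i) y = lform (a i) p0 * lform (a i) y.
Proof. by rewrite lformZl. Qed.

Lemma oriented_scale i : exists2 c, c != 0 & b i = c *: a i.
Proof. by exists (lform (a i) p0) => //; exact: (complementP a p0).1. Qed.

Lemma oriented_pos i : 0 < lform (b i) p0.
Proof.
by rewrite lform_oriented lt0r -expr2 sqr_ge0 expf_neq0 // (complementP a p0).1.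
Qed.

Definition negs (c : set 'rV[R]_d) : {set I} :=
  [set i | `[< exists2 x, c x & lform (b i) x < 0 >]].

Definition cell (P : {set I}) : set 'rV[R]_d :=
  [set y | forall i, if i \in P then lform (b i) y < 0 else 0 < lform (b i) y]%classic.

Lemma sign_oriented i x y : complement a x -> 0 < lform (a i) x * lform (a i) y <->
  if lform (b i) x < 0 then lform (b i) y < 0 else 0 < lform (b i) y.
Proof.
move=> /complementP/(_ i) x0; have := (complementP a p0).1 p0C i.
rewrite !lform_oriented; move: (lform _ p0) (lform _ x) (lform _ y) x0 => p q r.
rewrite !neq_lt => /orP[q0|q0] /orP[p_0|p_0].
- by rewrite !nmulr_rlt0 // !nmulr_rgt0 // (lt_gtF q0).
- by rewrite !pmulr_rlt0 // q0 nmulr_rgt0.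
- by rewrite !nmulr_rlt0 // q0 pmulr_rgt0.
- by rewrite !pmulr_rlt0 // !pmulr_rgt0 // (lt_gtF q0).
Qed.

Lemma cell_complement P x : cell P x -> complement a x.
Proof.
move=> xP; apply/complementP => i; have := xP i; rewrite !lform_oriented.
by case: ifP => _; apply: contraTneq => ->; rewrite mulr0 ltxx.
Qed.

Lemma cell_negs P x : cell P x -> negs (cell P) = P.
Proof.
move=> xP; apply/setP => i; rewrite inE; apply/asboolP/idP => [[y]|iP].
  by move=> /(_ i); case: ifP => // _ /lt_gtF ->.
by exists x => //; have := xP i; rewrite iP.
Qed.

Lemma cell_chamber P x : cell P x -> chamber a (cell P).
Proof.
move=> xP; have xC := cell_complement xP; exists x => //.
rewrite component_cell //; apply/seteqP; split=> y yP i; have := xP i; have := yP i.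
  by move=> hy hx; apply/(sign_oriented _ _ xC); move: hx hy; case: ifP => _ hx;
    rewrite ?hx // (lt_gtF hx).
by move/(sign_oriented _ _ xC) => hy hx; move: hx hy; case: ifP => _ hx;
  rewrite ?hx // (lt_gtF hx).
Qed.

Lemma chamber_cell c : chamber a c -> c = cell (negs c) /\ exists x, c x.
Proof.
case=> x xC; rewrite component_cell // => ec.
have ec' : c = cell [set i | lform (b i) x < 0].
  rewrite ec; apply/seteqP; split=> y yP i; have := yP i.
    by move/(sign_oriented _ _ xC); rewrite inE.
  by rewrite inE => /(sign_oriented _ _ xC).
have cx : c x.
  rewrite ec' => i; rewrite inE; case: ifPn => //; rewrite -leNgt le_eqVlt.
  rewrite eq_sym lform_oriented mulf_eq0 (negbTE ((complementP a p0).1 p0C i)).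
  by rewrite (negbTE ((complementP a x).1 xC i)).
split; last by exists x.
by rewrite {2}ec' (@cell_negs _ x) // -ec'.
Qed.

Lemma separates_negs i c c' : chamber a c -> chamber a c' ->
  separates a i c c' <-> (i \in negs c) != (i \in negs c').
Proof.
move=> cc cc'; have [e [z cz]] := chamber_cell cc.
have [e' [z' cz']] := chamber_cell cc'.
have sgn x y : c x -> c' y -> (lform (a i) x * lform (a i) y < 0) =
    ((i \in negs c) != (i \in negs c')).
  move=> cx cy; have hx : cell (negs c) x by rewrite -e.
  have hy : cell (negs c') y by rewrite -e'.
  move: (hx i) (hy i).
  have := oriented_pos i; rewrite !lform_oriented.
  move: (lform _ p0) (lform _ x) (lform _ y) => p q r; rewrite -expr2 => pp hq hr.
  rewrite -(pmulr_rlt0 _ pp) expr2 mulrACA; move: hq hr.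
  case: ifP => _ hq; case: ifP => _ hr.
  - by rewrite nmulr_rlt0 // (lt_gtF hr).
  - by rewrite nmulr_rlt0 // hr.
  - by rewrite pmulr_rlt0 // hr.
  - by rewrite pmulr_rlt0 // (lt_gtF hr).
split=> [[x [y [cx cy]]]|h]; first by rewrite sgn.
by exists z, z'; rewrite sgn.
Qed.

Lemma L1sep_negs c c' : chamber a c -> chamber a c' ->
  L1sep a c c' = (negs c :\: negs c') :|: (negs c' :\: negs c).
Proof.
move=> cc cc'; apply/setP => i; rewrite !inE.
apply/asboolP/idP => [/(separates_negs i cc cc')|h]; last first.
  by apply/(separates_negs i cc cc'); move: h; rewrite !inE; case: asbool; case: asbool.
by rewrite !inE; case: asbool; case: asbool.
Qed.

Let c0 := cell finset.set0.

Lemma base_cell : c0 p0.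
Proof. by move=> i; rewrite finset.in_set0 oriented_pos. Qed.

Lemma negset_base : negset c0 = cell [set: I].
Proof.
apply/seteqP; split=> y.
  case=> x xP <- i; have := xP i.
  by rewrite finset.in_set0 finset.in_setT lformNr oppr_lt0.
move=> yP; exists (- y); last by rewrite opprK.
move=> i; have := yP i.
by rewrite finset.in_set0 finset.in_setT lformNr oppr_gt0.
Qed.

Definition gal (w : seq I) : seq (set 'rV[R]_d) :=
  mkseq (fun t => cell [set i in take t w]) #|I|.+1.

Lemma nth_gal w t : (t <= #|I|)%N -> nth set0 (gal w) t = cell [set i in take t w].
Proof. by move=> tI; rewrite nth_mkseq. Qed.

Lemma gword_cell w t : gword b [set: I] w -> exists x, cell [set i in take t w] x.
Proof.
case=> _ _ /(_ (take t w) (drop t w)); rewrite cat_take_drop => /(_ erefl)[x xr].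
by exists x => i; have := xr i; rewrite finset.in_setT inE => /(_ isT).
Qed.

Lemma gal_chamber w t : gword b [set: I] w -> chamber a (cell [set i in take t w]).
Proof. by move=> /(@gword_cell _ t)[x]; exact: cell_chamber. Qed.

Lemma negs_gal w t : gword b [set: I] w ->
  negs (cell [set i in take t w]) = [set i in take t w].
Proof. by move=> /(@gword_cell _ t)[x]; exact: cell_negs. Qed.

Lemma gword_size w : gword b [set: I] w -> size w = #|I|.
Proof.
case=> uw wI _; rewrite -(card_uniqP uw) -cardsT; apply: eq_card => i.
by rewrite wI.
Qed.

Lemma L1sep_add c c' i : chamber a c -> chamber a c' -> i \notin negs c ->
  negs c' = i |: negs c -> L1sep a c c' = [set i].
Proof.
move=> cc cc' ic e; rewrite L1sep_negs // e; apply/setP => j.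
rewrite !finset.in_setU !finset.in_setD finset.in_setU finset.in_set1.
by have [->|ji] := eqVneq j i; rewrite ?(negbTE ic) //=; case: (j \in negs c).
Qed.

Lemma gal_gallery w : gword b [set: I] w -> is_gallery a c0 (negset c0) (gal w).
Proof.
move=> gw; have sw := gword_size gw; have [uw wI _] := gw; split.
- by rewrite size_mkseq.
- by rewrite nth_gal // take0; congr cell; apply/setP => i; rewrite !inE.
- rewrite -nth_last size_mkseq nth_gal //.
  by rewrite negset_base -sw take_size; congr cell; apply/setP => i; rewrite inE wI.
- by move=> k; rewrite size_mkseq ltnS => kI; rewrite nth_gal //; exact: gal_chamber.
- move=> k; rewrite size_mkseq ltnS => kI; rewrite nth_gal ?(ltnW kI) // nth_gal // /Defs.adj1.
  case e : (drop k w) => [|i w'].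
    by have := size_drop k w; rewrite e sw /= => /eqP; rewrite eq_sym subn_eq0 leqNgt kI.
  have ew : take k.+1 w = rcons (take k w) i.
    by rewrite -addn1 takeD e /= take0 cats1.
  rewrite (@L1sep_add _ _ i) ?cards1 //; try exact: gal_chamber.
    rewrite negs_gal // inE; move: uw; rewrite -{1}(cat_take_drop k w) e cat_uniq.
    by rewrite /= negb_or => /and3P[_ /andP[]].
  rewrite !negs_gal // ew; apply/setP => j.
  by rewrite finset.in_setU1 !inE mem_rcons inE.
Qed.

Lemma negs_base : negs c0 = finset.set0.
Proof. exact: cell_negs base_cell. Qed.

Lemma negs_negset_base : negs (negset c0) = [set: I].
Proof.
rewrite negset_base (@cell_negs _ (- p0)) // => i.
by rewrite finset.in_setT lformNr oppr_lt0 oriented_pos.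
Qed.

Section Gallery.
Variable g : seq (set 'rV[R]_d).
Hypothesis gP : is_gallery a c0 (negset c0) g.
Let S k := negs (nth set0 g k).

Let step k : (k.+1 < size g)%N -> (#|S k.+1| <= #|S k|.+1)%N.
Proof.
case: gP => _ _ _ gc ga kg; have := ga k kg; rewrite /Defs.adj1 L1sep_negs; try apply: gc => //; last exact: ltnW.
rewrite -/(S k) -/(S k.+1) => e1; rewrite -[X in (_ <= X)%N]addn1 -e1.
apply: leq_trans (leq_card_setU _ _); apply/subset_leq_card/fintype.subsetP => i.
by rewrite !finset.in_setU !finset.in_setD => ->; case: (i \in S k).
Qed.

Let steps j k : (j + k < size g)%N -> (#|S (j + k)| <= #|S k| + j)%N.
Proof.
elim: j => [|j IH] jk; first by rewrite addn0.
by apply: leq_trans (step jk) _; rewrite addnS ltnS IH // ltnW.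
Qed.

Let S0 : S 0 = finset.set0.
Proof. by case: gP => _ e _ _ _; rewrite /S e negs_base. Qed.

Let Slast : S (size g).-1 = [set: I].
Proof.
case: gP => g0 _ e _ _; rewrite /S nth_last (_ : last set0 g = negset c0) //.
exact: negs_negset_base.
Qed.

(** The set of hyperplanes separating from the base chamber starts empty, ends full, and gains at
    most one element per step. *)
Lemma gallery_size : (#|I| < size g)%N.
Proof.
have g0 : (0 < size g)%N by case: gP.
have := @steps (size g).-1 0%N; rewrite addn0 Slast S0 cards0 cardsT prednK //.
by move=> /(_ (leqnn _)); lia.
Qed.

Lemma gallery_word : size g = #|I|.+1 ->
  exists2 w, gword b [set: I] w & g = gal w.
Proof.
move=> sg; have [_ _ _ gc ga] := gP.
(* The bound of one new hyperplane per step, used from both ends of the gallery, squeezes the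
   cardinal to [k]. *)
have cS k : (k <= #|I|)%N -> #|S k| = k.
  move=> kI; apply/eqP; rewrite eqn_leq; apply/andP; split.
    by have := @steps k 0%N; rewrite addn0 S0 cards0; apply; rewrite sg ltnS.
  have := @steps (#|I| - k)%N k; rewrite subnK // sg ltnS => /(_ (leqnn _)).
  by have := Slast; rewrite sg /= => ->; rewrite cardsT addnC -leq_subLR subKn.
have [k kI|w [uw sw wS]] := @seq_of_sets I S #|I| S0.
  have k1 : (k.+1 < size g)%N by rewrite sg ltnS.
  have := ga k k1; rewrite /Defs.adj1 L1sep_negs; try apply: gc => //; last exact: ltnW.
  rewrite -/(S k) -/(S k.+1) => /eqP/cards1P[i ei].
  have mi j : (j \in S k) != (j \in S k.+1) -> j = i.
    move=> h; apply/finset.set1P; rewrite -ei !inE; move: h.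
    by rewrite /S !inE; case: asbool; case: asbool.
  have : i \in (S k :\: S k.+1) :|: (S k.+1 :\: S k) by rewrite ei finset.set11.
  rewrite finset.in_setU !finset.in_setD => /orP[/andP[iS' iS]|/andP[iS iS']].
    have : (S k.+1 \subset S k).
      apply/fintype.subsetP => j jS; apply: contraT => njS.
      have ji : j = i by apply: mi; rewrite jS (negbTE njS).
      by move: njS; rewrite ji iS.
    by move/subset_leq_card; rewrite !cS ?(ltnW kI) // ltnn.
  exists i => //; apply/setP => j; rewrite finset.in_setU1.
  have [->|ji] := eqVneq j i; first by rewrite iS'.
  by apply/esym/eqP; apply: contraT => /mi ji'; rewrite ji' eqxx in ji.
have gE t : (t <= #|I|)%N -> nth set0 g t = cell [set i in take t w].
  move=> tI; have ct : chamber a (nth set0 g t) by apply: gc; rewrite sg ltnS.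
  have [-> _] := chamber_cell ct; congr cell; apply/setP => i.
  by rewrite -/(S t) -wS // inE.
have wI : w =i [set: I].
  by move=> i; rewrite -[w]take_size sw wS //; have := Slast; rewrite sg /= => ->.
exists w; last first.
  apply: (@eq_from_nth _ set0); first by rewrite sg size_mkseq.
  by move=> t; rewrite sg ltnS => tI; rewrite nth_gal // gE.
split=> // u v e; have su : (size u <= #|I|)%N by rewrite -sw e size_cat leq_addr.
have ct : chamber a (nth set0 g (size u)) by apply: gc; rewrite sg ltnS.
have [_ [x]] := chamber_cell ct; rewrite gE // => xc; exists x => i _.
by have := xc i; rewrite inE e take_size_cat.
Qed.

End Gallery.

Lemma gal_min w : gword b [set: I] w -> G2_vertex a c0 (gal w).
Proof.
move=> gw; split; first exact: gal_gallery.
by move=> g' /gallery_size; rewrite size_mkseq.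
Qed.

(** The existence of one word [r] shows that the minimal number of chambers is [#|I|.+1], so a
    minimal gallery gains one hyperplane at every step. *)
Lemma min_word g r : gword b [set: I] r -> G2_vertex a c0 g ->
  exists2 w, gword b [set: I] w & g = gal w.
Proof.
move=> gr [gg gmin]; apply: gallery_word => //; apply/eqP; rewrite eqn_leq.
rewrite (gallery_size gg) andbT; have := gmin _ (gal_gallery gr).
by rewrite size_mkseq.
Qed.

Lemma cross_gal w i : gword b [set: I] w -> cross a (gal w) i = index i w.
Proof.
move=> gw; have sw := gword_size gw; have [uw wI _] := gw.
have iw : i \in w by rewrite wI finset.in_setT.
rewrite /cross size_mkseq (@eq_in_find _ _ (pred1 (index i w))).
  rewrite -[LHS]/(index (index i w) (iota 0 #|I|)).
  have iN : (index i w < size (iota 0 #|I|))%N by rewrite size_iota -sw index_mem.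
  rewrite -{1}[index i w]add0n -(nth_iota 0 0 (n := #|I|)) -?sw ?index_mem //.
  by rewrite sw index_uniq ?iota_uniq.
move=> k; rewrite mem_iota add0n => /andP[_ kI].
rewrite nth_gal ?(ltnW kI) // nth_gal //.
have E : separates a i (cell [set i in take k w]) (cell [set i in take k.+1 w]) <->
    k = index i w.
  rewrite separates_negs; try exact: gal_chamber.
  rewrite !negs_gal // !inE !in_take // ltnS.
  split; first by case: ltngtP.
  by move=> <-; rewrite ltnn leqnn.
by apply/asboolP/eqP => /E.
Qed.

Lemma Xsep_gal (X : {vspace 'rV[R]_d}) w w' : gword b [set: I] w -> gword b [set: I] w' ->
  Xsep a X (gal w) (gal w') <-> sepw (flat a X) w w'.
Proof.
move=> gw gw'; split.
  case=> i [j [iX jX]]; rewrite !cross_gal // => ij.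
  by apply/sepwP; exists i, j; rewrite !inE.
case/sepwP=> i [j []]; rewrite !inE => iX jX ij.
by exists i, j; rewrite !cross_gal.
Qed.

Hypothesis aP : is_arrangement a.

Lemma lines_oriented : lines b = lines a.
Proof. exact: lines_scale oriented_scale. Qed.

Lemma oriented_free i j : i != j -> free [:: b i; b j].
Proof.
move=> ij; apply: (@arrangement_free _ _ _ b) => //; have [a0 Hinj] := aP.
have HE k : H b k = H a k by have [c cn0 e] := oriented_scale k; rewrite /H e hyp_scale.
split=> [k|k l].
  have [c cn0 ->] := oriented_scale k; rewrite scaler_eq0 negb_or cn0; exact: a0.
by rewrite !HE; exact: Hinj.
Qed.

Lemma L2sep_gal w w' : gword b [set: I] w -> gword b [set: I] w' ->
  L2sep a (gal w) (gal w') = sepn b w w'.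
Proof.
move=> gw gw'; rewrite /sepn lines_oriented -(count_lines aP (fun X => sepw X w w')).
apply: eq_count => X /=; apply/asboolP/idP => /(Xsep_gal X gw gw') //.
Qed.

End Galleries.

Lemma L2sep_tri (R : realType) (d : nat) (I : finType) (a : I -> 'rV[R]_d) x y z :
  L2sep a x z <= L2sep a x y + L2sep a y z.
Proof.
rewrite /L2sep -count_predUI; apply: leq_trans (leq_addr _ _).
apply: sub_count => X /asboolP[i [j [iX jX ij]]]; apply/orP.
have [e|ne] := eqVneq (cross a x i < cross a x j) (cross a y i < cross a y j).
  by right; apply/asboolP; exists i, j; rewrite -e.
by left; apply/asboolP; exists i, j.
Qed.

Lemma L2sep_walk (R : realType) (d : nat) (I : finType) (a : I -> 'rV[R]_d) V k x y :
  nwalk V (adj2 a) k x y -> L2sep a x y <= k.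
Proof.
elim: k x => [|k IH] x /=.
  case=> _ <-; rewrite /L2sep (_ : count _ _ = 0) //; apply/eqP; rewrite -leqn0 leqNgt -has_count.
  by apply/hasPn => X _; apply/asboolP => -[i [j [_ _]]]; rewrite eqxx.
case=> z [_ xz /IH zy]; apply: leq_trans (L2sep_tri a x z y) _.
by rewrite -add1n -xz leq_add2l.
Qed.

Section MainGraph.
Import numFieldNormedType.Exports.

Lemma gallery_diameter (R : realType) (d : nat) (I : finType) (a : I -> 'rV[R]_d) p0 :
  complement a p0 -> is_arrangement a -> core (oriented a p0) [set: I] ->
  has_diameter (G2_vertex a (@connected_component 'rV[R]_d (complement a) p0)) (adj2 a)
    (size (L2 a)).
Proof.
move=> p0C aP cr; have bfree := oriented_free p0C aP.
have -> : @connected_component 'rV[R]_d (complement a) p0 = cell a p0 finset.set0.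
  rewrite component_cell //; apply/seteqP; split=> y yP i; have := yP i;
    by rewrite finset.in_set0 lform_oriented.
have [r [gr _]] := cr.
have sizeE : size (L2 a) = #|lines (oriented a p0)| by rewrite lines_oriented // card_lines.
split=> [x y Vx Vy|].
  have [w gw ->] := min_word p0C gr Vx; have [w' gw' ->] := min_word p0C gr Vy.
  have [n ln nw] := core_diameter bfree (oriented_pos p0C) cr gw gw'.
  exists n; first by rewrite sizeE.
  apply/nwalk_walk; apply: nwalk_map nw => [t gt|t t' gt gt' f].
    exact: gal_min.
  by rewrite /adj2 L2sep_gal // (flip_sep bfree gt f).
exists (gal a p0 r), (gal a p0 (rev r)); split; try apply: gal_min => //.
  exact: gword_rev.
move=> k kL /nwalk_walk/L2sep_walk.
rewrite L2sep_gal //; last exact: gword_rev.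
by rewrite (sepn_rev gr) -sizeE leqNgt kL.
Qed.

End MainGraph.

(** * Induction along a modular flag *)

Section Supersolvable.
Import Order.TTheory GRing.Theory Num.Theory numFieldNormedType.Exports.
Local Open Scope ring_scope.
Variables (R : realType) (d : nat) (I : finType) (a : I -> 'rV[R]_d) (p0 : 'rV[R]_d).
Variable F : nat -> {vspace 'rV[R]_d}.
Hypothesis p0C : complement a p0.
Hypothesis aP : is_arrangement a.
Let c0 := @connected_component 'rV[R]_d (complement a) p0.
Hypothesis FP : modular_flag a F.
Hypothesis c0F : incident_flag c0 F.
Local Notation b := (oriented a p0).

Let S k : {set I} := [set i | (F k <= H a i)%VS].

(** The closure of the chamber contains a spanning family of [F k.+1], which cannot lie in [F k] for
    reasons of dimension. *)
Lemma flag_vector k : (k < d)%N -> exists v, [/\ v \in F k.+1, v \notin F k &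
  forall i, 0 <= lform (b i) v].
Proof.
move=> kd; have [s [sP ds]] := c0F kd.
have [_ _ /(_ k.+1 kd)[_ dk1] _] := FP; have [_ _ /(_ k (ltnW kd))[_ dk] _] := FP.
have [v vs vF] : exists2 v, v \in s & v \notin F k.
  apply/hasP; apply: contraT; rewrite -all_predC => /allP sF.
  have : (span s <= F k)%VS by apply/span_subvP => v /sF /=; rewrite negbK.
  by move/dimvS; rewrite ds dk1 dk ltnn.
have [vc vF1] := sP v vs; exists v; split=> // i.
apply: closure_halfspace vc => y; rewrite /c0 component_cell // => yP.
by rewrite lform_oriented ltW.
Qed.

Lemma flag_core k : (k <= d)%N -> core b (S k).
Proof.
have [F0 Fd FL Fmod] := FP; have bfree := oriented_free p0C aP.
(* Downward induction on the index: [S d] is empty, and [S 0] consists of all hyperplanes. *)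
move=> kd; rewrite -(subKn kd); move: (d - k)%N (leq_subr k d) => {kd} {}k.
elim: k => [|k IH] kd.
  rewrite subn0 (_ : S d = finset.set0); first exact: core0.
  apply/setP => i; rewrite !inE Fd; apply/negP => /dimvS.
  by have := dim_hyp aP i; rewrite dimvf [dim _]mul1n; lia.
have {IH} := IH (ltnW kd); set m := (d - k.+1)%N.
have -> : (d - k)%N = m.+1 by rewrite /m; lia.
have md : (m < d)%N by rewrite /m; lia.
have [Fm modm] := Fmod m md; have [_ _ dF modP] := modm.
have [v [vF1 vF vP]] := flag_vector md.
have lineE i j : line b i j = line a i j.
  apply/setP => l; rewrite !inE -!hyp_cap_sub.
  have hE n : hyp (b n) = hyp (a n).
    by have [c cn0 ->] := oriented_scale p0C n; rewrite hyp_scale.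
  by rewrite !hE.
have b0 i : (lform (b i) v == 0) = (v \in H a i).
  rewrite mem_hyp lform_oriented mulf_eq0.
  by rewrite (negbTE ((complementP a p0).1 p0C i)).
(* A hyperplane through [F m] that contains [v] contains [F m.+1]; so the fiber forms, nonnegative
   at [v], are positive there. *)
have FvE : (F m + <[v]>)%VS = F m.+1.
  apply/eqP; rewrite eqEdim subv_add Fm -memvE vF1 /= dF.
  rewrite dimv_disjoint_sum ?dim_vline.
    by have [v0|_] := eqVneq v 0; [rewrite v0 mem0v in vF|rewrite addn1].
  apply/eqP; rewrite -subv0; apply/subvP => x; rewrite memv_cap => /andP[xF /vlineP[c ex]].
  rewrite memv0; have [c0'|cn0] := eqVneq c 0; first by rewrite ex c0' scale0r.
  case/negP: vF; have -> : v = c^-1 *: x by rewrite ex scalerA mulVf // scale1r.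
  exact: memvZ.
apply: (@core_step _ _ _ b bfree (S m) (S m.+1) v p0).
- by apply/fintype.subsetP => i; rewrite !inE; exact: subv_trans.
- exact: oriented_pos.
- move=> i j; rewrite !inE => iS jS; apply/fintype.subsetP => l.
  rewrite lineE !inE -hyp_cap_sub; apply: subv_trans.
  by rewrite subv_cap iS jS.
- by move=> i; rewrite inE => iS; apply/eqP; rewrite b0; exact: (subvP iS).
- move=> i; rewrite !inE => /andP[iS1 iS]; rewrite lt0r vP andbT b0.
  by apply: contra iS1 => vi; rewrite -FvE subv_add iS -memvE.
- move=> i j; rewrite !inE => /andP[iS1 iS] /andP[jS1 jS] ij.
  have [l el] := modP i j ij iS jS iS1 jS1; exists l.
    by rewrite inE el addvSl.
  by rewrite lineE inE -hyp_cap_sub -/(H a l) el addvSr.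
Qed.

Lemma supersolvable_diameter :
  has_diameter (G2_vertex a c0) (adj2 a) (size (L2 a)).
Proof.
apply: gallery_diameter => //; have := flag_core (leq0n d).
rewrite (_ : S 0 = [set: I]) //; apply/setP => i.
by have [F0 _ _ _] := FP; rewrite !inE F0 sub0v.
Qed.

End Supersolvable.

(** * Reduced words in reflection groups *)

Section Alternating.
Local Open Scope group_scope.
Variables (gT : finGroupType) (J : eqType) (s : J -> gT).
Implicit Types (i j : J) (w : seq J).

Lemma wprod_cat u w : wprod s (u ++ w) = wprod s u * wprod s w.
Proof. exact: big_cat. Qed.

Lemma wprod_rcons w j : wprod s (rcons w j) = wprod s w * s j.
Proof. by rewrite -cats1 wprod_cat /wprod big_seq1. Qed.

Lemma wprod_cons w j : wprod s (j :: w) = s j * wprod s w.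
Proof. exact: big_cons. Qed.

Lemma altS i j k : alt i j k.+1 = i :: alt j i k.
Proof.
rewrite /alt /mkseq /= -[1%N]addn0 iotaDl -map_comp; congr cons.
by apply: eq_map => t /=; case: odd.
Qed.

Lemma size_alt i j k : size (alt i j k) = k.
Proof. exact: size_mkseq. Qed.

Lemma alt_rcons i j k : alt i j k.+1 = rcons (alt i j k) (if odd k then j else i).
Proof. exact: mkseqS. Qed.

Lemma alt_add i j k l :
  alt i j (k + l) = alt i j k ++ (if odd k then alt j i l else alt i j l).
Proof.
elim: k i j => // k IH i j; rewrite addSn !altS IH /=.
by case: (odd k).
Qed.

Lemma alt_cat i j k l : (k <= l)%N -> exists v, alt i j l = alt i j k ++ v.
Proof. by move=> kl; eexists; rewrite -{1}(subnKC kl) alt_add. Qed.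

Lemma alternatingE i j w : (forall k, k \in w -> k = i \/ k = j) ->
  sorted (fun k l => k != l) w -> head i w = i -> i != j -> w = alt i j (size w).
Proof.
elim: w i j => // k w IH i j wij /= sw ki; rewrite {k}ki in wij sw * => ij; rewrite altS; congr cons.
apply: IH; last by rewrite eq_sym.
- by move=> l lw; have [|->|->] := wij l; rewrite ?inE ?lw ?orbT; [|right|left].
- exact: path_sorted sw.
- case: w wij sw => //= l w wij /andP[kl _].
  by have [|lk|//] := wij l; [rewrite !inE eqxx orbT|rewrite lk eqxx in kl].
Qed.

Hypothesis s2 : forall j, s j * s j = 1.

(** Conjugation by [s j] inverts the rotation [s i * s j], so the two alternating words of length
    [k] differ by its [k]-th power. *)
Lemma alt_prod i j k :
  wprod s (alt i j k) = (s i * s j) ^+ k * wprod s (alt j i k).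
Proof.
have inv l : (s l)^-1 = s l by apply/eqP; rewrite eq_invg_mul s2.
have conj k' : s j * (s i * s j) ^+ k' = (s i * s j) ^- k' * s j.
  rewrite -expgVn invMg !inv; elim: k' => [|k' IH]; first by rewrite !expg0 mulg1 mul1g.
  by rewrite !expgSr mulgA IH -!mulgA.
elim: k => [|k IH]; first by rewrite expg0 mul1g.
rewrite !altS !wprod_cons IH [s j * (_ * _)]mulgA conj expgS.
by rewrite -!mulgA mulKVg [s j * (s j * _)]mulgA s2 mul1g.
Qed.

Lemma alt_prod_eq i j k :
  wprod s (alt i j k) = wprod s (alt j i k) <-> #[s i * s j] %| k.
Proof.
rewrite order_dvdn alt_prod; split=> [e|/eqP->]; last by rewrite mul1g.
by apply/eqP; apply: (mulIg (wprod s (alt j i k))); rewrite mul1g.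
Qed.

(* Beyond the order of [s i * s j] an alternating word can be shortened by two
   letters. *)
Lemma alt_shorten i j : i != j -> s i * s j != 1 ->
  wprod s (alt i j #[s i * s j].+1) = wprod s (alt j i #[s i * s j].-1).
Proof.
move=> ij n1; rewrite alt_rcons wprod_rcons.
have -> := (alt_prod_eq i j #[s i * s j]).2 (dvdnn _).
case: #[_] (order_gt0 (s i * s j)) => // o _ /=.
by rewrite alt_rcons wprod_rcons -mulgA; case: odd; rewrite /= s2 mulg1.
Qed.

End Alternating.

(** * Action of words by orthogonal reflections *)

Section Reflections.
Import Order.TTheory GRing.Theory Num.Theory.
Local Open Scope ring_scope.
Variables (R : realType) (d : nat) (I : finType) (a : I -> 'rV[R]_d).
Variables (J : finType) (sig : J -> I).
Local Notation al j := (a (sig j)).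

Definition sreflect j x : 'rV[R]_d :=
  x - (2 * lform (al j) x / lform (al j) (al j)) *: al j.

(** The first letter acts last: appending a letter to [w] moves the image of the base chamber across
    one of its walls. *)
Definition actw (w : seq J) (x : 'rV[R]_d) := foldr sreflect x w.

Lemma actw_cat u w x : actw (u ++ w) x = actw u (actw w x).
Proof. exact: foldr_cat. Qed.

Lemma actw_rcons w j x : actw (rcons w j) x = actw w (sreflect j x).
Proof. by rewrite -cats1 actw_cat. Qed.

Lemma refl_lin j c x y : sreflect j (c *: x + y) = c *: sreflect j x + sreflect j y.
Proof.
rewrite /sreflect lformDr lformZr scalerBr mulrDr mulrDl scalerDl scalerA opprD.
by rewrite addrACA; congr (_ - _ *: _ + _); ring.
Qed.

Lemma actw_lin w c x y : actw w (c *: x + y) = c *: actw w x + actw w y.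
Proof. by elim: w => //= j w ->; exact: refl_lin. Qed.

Lemma actw0 w : actw w 0 = 0.
Proof.
have := actw_lin w 0 0 0; rewrite !scale0r !add0r.
by have := actw_lin w 1 0 0; rewrite !scale1r addr0 => e _; apply: (addrI (actw w 0)); rewrite -e addr0.
Qed.

Lemma actwZ w c x : actw w (c *: x) = c *: actw w x.
Proof. by rewrite -[c *: x]addr0 actw_lin actw0 addr0. Qed.

Lemma actwN w x : actw w (- x) = - actw w x.
Proof. by rewrite -scaleN1r actwZ scaleN1r. Qed.

Hypothesis al_neq0 : forall j, lform (al j) (al j) != 0.

Lemma refl_root j : sreflect j (al j) = - al j.
Proof.
by rewrite /sreflect mulfK // -{1}[al j]scale1r -scalerBl -[RHS]scaleN1r; congr (_ *: _); ring.
Qed.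

Lemma refl_form j x y : lform (sreflect j x) (sreflect j y) = lform x y.
Proof.
rewrite /sreflect !(lformDl, lformDr, lformNl, lformNr, lformZl, lformZr).
rewrite (lformC x (al j)); have := al_neq0 j.
move: (lform (al j) (al j)) (lform _ x) (lform _ y) (lform x y) => p q r t p0.
by field.
Qed.

Lemma reflK j x : sreflect j (sreflect j x) = x.
Proof.
rewrite {1}/sreflect {1}/sreflect lformDr lformNr lformZr.
rewrite -addrA -opprD -scalerDl -[RHS]subr0; congr (_ - _).
rewrite -[RHS](scale0r (al j)); congr (_ *: _).
have := al_neq0 j; move: (lform (al j) (al j)) (lform _ x) => p q p0.
by field.
Qed.

Lemma actw_form w x y : lform (actw w x) (actw w y) = lform x y.
Proof. by elim: w => //= j w IH; rewrite refl_form. Qed.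

Lemma actw_rev w x : actw (rev w) (actw w x) = x.
Proof.
by elim: w x => //= j w IH x; rewrite rev_cons actw_rcons reflK IH.
Qed.

Lemma actw_revr w x : actw w (actw (rev w) x) = x.
Proof. by rewrite -{1}[w]revK actw_rev. Qed.

Lemma lform_actw w x y : lform x (actw w y) = lform (actw (rev w) x) y.
Proof. by rewrite -(actw_form (rev w)) actw_rev. Qed.

Lemma actw_span w (s t : J) x :
  (forall k, k \in w -> k = s \/ k = t) ->
  x \in <<[:: al s; al t]>>%VS -> actw w x \in <<[:: al s; al t]>>%VS.
Proof.
elim: w => //= k w IH wst xV.
have {IH} := IH (fun l lw => wst l (@mem_behead _ (k :: w) l lw)) xV.
rewrite /sreflect => h; rewrite rpredB // rpredZ // memv_span //.
by have [|->|->] := wst k; rewrite !inE ?eqxx ?orbT.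
Qed.

End Reflections.

(** * Reduced words of the longest element as orderings of the hyperplanes *)

Section Coxeter.
Import Order.TTheory GRing.Theory Num.Theory.
Local Open Scope ring_scope.
Variables (R : realType) (d : nat) (I : finType) (a : I -> 'rV[R]_d).
Variables (J : finType) (sig : J -> I) (x0 : 'rV[R]_d).
Variables (gT : finGroupType) (s : J -> gT).
Local Notation al j := (a (sig j)).
Local Notation refl := (sreflect a sig).
Local Notation actw := (actw a sig).

Hypothesis x0P : forall i, 0 < lform (a i) x0.
Hypothesis afree : forall i j, i != j -> free [:: a i; a j].
(** The facts on root systems that are checked in coordinates for each type: a simple reflection
    permutes the other positive roots, dual vectors make the simple roots independent, the simple
    roots cut out the base chamber, the action of words factors through the group, and a word that
    keeps the base chamber is trivial. *)
Hypothesis refl_pos : forall j i, i != sig j -> exists k, refl j (a i) = a k.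
Hypothesis simple_dual : forall j, exists y,
  forall k, lform (al k) y = (k == j)%:R.
Hypothesis simple_pos : forall x, (forall j, 0 < lform (al j) x) ->
  forall i, 0 < lform (a i) x.
Hypothesis rep : forall w w', wprod s w = wprod s w' -> actw w =1 actw w'.
Hypothesis faith : forall w, (forall i, 0 < lform (a i) (actw w x0)) ->
  wprod s w = 1%g.

Let al_neq0 j : lform (al j) (al j) != 0.
Proof.
apply: contraTneq (x0P (sig j)) => e; suff -> : al j = 0 by rewrite lformC lform0r ltxx.
apply/rowP => k; move: e; rewrite lformE => /eqP.
rewrite psumr_eq0; last by move=> l _; rewrite -expr2 sqr_ge0.
move=> /allP z; have := z k (mem_index_enum _).
by rewrite /= mulf_eq0 orbb mxE => /eqP.
Qed.

Let actK w x : actw (rev w) (actw w x) = x.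
Proof. exact: actw_rev. Qed.

Let actKr w x : actw w (actw (rev w) x) = x.
Proof. exact: actw_revr. Qed.

Let form_act w x y : lform x (actw w y) = lform (actw (rev w) x) y.
Proof. exact: lform_actw. Qed.

Let neg_x0 i : lform (- a i) x0 < 0.
Proof. by rewrite lformNl oppr_lt0. Qed.

Lemma root_sign_inj i k : a i = a k \/ a i = - a k -> i = k.
Proof.
move=> h; apply/eqP; apply: contraT => ik.
case: h => e; have := a_indep afree ik.
  by move=> /(_ 1 (-1)); rewrite e scale1r scaleN1r subrr => /(_ erefl)[/eqP]; rewrite oner_eq0.
by move=> /(_ 1 1); rewrite e !scale1r addNr => /(_ erefl)[/eqP]; rewrite oner_eq0.
Qed.

Let reflN j x : refl j (- x) = - refl j x.
Proof. exact: (actwN a sig [:: j]). Qed.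

Lemma actw_root w i : exists k, actw w (a i) = a k \/ actw w (a i) = - a k.
Proof.
elim: w => [|j w [k hk]] /=; first by exists i; left.
have [e|nk] := eqVneq k (sig j).
  by exists (sig j); case: hk => ->; rewrite e ?reflN refl_root ?opprK //; [right|left].
by have [l el] := refl_pos nk; exists l; case: hk => ->; rewrite ?reflN el; [left|right].
Qed.

(* The hyperplane crossed between the chambers of [w] and of [rcons w j]. *)
Definition rt (w : seq J) (j : J) : I :=
  odflt (sig j) [pick i | (actw w (al j) == a i) || (actw w (al j) == - a i)].

Lemma rtP w j : actw w (al j) = a (rt w j) \/ actw w (al j) = - a (rt w j).
Proof.
rewrite /rt; case: pickP => [i /orP[/eqP|/eqP]|no] /=; [by left|by right|].
have [k hk] := actw_root w (sig j); have := no k.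
by case: hk => ->; rewrite eqxx ?orbT.
Qed.

Lemma rt_uniq w j i : actw w (al j) = a i \/ actw w (al j) = - a i -> rt w j = i.
Proof.
have := rtP w j; case=> -> [] e; apply: root_sign_inj; rewrite -?e; [left|right|right|left] => //.
- by rewrite -[LHS]opprK e.
- by rewrite -[LHS]opprK e opprK.
Qed.

Definition inv (w : seq J) : {set I} := [set i | lform (a i) (actw w x0) < 0].

Lemma inv_neq0 w i : lform (a i) (actw w x0) != 0.
Proof.
rewrite form_act; have [k [->|->]] := actw_root (rev w) i.
  by rewrite gt_eqF.
by rewrite lt_eqF.
Qed.

Lemma inv_pos w i : i \notin inv w -> 0 < lform (a i) (actw w x0).
Proof. by rewrite inE -leNgt le_eqVlt eq_sym (negbTE (inv_neq0 w i)). Qed.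

(** A simple reflection makes only its own root negative; transported by [w], the new letter changes
    the side of [rt w j] alone. *)
Lemma rcons_sign w j i : lform (a i) (actw (rcons w j) x0) < 0 =
  ((lform (a i) (actw w x0) < 0) (+) (i == rt w j)).
Proof.
rewrite actw_rcons !form_act -[x in lform _ (refl j x)]/(_ x0).
have -> x : lform x (refl j x0) = lform (refl j x) x0.
  exact: (lform_actw al_neq0 [:: j]).
have [k hk] := actw_root (rev w) i.
have aiE : a i = actw w (a k) \/ a i = - actw w (a k).
  by case: hk => e; [left|right]; rewrite -?actwN -1?e ?opprK -?e actKr // -actwN -[- a k]opprK.
have [ek|nk] := eqVneq k (sig j).
  have -> : i == rt w j.
    apply/eqP/esym/rt_uniq; rewrite -ek; case: aiE => ->; first by left.
    by right; rewrite opprK.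
  rewrite addbT; case: hk => ->; rewrite ek ?reflN refl_root // ?opprK.
    by rewrite neg_x0 (lt_gtF (x0P _)).
  by rewrite neg_x0 (lt_gtF (x0P _)).
have -> : (i == rt w j) = false.
  apply: contraNF nk => /eqP ei; apply/eqP/root_sign_inj.
  have := rtP w j; rewrite -ei => h.
  have {h} : al j = actw (rev w) (a i) \/ al j = - actw (rev w) (a i).
    case: h => h; [left|right]; first by rewrite -h actK.
    by rewrite -actwN -h actK.
  by case: hk => ->; rewrite ?opprK => -[] ->; rewrite ?opprK; auto.
have [l el] := refl_pos nk; rewrite addbF.
by case: hk => ->; rewrite ?reflN el ?neg_x0 // !(lt_gtF (x0P _)).
Qed.

Lemma inv_rcons w j i : (i \in inv (rcons w j)) = (i \in inv w) (+) (i == rt w j).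
Proof. by rewrite !inE rcons_sign. Qed.

Lemma inv_nil : inv [::] = finset.set0.
Proof. by apply/setP => i; rewrite !inE (lt_gtF (x0P i)). Qed.

Lemma card_inv_rcons w j : #|inv (rcons w j)| =
  (if rt w j \in inv w then #|inv w|.-1 else #|inv w|.+1).
Proof.
case: ifPn => h.
  rewrite (cardsD1 (rt w j) (inv w)) h /=; apply: eq_card => i.
  by rewrite inv_rcons finset.in_setD1; case: eqVneq => [->|]; rewrite ?h ?addbF.
have -> : inv (rcons w j) = rt w j |: inv w.
  apply/setP => i; rewrite inv_rcons finset.in_setU1.
  by case: eqVneq => [->|]; rewrite ?(negbTE h) ?addbF.
by rewrite cardsU1 h.
Qed.

Lemma inv_wprod w w' : wprod s w = wprod s w' -> inv w = inv w'.
Proof. by move=> /rep e; apply/setP => i; rewrite !inE e. Qed.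

Lemma card_inv w : (#|inv w| <= size w)%N.
Proof.
elim/last_ind: w => [|w j IH]; first by rewrite inv_nil cards0.
rewrite card_inv_rcons size_rcons; case: ifP => _ //.
by apply: leq_trans (leq_pred _) _; exact: leqW.
Qed.

Lemma s_invol j : (s j * s j = 1)%g.
Proof.
rewrite -[LHS]/(s j * s j)%g; have := @faith [:: j; j].
rewrite wprod_cons /wprod big_seq1; apply=> i /=.
by rewrite reflK.
Qed.

Lemma rt_pos w j : (rt w j \in inv w) = (lform (actw w (al j)) x0 < 0).
Proof.
have h : lform (actw w (al j)) (actw w x0) = lform (al j) x0 by exact: actw_form.
rewrite inE; case: (rtP w j) => e; move: h; rewrite e => h.
  by rewrite h !(lt_gtF (x0P _)).
by rewrite neg_x0 -oppr_gt0 -lformNl h x0P.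
Qed.

(** If no letter leads back towards the base, all simple forms are positive at the image of [x0]
    under [rev w], which therefore keeps the base chamber. *)
Lemma descent_exists w : wprod s w != 1%g -> exists j, rt w j \in inv w.
Proof.
move=> w1; apply/existsP; apply: contraNT w1; rewrite negb_exists => /forallP no.
have pos j : 0 < lform (al j) (actw (rev w) x0).
  have := no j; rewrite rt_pos form_act revK -leNgt le_eqVlt eq_sym => /orP[/eqP e|//].
  by have := inv_neq0 (rev w) (sig j); rewrite form_act revK e eqxx.
have e : wprod s (rev w) = wprod s [::].
  by rewrite (faith (simple_pos pos)) /wprod big_nil.
by apply/eqP/faith => i; rewrite -{1}[x0](rep e) actKr.
Qed.

(** A descent [j] is used twice: appended to lower the number of inversions, then appended again to
    recover the group element. *)
Lemma inv_word w : exists2 w', wprod s w' = wprod s w & size w' = #|inv w|.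
Proof.
have [n] := ubnP #|inv w|; elim: n w => // n IH w; rewrite ltnS => wn.
have [w1|/descent_exists[j jw]] := eqVneq (wprod s w) 1%g.
  exists [::]; first by rewrite w1 /wprod big_nil.
  by rewrite (@inv_wprod w [::]) ?inv_nil ?cards0 // w1 /wprod big_nil.
have w0 : (0 < #|inv w|)%N by apply/card_gt0P; exists (rt w j).
have cj : #|inv (rcons w j)| = #|inv w|.-1 by rewrite card_inv_rcons jw.
have [|w' e sw'] := IH (rcons w j); first by rewrite cj; apply: leq_trans wn; rewrite prednK.
exists (rcons w' j); last by rewrite size_rcons sw' cj prednK.
by rewrite wprod_rcons e wprod_rcons -mulgA s_invol mulg1.
Qed.

Lemma inv_inj w w' : inv w = inv w' -> wprod s w = wprod s w'.
Proof.
move=> e; have main : wprod s (rev w' ++ w) = 1%g.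
  apply: faith => i; rewrite actw_cat form_act revK.
  have := x0P i; rewrite -{1}(actw_form al_neq0 w').
  have sgn k : (lform (a k) (actw w x0) < 0) = (lform (a k) (actw w' x0) < 0).
    by move/setP/(_ k): e; rewrite !inE.
  have [k [->|->]] := actw_root w' i; rewrite ?lformNl ?oppr_gt0 ?sgn //.
  by move=> h; rewrite lt0r inv_neq0 leNgt sgn -leNgt ltW.
have inv1 : wprod s (rev w' ++ w') = 1%g by apply: faith => i; rewrite actw_cat actK.
by apply: (mulgI (wprod s (rev w'))); rewrite -!wprod_cat main inv1.
Qed.

(** Reducedness in geometric form: no hyperplane is crossed twice. *)
Definition tight (w : seq J) : bool := size w == #|inv w|.

Lemma tight_rcons w j : tight (rcons w j) = tight w && (rt w j \notin inv w).
Proof.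
rewrite /tight size_rcons card_inv_rcons; case: ifP => h /=.
  rewrite andbF; apply/negbTE; rewrite neq_ltn; apply/orP; right.
  by rewrite ltnS (leq_trans (leq_pred _)) ?card_inv.
by rewrite eqSS andbT.
Qed.

Lemma tight_catl u w : tight (u ++ w) -> tight u.
Proof.
elim/last_ind: w => [|w j IH]; first by rewrite cats0.
by rewrite -rcons_cat tight_rcons => /andP[/IH].
Qed.

(** The hyperplanes crossed by the gallery of [w] that starts at the chamber of [u]; from [[::]],
    this is the ordering attached to a word. *)
Fixpoint rseq (u w : seq J) : seq I :=
  if w is j :: w' then rt u j :: rseq (rcons u j) w' else [::].

Lemma rseq_cat u w w' : rseq u (w ++ w') = rseq u w ++ rseq (u ++ w) w'.
Proof.
by elim: w u => [|j w IH] u /=; rewrite ?cats0 // IH cat_rcons.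
Qed.

Lemma size_rseq u w : size (rseq u w) = size w.
Proof. by elim: w u => //= j w IH u; rewrite IH. Qed.

Lemma rseq_rcons w j : rseq [::] (rcons w j) = rcons (rseq [::] w) (rt w j).
Proof. by rewrite -!cats1 rseq_cat. Qed.

Lemma rt_ext u u' j : actw u =1 actw u' -> rt u j = rt u' j.
Proof. by move=> e; rewrite /rt e. Qed.

Lemma rseq_ext u u' w : actw u =1 actw u' -> rseq u w = rseq u' w.
Proof.
elim: w u u' => //= j w IH u u' e; rewrite (rt_ext _ e) (IH _ (rcons u' j)) //.
by move=> x; rewrite !actw_rcons.
Qed.

Lemma rt_inj u j k : rt u j = rt u k -> j = k.
Proof.
move=> e; have al_jk : al j = al k \/ al j = - al k.
  have := rtP u j; have := rtP u k; rewrite e => -[] ek [] ej.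
  - by left; rewrite -(actK u (al j)) ej -ek actK.
  - by right; rewrite -(actK u (al j)) ej -ek actwN actK.
  - by right; rewrite -(actK u (al j)) ej -[a _]opprK -ek actwN actK.
  - by left; rewrite -(actK u (al j)) ej -ek actK.
have [y yE] := simple_dual j; apply/eqP; apply: contraT => jk.
have := yE j; rewrite eqxx; case: al_jk => ->; rewrite ?lformNl yE eq_sym (negbTE jk) ?oppr0 => /eqP;
  by rewrite eq_sym oner_eq0.
Qed.

Lemma rseq_inj u w w' : rseq u w = rseq u w' -> w = w'.
Proof.
elim: w w' u => [|j w IH] [|j' w'] u //= [/rt_inj <-] /IH -> //.
Qed.

Lemma tight_rseq w : tight w -> uniq (rseq [::] w) /\ rseq [::] w =i inv w.
Proof.
elim/last_ind: w => [|w j IH]; first by rewrite inv_nil; split=> // i; rewrite finset.in_set0.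
rewrite tight_rcons => /andP[/IH[u e] jw]; rewrite rseq_rcons; split.
  by rewrite rcons_uniq u e jw.
move=> i; rewrite mem_rcons inE e inv_rcons.
by case: eqVneq => [->|]; rewrite ?(negbTE jw) ?addbF.
Qed.

Lemma tight_gword w : tight w -> inv w = [set: I] -> gword a [set: I] (rseq [::] w).
Proof.
move=> tw iw; have [ur er] := tight_rseq tw; split=> // [i|u v e].
  by rewrite er iw.
have ew := cat_take_drop (size u) w.
have eu : u = rseq [::] (take (size u) w).
  have := e; rewrite -{1}ew rseq_cat => /eqP.
  rewrite eqseq_cat => [/andP[/eqP->]|] //; rewrite size_rseq size_takel //.
  by rewrite -(size_rseq [::] w) e size_cat leq_addr.
have [_ iu] : uniq u /\ u =i inv (take (size u) w).
  by rewrite {1 2}eu; apply: tight_rseq; apply: (@tight_catl _ (drop (size u) w)); rewrite ew.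
exists (actw (take (size u) w) x0) => i _; rewrite iu; case: ifPn => [|/inv_pos//].
by rewrite inE.
Qed.

(** Letter by letter: the point realizing the next prefix is outside the chamber of [w], hence
    beyond one of its walls, and the only hyperplane newly crossed is [i]. *)
Lemma gword_word r : gword a [set: I] r ->
  exists w, [/\ tight w, rseq [::] w = r & inv w = [set: I]].
Proof.
case=> ur rI gr.
suff main u v : r = u ++ v -> exists2 w, tight w & rseq [::] w = u.
  have [|w tw ew] := main r [::]; first by rewrite cats0.
  exists w; split=> //; apply/setP => i; have [_ <-] := tight_rseq tw.
  by rewrite ew rI.
elim/last_ind: u v => [|u i IH] v e.
  by exists [::] => //; rewrite /tight inv_nil cards0.
have [|w tw ew] := IH (i :: v); first by rewrite e cat_rcons.
have [x xr] := gr _ _ e; have [_ wu] := tight_rseq tw; rewrite ew in wu.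
have xs k : if k \in rcons u i then lform (a k) x < 0 else 0 < lform (a k) x.
  by apply: xr; rewrite finset.in_setT.
have iu : i \notin u.
  by move: ur; rewrite e cat_uniq rcons_uniq => /andP[/andP[]].
have [j jx] : exists j, ~~ (0 < lform (al j) (actw (rev w) x)).
  apply/existsP; apply: contraT; rewrite negb_exists => /forallP pos.
  have := xs i; rewrite mem_rcons mem_head.
  have := inv_pos (w := w) (i := i); rewrite -wu => /(_ iu); rewrite form_act.
  have := @simple_pos (actw (rev w) x) (fun j => negbNE (pos j)).
  move=> px; rewrite -[lform (a i) x](actw_form al_neq0 (rev w)).
  have [k [->|->]] := actw_root (rev w) i; first by rewrite (lt_gtF (px k)).
  by rewrite (lt_gtF (neg_x0 k)).
have jw : rt w j = i.
  have := xs (rt w j); move: jx; rewrite form_act revK mem_rcons inE.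
  case: eqP => [->|] //= _.
  have h : lform (actw w (al j)) (actw w x0) = lform (al j) x0 by exact: actw_form.
  have := x0P (sig j); rewrite -h wu inE.
  case: (rtP w j) => ->; first by move=> p /negbTE q; rewrite q (lt_gtF p).
  rewrite !lformNl !oppr_gt0 => -> /negbTE ->.
  by [].
exists (rcons w j); last by rewrite rseq_rcons ew jw.
by rewrite tight_rcons tw jw -wu.
Qed.

(** If every wall leads back, the opposite of the base point is mapped into the base chamber by
    [rev w], and every hyperplane is an inversion; otherwise a letter could lengthen the word. *)
Lemma longest_inv g w : longest s g -> reduced s g w -> tight w /\ inv w = [set: I].
Proof.
case=> w1 [[ew1 min1] max1] [ew minw].
have eqsz : size w = size w1.
  by apply/eqP; rewrite eqn_leq minw // min1.
have tw : tight w.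
  have [w' ew' sw'] := inv_word w; rewrite /tight eqn_leq card_inv andbT -sw'.
  by apply: minw; rewrite ew'.
split=> //; apply/eqP; rewrite -finset.subTset; apply: contraT => nT.
have [j jw] : exists j, rt w j \notin inv w.
  apply/existsP; apply: contraNT nT; rewrite negb_exists => /forallP neg.
  have pos : forall j, 0 < lform (al j) (actw (rev w) (- x0)).
    by move=> j; have := negbNE (neg j); rewrite rt_pos form_act revK lformNr oppr_gt0.
  apply/fintype.subsetP => i _; rewrite inE form_act.
  have [k hk] := actw_root (rev w) i.
  case: hk => e; rewrite e ?neg_x0 //.
  have := simple_pos pos k; rewrite form_act revK -e actKr lformNr oppr_gt0.
  by rewrite (lt_gtF (x0P i)).
have [w' ew' sw'] := inv_word (rcons w j).
have := max1 (wprod s (rcons w j)) w'; rewrite sw' card_inv_rcons (negbTE jw).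
rewrite -(eqP tw) eqsz ltnn; apply; split=> // w'' ew''.
by rewrite sw' -(inv_wprod ew'') card_inv.
Qed.

Lemma inv_longest g w : longest s g -> tight w -> inv w = [set: I] -> reduced s g w.
Proof.
move=> lg tw iw; have [w1 [[ew1 min1] max1]] := lg.
have [t1 i1] := longest_inv lg (conj ew1 min1).
split; first by rewrite -ew1; apply: inv_inj; rewrite iw i1.
by move=> w'; rewrite -ew1 => /inv_wprod e; rewrite (eqP tw) iw -i1 -e card_inv.
Qed.

Lemma root_span w j (V : {vspace 'rV[R]_d}) :
  (a (rt w j) \in V) = (actw w (al j) \in V).
Proof. by case: (rtP w j) => ->; rewrite ?rpredN. Qed.

Lemma rt_line u w j k l : (forall m, m \in w -> m = k \/ m = l) -> j = k \/ j = l ->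
  rt (u ++ w) j \in line a (rt u k) (rt u l).
Proof.
move=> wkl jkl; rewrite inE root_span actw_cat.
have : actw w (al j) \in <<[:: al k; al l]>>%VS.
  apply: (actw_span wkl); apply: memv_span.
  by case: jkl => ->; rewrite !inE eqxx ?orbT.
case/span2P=> b [c ->]; rewrite actw_lin actwZ rpredD // rpredZ // -root_span;
  by apply: memv_span; rewrite !inE eqxx ?orbT.
Qed.

Lemma rseq_line u w1 w k l : (forall m, m \in w1 -> m = k \/ m = l) ->
  (forall m, m \in w -> m = k \/ m = l) ->
  {subset rseq (u ++ w1) w <= line a (rt u k) (rt u l)}.
Proof.
elim: w w1 => //= j w IH w1 w1kl wkl i; rewrite inE => /orP[/eqP->|].
  by apply: rt_line => //; apply: wkl; rewrite mem_head.
rewrite rcons_cat; apply: IH => [m|m mw]; last by apply: wkl; rewrite inE mw orbT.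
by rewrite mem_rcons inE => /orP[/eqP->|/w1kl//]; apply: wkl; rewrite mem_head.
Qed.

(** Pulled back by [u] and [w1], the crossed root is a simple root in the plane of [al k] and
    [al l]; independence of the simple roots leaves only these two. *)
Lemma line_letters u w1 w k l : (forall m, m \in w1 -> m = k \/ m = l) ->
  {subset rseq (u ++ w1) w <= line a (rt u k) (rt u l)} ->
  forall m, m \in w -> m = k \/ m = l.
Proof.
elim: w w1 => //= j w IH w1 w1kl sub.
have jkl : j = k \/ j = l.
  have back m : m \in [:: k; l] -> actw (rev u) (a (rt u m)) \in <<[:: al k; al l]>>%VS.
    move=> mkl; have mz : al m \in <<[:: al k; al l]>>%VS.
      by apply: memv_span; move: mkl; rewrite !inE => /orP[] /eqP->; rewrite eqxx ?orbT.
    have : actw (rev u) (actw u (al m)) \in <<[:: al k; al l]>>%VS by rewrite actK.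
    by case: (rtP u m) => ->; rewrite ?actwN ?rpredN.
  have := sub _ (mem_head _ _); rewrite inE root_span actw_cat => /span2P[b [c e]].
  have aV : al j \in <<[:: al k; al l]>>%VS.
    rewrite -(actK w1 (al j)); apply: (@actw_span _ _ _ a _ sig _ k l).
      by move=> m; rewrite mem_rev; exact: w1kl.
    rewrite -(actK u (actw w1 (al j))) e actw_lin actwZ.
    by rewrite rpredD // ?rpredZ // back // !inE eqxx ?orbT.
  have [y yE] := simple_dual j; case/span2P: aV => p [q ea].
  have := yE j; rewrite ea lformDl !lformZl !yE eqxx.
  have [->|jk] := eqVneq k j; first by left.
  have [->|jl] := eqVneq l j; first by right.
  by rewrite !mulr0 addr0 => /eqP; rewrite eq_sym oner_eq0.
move=> m; rewrite inE => /orP[/eqP->//|mw].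
apply: (IH (rcons w1 j)) mw => [m'|i].
  by rewrite mem_rcons inE => /orP[/eqP->|/w1kl].
by rewrite -rcons_cat => h; apply: sub; rewrite inE h orbT.
Qed.

Lemma rseq_neq u w : uniq (rseq u w) -> sorted (fun k l => k != l) w.
Proof.
elim: w u => //= j [|k w] //= IH u /andP[]; rewrite inE negb_or => /andP[jk _] uw.
rewrite (IH (rcons u j)) // andbT; apply: contraNneq jk => <-; apply/eqP.
apply/esym/rt_uniq; rewrite actw_rcons refl_root // actwN.
by case: (rtP u j) => ->; rewrite ?opprK; [right|left].
Qed.

Lemma line_alt u q k l X : X \in lines a ->
  rt u k \in X -> rt u l \in X -> k != l -> head k q = k ->
  uniq (rseq u q) -> {subset rseq u q <= X} -> q = alt k l (size q).
Proof.
move=> XL kX lX kl hq uq qX.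
have eX : X = line a (rt u k) (rt u l).
  by apply: lines_eq => //; apply: contraNneq kl => /rt_inj ->.
apply: alternatingE => //; last exact: rseq_neq uq.
by apply: (@line_letters u [::]) => //; rewrite cats0 -eX.
Qed.

(** A longer alternating factor could be replaced by one with fewer letters and the same product. *)
Lemma tight_alt u k l m : tight (u ++ alt k l m) -> k != l -> (m <= #[s k * s l]%g)%N.
Proof.
move=> tw kl; rewrite leqNgt; apply/negP => om.
(* Applied to [al l], a trivial product would equate a positive root with a negative one. *)
have n1 : (s k * s l != 1)%g.
  apply/eqP => e; have {}e : wprod s [:: k; l] = wprod s [::] by rewrite /wprod big_cons big_seq1 big_nil.
  have sig_kl : sig l != sig k.
    have [y yE] := simple_dual l; apply: contraNneq kl => skl.
    by have := yE k; rewrite -skl yE eqxx; case: (k == l) => // /eqP; rewrite oner_eq0.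
  have [i ei] := refl_pos sig_kl; have := rep e (al l).
  rewrite /= refl_root // reflN ei => h.
  by have := x0P (sig l); rewrite -h (lt_gtF (neg_x0 i)).
have [v ev] := alt_cat k l om; move: tw; rewrite ev catA => /tight_catl.
rewrite /tight => /eqP tw.
have e : wprod s (u ++ alt k l #[s k * s l]%g.+1) = wprod s (u ++ alt l k #[s k * s l]%g.-1).
  by rewrite !wprod_cat alt_shorten // => j; exact: s_invol.
have := card_inv (u ++ alt l k #[s k * s l]%g.-1); rewrite -(inv_wprod e) -tw !size_cat !size_alt.
by lia.
Qed.

Lemma flip_braid g w w' : longest s g -> reduced s g w -> reduced s g w' ->
  flip a (rseq [::] w) (rseq [::] w') -> braid_adj s w w'.
Proof.
move=> lg rw rw' [u [p [v [X [XL pX e e']]]]].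
have [tw iw] := longest_inv lg rw; have [tw' iw'] := longest_inv lg rw'.
have split3 z r : rseq [::] z = u ++ r ++ v -> exists z1 z2 z3,
    [/\ z = z1 ++ z2 ++ z3, rseq [::] z1 = u, rseq z1 z2 = r & rseq (z1 ++ z2) z3 = v].
  move=> ez; have sz : (size u + (size r + size v) = size z)%N.
    by rewrite -(size_rseq [::] z) ez !size_cat.
  pose z1 := take (size u) z; pose z2 := take (size r) (drop (size u) z).
  pose z3 := drop (size r) (drop (size u) z).
  have ez' : z = z1 ++ z2 ++ z3 by rewrite !cat_take_drop.
  exists z1, z2, z3; rewrite -ez'; move: ez; rewrite {1}ez' !rseq_cat => /eqP.
  rewrite eqseq_cat; last by rewrite size_rseq size_takel // -sz leq_addr.
  case/andP=> /eqP e1; rewrite eqseq_cat; last first.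
    by rewrite size_rseq size_takel // size_drop -sz addKn leq_addr.
  by case/andP=> /eqP e2 /eqP e3.
have [z1 [z2 [z3 [ez e1 e2 e3]]]] := split3 _ _ e.
have [y1 [y2 [y3 [ey d1 d2 d3]]]] := split3 _ _ e'.
have ezy : z1 = y1 by apply: (@rseq_inj [::]); rewrite e1 d1.
rewrite -{y1}ezy in ey d1 d2 d3.
have t12 : tight (z1 ++ z2) by apply: (@tight_catl _ z3); rewrite -catA -ez.
have t12' : tight (z1 ++ y2) by apply: (@tight_catl _ y3); rewrite -catA -ey.
have i12 : inv (z1 ++ z2) = inv (z1 ++ y2).
  apply/setP => i; have [_ <-] := tight_rseq t12; have [_ <-] := tight_rseq t12'.
  by rewrite !rseq_cat !mem_cat e1 e2 d2 mem_rev.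
(* Both blocks cross the same hyperplanes, so they lead to the same group element and the remaining
   letters agree. *)
have w12 := inv_inj i12.
have z3y3 : z3 = y3.
  apply: (@rseq_inj (z1 ++ z2)); rewrite e3 -d3; apply: rseq_ext => x.
  exact/esym/rep.
rewrite -{y3 d3}z3y3 in ey *.
have [i [j [ij eX]]] := linesP _ _ XL.
have up : uniq p.
  by have [] := tight_rseq t12; rewrite rseq_cat e2 cat_uniq => /and3P[].
case: z2 e2 ez t12 i12 w12 e3 => [|k z2] e2 ez t12 i12 w12 e3.
  by have := line_l a i j; rewrite -eX -pX -e2.
case: y2 d2 ey t12' i12 w12 => [|l y2] d2 ey t12' i12 w12.
  by have := line_l a i j; rewrite -eX -pX -mem_rev -d2.
have kX : rt z1 k \in X by rewrite -pX -e2 mem_head.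
have lX : rt z1 l \in X by rewrite -pX -mem_rev -d2 mem_head.
(* Equal first letters would make the first and last elements of [p] coincide. *)
have kl : k != l.
  apply/eqP => kl; have hl : last i p = head i p.
    by rewrite -[p in last _ p]revK -d2 -e2 /= rev_cons last_rcons kl.
  have ip : i \in p by rewrite pX eX line_l.
  have jp : j \in p by rewrite pX eX line_r.
  case: (p) up hl ip jp => [|h t] //= /andP[ht _].
  case/lastP: t ht => [_ _|t h']; last by rewrite last_rcons mem_rcons inE => + e0; rewrite e0 eqxx.
  by rewrite !inE => /eqP ih /eqP jh; rewrite ih jh eqxx in ij.
have sz2 : size (k :: z2) = size p by rewrite -e2 size_rseq.
have sy2 : size (l :: y2) = size p by rewrite -(size_rev p) -d2 size_rseq.
have zalt : k :: z2 = alt k l (size p).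
  rewrite -sz2; apply: (line_alt XL kX lX kl) => //; first by rewrite e2.
  by move=> x; rewrite e2 pX.
have yalt : l :: y2 = alt l k (size p).
  rewrite -sy2; apply: (line_alt XL lX kX) => //; first by rewrite eq_sym.
    by rewrite d2 rev_uniq.
  by move=> x; rewrite d2 mem_rev pX.
(* At most the order, because the word is reduced; a multiple of it, because the two blocks have the
   same product. *)
have po : size p = #[s k * s l]%g.
  apply/eqP; rewrite eqn_leq; apply/andP; split.
    by apply: (@tight_alt z1) => //; rewrite -zalt.
  apply: dvdn_leq; first by rewrite -sz2.
  apply/(alt_prod_eq s_invol); apply: (mulgI (wprod s z1)).
  by rewrite -!wprod_cat -zalt -yalt.
by exists z1, z3, k, l; rewrite -po -zalt -yalt.
Qed.

(** All hyperplanes crossed by the braided factor lie on one flat, the only one that can see a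
    change; this bound gives the lower estimate of the diameter. *)
Lemma braid_sep g w w' : longest s g -> reduced s g w -> reduced s g w' ->
  braid_adj s w w' -> (sepn a (rseq [::] w) (rseq [::] w') <= 1)%N.
Proof.
move=> lg rw rw' [u [v [i [j [ij ew ew']]]]]; set m := #[_]%g in ew ew'.
have [tw iw] := longest_inv lg rw; have [tw' iw'] := longest_inv lg rw'.
have e12 : wprod s (u ++ alt i j m) = wprod s (u ++ alt j i m).
  by rewrite !wprod_cat; congr (_ * _)%g; apply/(alt_prod_eq s_invol).
have [ur rE] := tight_rseq tw; have [ur' rE'] := tight_rseq tw'.
pose r1 := rseq [::] u; pose r3 := rseq (u ++ alt i j m) v.
pose r2 := rseq u (alt i j m); pose r2' := rseq u (alt j i m).
have E : rseq [::] w = r1 ++ r2 ++ r3 by rewrite ew !rseq_cat.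
have E' : rseq [::] w' = r1 ++ r2' ++ r3.
  rewrite ew' !rseq_cat; congr (_ ++ (_ ++ _)); apply: rseq_ext => x.
  exact/esym/rep.
rewrite E in ur rE; rewrite E' in ur' rE'; rewrite E E'.
have nr2 r : uniq (r1 ++ r ++ r3) -> r1 ++ r ++ r3 =i inv w ->
    forall x, (x \in r) = (x \notin r1) && (x \notin r3).
  rewrite iw => ur0 rE0 x; have := rE0 x; rewrite finset.in_setT !mem_cat.
  move: ur0; rewrite !cat_uniq has_cat negb_or => /and3P[_ /andP[/hasPn n1 _] /and3P[_ /hasPn n3 _]].
  have [xr|xr] := boolP (x \in r); first by rewrite n1 //= => _; apply/esym; apply: contraL xr => /n3.
  by case: (x \in r1) => //=; case: (x \in r3).
have r22 x : (x \in r2') = (x \in r2).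
  by rewrite (nr2 _ ur rE) (nr2 r2') // iw -iw'.
have beforeE p q : before (r1 ++ r2 ++ r3) p q != before (r1 ++ r2' ++ r3) p q ->
    p \in r2 /\ q \in r2.
  rewrite !before_cat !r22; case: (p \in r1); case: (q \in r1); case: (p \in r2);
    case: (q \in r2) => //=; by move/eqP => h; case: h.
have r2L : {subset r2 <= line a (rt u i) (rt u j)}.
  have := @rseq_line u [::] (alt i j m) i j; rewrite cats0; apply=> // k.
  by case/mapP=> t _ ->; case: odd; [right|left].
rewrite -(cards1 (line a (rt u i) (rt u j))).
apply/subset_leq_card/fintype.subsetP => X; rewrite !inE => /andP[XL].
case/sepwP=> p [q [pX qX pq]]; have [pr qr] := beforeE _ _ pq.
have npq : p != q by apply: contraNneq pq => ->; rewrite !beforexx.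
have nij : rt u i != rt u j by apply: contraNneq ij => /rt_inj ->.
by rewrite (lines_eq afree XL npq pX qX) (line_eq afree nij npq) ?r2L.
Qed.

Lemma word_diameter g : longest s g -> core a [set: I] ->
  GW_diameter s g #|lines a|.
Proof.
move=> lg cr; split=> [w w' rw rw'|].
  have [tw iw] := longest_inv lg rw; have [tw' iw'] := longest_inv lg rw'.
  have [n ln nw] := core_diameter afree x0P cr (tight_gword tw iw) (tight_gword tw' iw').
  exists n => //; apply/nwalk_walk; move: nw rw; move er : (rseq [::] w) => r.
  elim: n w r {ln tw iw} er => [|n IH] w r er /=.
    by case=> _; rewrite -er => /rseq_inj <-.
  case=> t [gr fl nw] rw; have [z [tz ez iz]] := gword_word (nwalkL nw).
  have rz := inv_longest lg tz iz; exists z; split=> //; last exact: IH nw rz.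
  by apply: flip_braid lg rw rz _; rewrite er ez.
have [w [rw _]] := lg; have [tw iw] := longest_inv lg rw.
have gw := tight_gword tw iw.
have [w' [tw' ew' iw']] := gword_word (gword_rev gw).
have rw' := inv_longest lg tw' iw'.
exists w, w'; split=> // k kL /nwalk_walk.
move=> nw; suff : (sepn a (rseq [::] w) (rseq [::] w') <= k)%N.
  by rewrite ew' sepn_rev // leqNgt kL.
elim: k w {kL rw tw iw gw ew'} nw rw => [|k IH] w /=.
  case=> rw <- _; rewrite leqn0; apply/eqP/eq_card0 => X; rewrite !inE.
  by apply/negP => /andP[_ /sepwP[p [q []]]]; rewrite eqxx.
case=> z [rw wz nz] _; apply: leq_trans (sepn_tri _ _ (rseq [::] z) _) _.
rewrite -add1n leq_add //; first exact: braid_sep lg rw (nwalkL nz) wz.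
exact: IH nz (nwalkL nz).
Qed.

End Coxeter.

(** * Normals in echelon form *)

(* The normals are graded by the position [lev] of their last nonzero coordinate:
   the coordinate subspaces give a modular flag, and each codimension 2
   intersection has a unique reduced echelon basis made of two normals. *)
Section Echelon.
Import Order.TTheory GRing.Theory Num.Theory.
Local Open Scope ring_scope.
Variables (R : realType) (n : nat) (I : finType) (a : I -> 'rV[R]_n).
Variables (lev : I -> 'I_n) (eps : R).
Hypothesis eps0 : eps != 0.
Hypothesis lead : forall i, a i 0 (lev i) = eps.
Hypothesis above : forall i (m : 'I_n), (lev i < m)%N -> a i 0 m = 0.
Hypothesis a_inj : injective a.
Hypothesis same_level : forall i j, i != j -> lev i = lev j ->
  exists2 k, k \in line a i j & (lev k < lev i)%N.
Hypothesis reduce : forall k i, (lev k < lev i)%N ->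
  exists j, [/\ j \in line a k i, lev j = lev i & a j 0 (lev k) = 0].

Lemma echelon_indep i j b c : i != j -> b *: a i + c *: a j = 0 -> b = 0 /\ c = 0.
Proof.
move=> ij e; have coef m : b * a i 0 m + c * a j 0 m = 0.
  by move/rowP/(_ m): e; rewrite !mxE.
have lt_case i' j' b' c' : (lev i' < lev j')%N ->
    (forall m, b' * a i' 0 m + c' * a j' 0 m = 0) -> b' = 0 /\ c' = 0.
  move=> lij co; have := co (lev j'); rewrite above // lead mulr0 add0r => /eqP.
  rewrite mulf_eq0 (negbTE eps0) orbF => /eqP c0; split=> //.
  have := co (lev i'); rewrite c0 mul0r addr0 lead => /eqP.
  by rewrite mulf_eq0 (negbTE eps0) orbF => /eqP.
case: (ltngtP (lev i) (lev j)) => [l|l|/val_inj l].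
- exact: lt_case l coef.
- by have [] := lt_case j i c b l (fun m => etrans (addrC _ _) (coef m)).
have bc : c = - b.
  have := coef (lev i); rewrite {2}l !lead -mulrDl => /eqP.
  by rewrite mulf_eq0 (negbTE eps0) orbF addrC addr_eq0 => /eqP.
suff b0 : b = 0 by rewrite bc b0 oppr0.
apply/eqP; apply: contraT => b0; case/eqP: ij; apply: a_inj; apply: (scalerI b0).
by apply/eqP; rewrite -subr_eq0 -scaleNr -bc e.
Qed.

Lemma echelon_free i j : i != j -> free [:: a i; a j].
Proof.
move=> ij; rewrite free_cons span_seq1 seq1_free; apply/andP; split.
  apply/vlineP => -[c e]; have [|] := @echelon_indep i j 1 (- c) ij.
    by rewrite e scale1r scaleNr subrr.
  by move/eqP; rewrite oner_eq0.
apply/eqP => e; have := lead j; rewrite e mxE => /eqP.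
by rewrite eq_sym (negbTE eps0).
Qed.

Lemma echelon_arrangement : is_arrangement a.
Proof.
split=> [i|i j e].
  by apply/eqP => e; have := lead i; rewrite e mxE => /eqP; rewrite eq_sym (negbTE eps0).
apply/eqP; apply: contraT => ij; have := echelon_free ij; rewrite free_cons.
have : (hyp (a j) :&: hyp (a j) <= hyp (a i))%VS by rewrite capvv -/(H a i) e.
by rewrite hyp_cap_sub span_cons span_seq1 addvv => ->.
Qed.

Lemma line_lev i j k : k \in line a i j -> (lev k <= maxn (lev i) (lev j))%N.
Proof.
move=> /lineP[b [c e]]; rewrite leqNgt gtn_max; apply/negP => /andP[li lj].
have := lead k; rewrite e !mxE !above // !mulr0 addr0 => /eqP.
by rewrite eq_sym (negbTE eps0).
Qed.

(** Each flat has a normal below its top level, by [same_level]; [reduce] then clears the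
    corresponding coefficient of a top normal. The right side counts these reduced bases. *)
Lemma echelon_lines : #|lines a| =
  #|[set p : I * I | (lev p.1 < lev p.2)%N && (a p.2 0 (lev p.1) == 0)]|.
Proof.
set P := [set p | _]; rewrite -(@card_in_imset _ _ (fun p => line a p.1 p.2) P).
  apply: eq_card => X; apply/linesP/imsetP => [[i [j [ij eX]]]|[[k i]]].
    have {ij eX} [k [l [kl eX]]] : exists k l, (lev k < lev l)%N /\ X = line a k l.
      case: (ltngtP (lev i) (lev j)) => [l|l|/val_inj l].
      - by exists i, j.
      - by exists j, i; rewrite lineC.
      have [k kij lk] := same_level ij l; exists k, i; split=> //.
      rewrite eX (line_eq echelon_free ij) ?line_l //.
      by apply: contraTneq lk => ->; rewrite ltnn.
    have nkl : k != l by apply: contraTneq kl => ->; rewrite ltnn.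
    have [m [mkl lm am]] := reduce kl; exists (k, m).
      by rewrite inE /= lm kl am eqxx.
    rewrite eX /= (line_eq echelon_free nkl) ?line_l //.
    by apply: contraTneq kl => ->; rewrite lm ltnn.
  rewrite inE /= => /andP[li _] ->; exists k, i; split=> //.
  by apply: contraTneq li => ->; rewrite ltnn.
move=> [k i] [k' i']; rewrite !inE /= => /andP[li /eqP ai] /andP[li' /eqP ai'] e.
have max_lev p q : (lev p < lev q)%N -> maxn (lev p) (lev q) = lev q by move=> /ltnW/maxn_idPr.
have lii' : lev i = lev i'.
  apply/val_inj/eqP; rewrite eqn_leq.
  have := @line_lev k' i' i; rewrite -e line_r (max_lev _ _ li') => ->  //=.
  by have := @line_lev k i i'; rewrite e line_r (max_lev _ _ li) => ->.
have k'L : k' \in line a k i by rewrite e line_l.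
have i'L : i' \in line a k i by rewrite e line_r.
(* Only [i] has a coordinate at the top level, so an element of the flat below that level is
   proportional to [a k]. *)
have kk' : k' = k.
  case/lineP: k'L => b [c eb]; have := congr1 (fun x : 'rV_n => x 0 (lev i)) eb.
  rewrite !mxE above ?lii' // above -?lii' // lead mulr0 add0r => /esym/eqP.
  rewrite mulf_eq0 (negbTE eps0) orbF => /eqP c0.
  apply/eqP; apply: contraT => kk'; have [|+ _] := @echelon_indep k' k 1 (- b) kk'.
    by rewrite eb c0 scale0r addr0 scale1r scaleNr subrr.
  by move/eqP; rewrite oner_eq0.
rewrite kk'; congr pair; case/lineP: i'L => b [c eb].
have := congr1 (fun x : 'rV_n => x 0 (lev k)) eb.
rewrite !mxE lead ai -kk' ai' mulr0 addr0 => /esym/eqP.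
rewrite mulf_eq0 (negbTE eps0) orbF => /eqP b0.
apply/eqP; apply: contraT => ii'; have [|_] := @echelon_indep i i' c (- 1) ii'.
  by rewrite eb b0 scale0r add0r scaleN1r subrr.
by move/eqP; rewrite oppr_eq0 oner_eq0.
Qed.

Lemma echelon_core x0 : (forall i, 0 < lform (a i) x0) -> core a [set: I].
Proof.
move=> x0P; have -> : [set: I] = [set i | lev i < n]%N.
  by apply/setP => i; rewrite !inE ltn_ord.
suff main k : (k <= n)%N -> core a [set i | lev i < k]%N by exact: main (leqnn n).
elim: k => [|k IH] kn.
  rewrite (_ : [set i | _] = finset.set0); first exact: core0.
  by apply/setP => i; rewrite !inE.
(* The factor [eps] gives the fiber forms the value [eps * eps], positive whatever the sign of the
   leading coefficient. *)
pose v : 'rV[R]_n := eps *: delta_mx 0 (Ordinal kn).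
have vE i : lform (a i) v = eps * a i 0 (Ordinal kn).
  rewrite lformZr lformE (bigD1 (Ordinal kn)) //= big1 => [|m mk].
    by rewrite mxE !eqxx mul1r addr0.
  by rewrite mxE (negbTE mk) andbF mul0r.
have TE i : i \in [set i | lev i < k.+1]%N :\: [set i | lev i < k]%N -> lev i = Ordinal kn.
  rewrite !inE -leqNgt ltnS => /andP[l1 l2].
  by apply/val_inj/eqP; rewrite eqn_leq l2 l1.
apply: (@core_step _ _ _ a echelon_free _ [set i | lev i < k]%N v x0) => //.
- by apply/fintype.subsetP => i; rewrite !inE; exact: leqW.
- move=> i j; rewrite !inE => li lj; apply/fintype.subsetP => l /line_lev.
  by rewrite inE => /leq_ltn_trans; apply; rewrite gtn_max li lj.
- by move=> i; rewrite inE vE => li; rewrite above // mulr0.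
- by move=> i /TE li; rewrite vE -li lead lt0r -expr2 sqr_ge0 expf_neq0.
- move=> i j /TE li /TE lj ij; have [|l lij ll] := same_level ij; first by rewrite li lj.
  by exists l; rewrite // inE; move: ll; rewrite li.
- exact: IH (ltnW kn).
Qed.

End Echelon.

Lemma ord_increasing_ge n (f : 'I_n -> 'I_n) :
  (forall i j : 'I_n, i < j -> f i < f j) -> forall i : 'I_n, i <= f i.
Proof.
move=> fI [i ilt] /=; elim: i ilt => // i IH ilt.
exact: leq_ltn_trans (IH (ltnW ilt)) (fI (Ordinal (ltnW ilt)) (Ordinal ilt) (leqnn _)).
Qed.

(** The lower bound is applied to [f] and to its conjugate by [rev_ord]. This yields faithfulness:
    keeping the base chamber means preserving the order of the coordinates. *)
Lemma ord_increasing_id n (f : 'I_n -> 'I_n) :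
  (forall i j : 'I_n, i < j -> f i < f j) -> f =1 id.
Proof.
move=> fI i; apply/val_inj/eqP; rewrite eqn_leq; apply/andP; split; last exact: ord_increasing_ge.
have := @ord_increasing_ge n (fun i => rev_ord (f (rev_ord i))) _ (rev_ord i).
rewrite rev_ordK /= leq_sub2lE //; apply=> j k jk /=.
have := fI (rev_ord k) (rev_ord j); rewrite /=; have := ltn_ord j; have := ltn_ord k.
by have := ltn_ord (f (rev_ord k)); have := ltn_ord (f (rev_ord j)); lia.
Qed.

(** * Types A and B *)

Definition mk_ltpair n (i j : 'I_n) (ij : i < j) : ltpair n :=
  exist (fun p : 'I_n * 'I_n => p.1 < p.2) (i, j) ij.

Section TypeA.
Import Order.TTheory GRing.Theory Num.Theory.
Local Open Scope ring_scope.
Variable R : realType.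

Lemma evecE n (i k : 'I_n) : evec R i 0 k = (k == i)%:R.
Proof. by rewrite mxE eqxx. Qed.

Lemma lform_evec n (i : 'I_n) x : lform (evec R i) x = x 0 i.
Proof.
rewrite lformE (bigD1 i) //= big1 => [|k ki]; rewrite evecE; first by rewrite eqxx mulr1 addr0.
by rewrite (negbTE ki) mulr0.
Qed.

Section Roots.
Variable n : nat.
Local Notation a := (normA R (n := n)).
Definition levA (p : ltpair n) : 'I_n := (val p).2.

Lemma normAE p k : a p 0 k = (k == (val p).1)%:R - (k == (val p).2)%:R.
Proof. by rewrite !mxE eqxx. Qed.

Lemma ltpair_neq (p : ltpair n) : ((val p).1 == (val p).2) = false.
Proof. by case: p => [[i j] /= ij]; apply/negbTE; rewrite neq_ltn ij. Qed.

Lemma normA_lead p : a p 0 (levA p) = -1.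
Proof. by rewrite normAE eqxx eq_sym ltpair_neq sub0r. Qed.

Lemma normA_above p (m : 'I_n) : (levA p < m)%N -> a p 0 m = 0.
Proof.
rewrite /levA normAE; case: p => [[i j] /= ij] jm.
by rewrite -!val_eqE /= !gtn_eqF ?subr0 // (ltn_trans ij).
Qed.

Lemma normA_inj : injective a.
Proof.
move=> [[i j] ij] [[k l] kl] e; have E m := congr1 (fun x : 'rV_n => x 0 m) e.
have nij : (i == j) = false := ltpair_neq (mk_ltpair ij).
apply: val_inj => /=; move: (E j) (E i) => {e E}.
rewrite /= !normAE /= !eqxx nij [j == i]eq_sym nij.
have [->|_] := eqVneq i k; last by case: (i == l) => /= _ h; exfalso; lra.
have [->|_] := eqVneq j l; first by [].
by case: (j == k) => /= h _; exfalso; lra.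
Qed.

Lemma normA_same p q : p != q -> levA p = levA q ->
  exists2 r, r \in line a p q & (levA r < levA p)%N.
Proof.
case: p q => [[i j] ij] [[k l] kl] /=; rewrite /levA -val_eqE /= => /[swap] el; subst l.
rewrite xpair_eqE eqxx andbT neq_ltn => /orP[] ik.
  exists (mk_ltpair ik) => //; apply/lineP; exists 1, (-1).
  by apply/rowP => m; rewrite !mxE; ring.
exists (mk_ltpair ik) => //; apply/lineP; exists (-1), 1.
by apply/rowP => m; rewrite !mxE; ring.
Qed.

Lemma normA_reduce p q : (levA p < levA q)%N ->
  exists r, [/\ r \in line a p q, levA r = levA q & a r 0 (levA p) = 0].
Proof.
case: p q => [[i j] ij] [[k l] kl]; rewrite /levA /= in ij kl * => jl.
have nlj : (j == l) = false by apply/negbTE; rewrite -val_eqE neq_ltn jl.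
have [jk|jk] := eqVneq j k.
  subst k; have il := ltn_trans ij jl; exists (mk_ltpair il); split=> //.
    by apply/lineP; exists 1, 1; apply/rowP => m; rewrite !mxE /=; ring.
  rewrite normAE /= nlj [j == i]eq_sym -val_eqE /= (ltn_eqF ij) subr0.
  by [].
exists (mk_ltpair kl); split=> //; first exact: line_r.
by rewrite normAE /= nlj (negbTE jk) subr0.
Qed.

Definition baseA : 'rV[R]_n := \row_k - (k%:R).

Lemma lform_normA p x : lform (a p) x = x 0 (val p).1 - x 0 (val p).2.
Proof. by rewrite lformDl lformNl !lform_evec. Qed.

Lemma normA_base p : 0 < lform (a p) baseA.
Proof.
by rewrite lform_normA !mxE opprK addrC subr_gt0 ltr_nat; case: p => [[i j]].
Qed.

Lemma lines_normA : #|lines a| = #|[set t : ltpair n * ltpair n |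
  (levA t.1 < levA t.2)%N && ((val t.2).1 != levA t.1)]|.
Proof.
rewrite (echelon_lines _ normA_lead normA_above normA_inj normA_same normA_reduce);
  last by rewrite oppr_eq0 oner_eq0.
apply: eq_card => -[p [[k l] kl]]; rewrite !inE /levA /=.
case: ltnP => //= jl; rewrite normAE /=.
have -> : ((val p).2 == l) = false by apply/negbTE; rewrite -val_eqE neq_ltn jl.
by rewrite subr0 pnatr_eq0 eqb0 eq_sym.
Qed.

Lemma normA_arrangement : is_arrangement a.
Proof.
by apply: (echelon_arrangement _ normA_lead normA_above normA_inj); rewrite oppr_eq0 oner_eq0.
Qed.

Lemma normA_free p q : p != q -> free [:: a p; a q].
Proof.
by apply: (echelon_free _ normA_lead normA_above normA_inj); rewrite oppr_eq0 oner_eq0.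
Qed.

Lemma normA_core : core a [set: ltpair n].
Proof.
apply: (echelon_core _ normA_lead normA_above normA_inj normA_same normA_base).
by rewrite oppr_eq0 oner_eq0.
Qed.

End Roots.

Section Words.
Variable m : nat.
Local Notation a := (normA R (n := m.+1)).

Lemma adj_lt (i : 'I_m) : (widen_ord (leqnSn m) i < lift ord0 i)%N.
Proof. by rewrite /= /bump leq0n add1n. Qed.

Definition simpleA (i : 'I_m) : ltpair m.+1 := mk_ltpair (adj_lt i).
Local Notation actw := (actw a simpleA).

Lemma refl_normA j x k : sreflect a simpleA j x 0 k = x 0 (genA j k).
Proof.
rewrite /sreflect; set p := simpleA j.
have pp : lform (a p) (a p) = 2.
  rewrite lform_normA !normAE !eqxx ltpair_neq [(val p).2 == _]eq_sym ltpair_neq.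
  by rewrite subr0 sub0r opprK.
rewrite pp mulrAC mulfV ?pnatr_eq0 // mul1r lform_normA !mxE eqxx /=.
rewrite /genA; case: tpermP => [->|->|/eqP n1 /eqP n2].
- rewrite eqxx (ltpair_neq p) subr0 mulr1 opprB addrC subrK //.
- by rewrite eqxx eq_sym (ltpair_neq p) sub0r mulrN1 opprK addrC subrK.
- by rewrite (negbTE n1) (negbTE n2) subr0 mulr0 subr0.
Qed.

Lemma actw_normA w x k : actw w x 0 k = x 0 (wprod (genA (m := m)) w k).
Proof.
elim: w k => [|j w IH] k; first by rewrite /wprod big_nil perm1.
by rewrite /= refl_normA IH wprod_cons permM.
Qed.

Lemma genA_val (j : 'I_m) k : val (genA j k) =
  (if val k == j then j.+1 else if val k == j.+1 then val j else val k).
Proof.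
have lj : val (lift ord0 j) = j.+1 by rewrite /= /bump leq0n add1n.
have nj : (j.+1 == j :> nat) = false by rewrite gtn_eqF.
rewrite /genA; case: tpermP => [->|->|/eqP n1 /eqP n2].
- by rewrite eqxx lj.
- by rewrite lj nj eqxx.
- by move: n1 n2; rewrite -!val_eqE lj /= => /negbTE-> /negbTE->.
Qed.

Lemma genA_lt j (p : ltpair m.+1) : p != simpleA j ->
  (genA j (val p).1 < genA j (val p).2)%N.
Proof.
case: p => [[k l] /= kl]; rewrite -val_eqE /= xpair_eqE -!val_eqE /= /bump leq0n add1n => ne.
have := genA_val j k; have := genA_val j l; rewrite /= => -> ->.
by move: kl ne; do ?[case: eqP => ?]; lia.
Qed.

Lemma evec_genA (j : 'I_m) (k : 'I_m.+1) : sreflect a simpleA j (evec R k) = evec R (genA j k).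
Proof.
apply/rowP => l; rewrite refl_normA !evecE /genA; congr (_ %:R); congr nat_of_bool.
by rewrite -(inj_eq (@perm_inj _ (tperm (widen_ord (leqnSn m) j) (lift ord0 j)))) tpermK.
Qed.

Lemma refl_normA_pos j i : i != simpleA j -> exists k, sreflect a simpleA j (a i) = a k.
Proof.
move=> /genA_lt lt; exists (mk_ltpair lt).
have -> : a i = (-1) *: evec R (val i).2 + evec R (val i).1 by rewrite scaleN1r addrC.
by rewrite refl_lin !evec_genA scaleN1r addrC.
Qed.

Lemma simple_dualA j : exists y, forall k, lform (a (simpleA k)) y = (k == j)%:R.
Proof.
(* A fundamental coweight: the coordinates drop only between [j] and its successor. *)
exists (\row_k (k <= j)%N%:R) => k; rewrite lform_normA !mxE /= /bump leq0n add1n.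
by rewrite -val_eqE /=; case: ltngtP => _; rewrite ?subrr ?subr0.
Qed.

Lemma simple_posA x : (forall j, 0 < lform (a (simpleA j)) x) ->
  forall p, 0 < lform (a p) x.
Proof.
move=> xs [[i [k kn]] /= ik]; rewrite lform_normA /=; elim: k kn ik => // k IH kn.
have km : (k < m)%N by [].
have := xs (Ordinal km); rewrite lform_normA /= !subr_gt0.
have -> : lift ord0 (Ordinal km) = Ordinal kn by apply: val_inj; rewrite /= /bump leq0n add1n.
have -> : widen_ord (leqnSn m) (Ordinal km) = Ordinal (ltnW kn) by apply: val_inj.
move=> lt; rewrite ltnS leq_eqVlt => /orP[/eqP ik|ik].
  by have -> : i = Ordinal (ltnW kn) by apply: val_inj.
by apply: lt_trans lt _; rewrite -subr_gt0; exact: IH.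
Qed.

Lemma typeA_diameter (w0 : {perm 'I_m.+1}) : longest (genA (m := m)) w0 ->
  GW_diameter (genA (m := m)) w0 #|lines a|.
Proof.
move=> lg; apply: (@word_diameter _ _ _ a _ simpleA (baseA m.+1)) lg (normA_core m.+1).
- exact: normA_base.
- exact: normA_free.
- exact: refl_normA_pos.
- exact: simple_dualA.
- exact: simple_posA.
- by move=> w w' e x; apply/rowP => k; rewrite !actw_normA e.
move=> w pos; apply/permP => k; rewrite perm1.
apply: (@ord_increasing_id _ (fun k => wprod (genA (m := m)) w k)) => i j ij.
have := pos (mk_ltpair ij); rewrite lform_normA !actw_normA !mxE /=.
by rewrite opprK addrC subr_gt0 ltr_nat.
Qed.

End Words.
End TypeA.

(** * Closed forms for the number of reduced bases *)

Section Counting.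

Lemma sum_ltpair n (F : nat -> nat -> nat) :
  \sum_(p : ltpair n) F (val p).1 (val p).2 = \sum_(k < n) \sum_(i < k) F i k.
Proof.
have -> : \sum_(k < n) \sum_(i < k) F i k =
    \sum_(q : 'I_n * 'I_n | q.2 < q.1) F q.2 q.1.
  rewrite -(pair_big_dep xpredT (fun k i : 'I_n => i < k) (fun k i : 'I_n => F i k)) /=.
  apply: eq_bigr => k _.
  exact: (big_ord_widen n (fun i => F i k) (ltnW (ltn_ord k))).
rewrite (reindex_omap (fun p : ltpair n => ((val p).2, (val p).1))
  (fun q => insub (q.2, q.1))) => [|[k i] /= ik]; last by rewrite insubT.
by apply: eq_bigl => -[[i k] ik] /=; rewrite ik insubT /= eqxx.
Qed.

Lemma sum_neq k j : j < k -> \sum_(i < k) (i != j :> nat) = k.-1.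
Proof.
move=> jk; have <- : #|predC1 (Ordinal jk)| = k.-1 by rewrite cardC1 card_ord.
rewrite -sum1_card [RHS]big_mkcond.
by apply: eq_bigr => i _; rewrite inE -val_eqE; case: eqP.
Qed.

(** [h j] stands for the number of normals at level [j], and [c k] for the number of those at a
    higher level [k] whose coefficient at [j] vanishes. *)
Lemma sum_exchange n (h c : nat -> nat) :
  \sum_(j < n) h j * (\sum_(k < n) (if j < k then c k else 0)) =
  \sum_(k < n) c k * \sum_(j < k) h j.
Proof.
under eq_bigr => j _ do rewrite big_distrr.
rewrite exchange_big; apply: eq_bigr => k _.
rewrite (big_ord_widen n h (ltnW (ltn_ord k))) big_distrr [RHS]big_mkcond.
by apply: eq_bigr => j _; case: ifP => _; [exact: mulnC|exact: muln0].
Qed.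

Lemma sum_odd k : \sum_(j < k) j.*2.+1 = k ^ 2.
Proof. by elim: k => [|k IH]; rewrite ?big_ord0 // big_ord_recr /= IH; lia. Qed.

Lemma sum_id2 k : (\sum_(j < k) j).*2 = k * k.-1.
Proof.
by elim: k => [|k IH]; rewrite ?big_ord0 // big_ord_recr /= doubleD IH; case: k {IH} => // k; lia.
Qed.

(** Level [k] has [k] normals, all but one of which vanish at a given lower coordinate. *)
Lemma sumA n : \sum_(k < n) k.-1 * \sum_(j < k) j =
  n * (n - 1) * (n - 2) * (3 * n - 5) %/ 24.
Proof.
(* Small [n] are set apart because the subtraction in [3 * n - 5] is truncated. *)
case: n => [|[|n]]; first by rewrite big_ord0.
  by rewrite big_ord_recr big_ord0.
have -> : 3 * n.+2 - 5 = 3 * n + 1 by lia.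
have E : 24 * (\sum_(k < n.+2) k.-1 * \sum_(j < k) j) = n.+2 * n.+1 * n * (3 * n + 1).
  elim: n => [|n IH]; first by rewrite !big_ord_recr !big_ord0.
  rewrite big_ord_recr /= mulnDr IH; have := sum_id2 n.+2; rewrite -muln2 /=.
  by move: (\sum_(j < _) _) => S; nia.
by rewrite subSS subn0 !subSS subn0 -E mulKn.
Qed.

(** Level [k] has [k.*2.+1] normals, all but two of which vanish at a given lower coordinate. *)
Lemma sumB n : \sum_(k < n) k.*2.-1 * \sum_(j < k) j.*2.+1 =
  n * (n - 1) * (3 * n ^ 2 + 1 - 5 * n) %/ 6.
Proof.
under eq_bigr => k _ do rewrite sum_odd.
case: n => [|[|n]]; first by rewrite big_ord0.
  by rewrite big_ord_recr big_ord0.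
have -> : 3 * n.+2 ^ 2 + 1 - 5 * n.+2 = 3 * n ^ 2 + 7 * n + 3 by lia.
have E : 6 * (\sum_(k < n.+2) k.*2.-1 * k ^ 2) = n.+2 * n.+1 * (3 * n ^ 2 + 7 * n + 3).
  elim: n => [|n IH]; first by rewrite !big_ord_recr !big_ord0.
  by rewrite big_ord_recr /= mulnDr IH; nia.
by rewrite subSS subn0 -E mulKn.
Qed.

(* Normals at a level above [j] whose coefficient at [j] vanishes. *)
Lemma sum_ltpair_free n j :
  \sum_(p : ltpair n) ((j < (val p).2) && ((val p).1 != j :> nat)) =
  \sum_(k < n) (if j < k then k.-1 else 0).
Proof.
rewrite (sum_ltpair n (fun i k => (j < k) && (i != j))); apply: eq_bigr => k _.
case: ifP => [jk|_]; last by rewrite big1.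
by rewrite sum_neq.
Qed.

End Counting.

Section CountA.
Variables (R : realType) (n : nat).

Lemma card_linesA : #|lines (normA R (n := n))| = n * (n - 1) * (n - 2) * (3 * n - 5) %/ 24.
Proof.
rewrite lines_normA -sum1dep_card.
rewrite -(pair_big_dep xpredT (fun p q : ltpair n => (levA p < levA q) && ((val q).1 != levA p))
  (fun _ _ => 1)) /=.
under eq_bigr => p _ do rewrite big_mkcond /=.
rewrite -sumA -(sum_exchange n id predn).
have -> : \sum_(j < n) id j * (\sum_(k < n) (if j < k then k.-1 else 0)) =
   \sum_(j < n) \sum_(i < j) \sum_(k < n) (if j < k then k.-1 else 0).
  by apply: eq_bigr => j _; rewrite sum_nat_const card_ord.
rewrite -(sum_ltpair n (fun i j => \sum_(k < n) (if j < k then k.-1 else 0))).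
apply: eq_bigr => p _; rewrite -sum_ltpair_free; apply: eq_bigr => q _.
by rewrite /levA val_eqE; case: (_ && _).
Qed.

End CountA.

Lemma sum_pair_bool (T : finType) (F : T * bool -> nat) :
  \sum_p F p = \sum_q (F (q, true) + F (q, false)).
Proof.
rewrite (eq_bigr (fun p => F (p.1, p.2))) => [|[] //].
rewrite -(pair_bigA _ (fun q b => F (q, b))).
by apply: eq_bigr => q _; rewrite big_bool.
Qed.

Section TypeB.
Import Order.TTheory GRing.Theory Num.Theory.
Local Open Scope ring_scope.
Variable R : realType.

Section Roots.
Variable n : nat.

(* Normals of type B, oriented so that their last nonzero coordinate is 1. *)
Definition rootB (q : (ltpair n * bool) + 'I_n) : 'rV[R]_n :=
  match q with
  | inl (p, b) => evec R (val p).2 + (-1) ^+ b *: evec R (val p).1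
  | inr i => evec R i
  end.
Local Notation a := rootB.

Definition levB (q : (ltpair n * bool) + 'I_n) : 'I_n :=
  match q with inl (p, _) => (val p).2 | inr i => i end.

Lemma rootB_scale q : exists2 c, c != 0 & a q = c *: normB R q.
Proof.
case: q => [[p [|]]|i] /=.
- by exists (-1); rewrite ?oppr_eq0 ?oner_eq0 // expr1 !scaleN1r opprB.
- by exists 1; rewrite ?oner_eq0 // expr0 !scale1r addrC.
- by exists 1; rewrite ?oner_eq0 // scale1r.
Qed.

Arguments rootB : simpl never.

Lemma rootBrE i k : a (inr i) 0 k = (k == i)%:R.
Proof. exact: evecE. Qed.

Lemma rootBlE p b k :
  a (inl (p, b)) 0 k = (k == (val p).2)%:R + (-1) ^+ b * (k == (val p).1)%:R.
Proof. by rewrite !mxE eqxx. Qed.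

Lemma rootB_lead q : a q 0 (levB q) = 1.
Proof.
case: q => [[p b]|i]; rewrite ?rootBrE ?rootBlE /= eqxx //.
by rewrite eq_sym ltpair_neq mulr0 addr0.
Qed.

Lemma rootB_above q (m : 'I_n) : (levB q < m)%N -> a q 0 m = 0.
Proof.
case: q => [[[[i j] ij] b]|i] /= jm; first rewrite rootBlE; last first.
  by rewrite rootBrE -val_eqE gtn_eqF.
by rewrite -!val_eqE /= !gtn_eqF ?(ltn_trans ij) // mulr0 addr0.
Qed.

Lemma sign_inj (b c : bool) : (-1) ^+ b = (-1) ^+ c :> R -> b = c.
Proof. by case: b; case: c => //; rewrite expr1 expr0 => h; exfalso; lra. Qed.

Lemma rootB_inj : injective a.
Proof.
have levE q q' : a q = a q' -> levB q = levB q'.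
  move=> e; apply: val_inj; case: (ltngtP (levB q) (levB q')) => // l.
    by have := rootB_lead q'; rewrite -e rootB_above // => /eqP; rewrite eq_sym oner_eq0.
  by have := rootB_lead q; rewrite e rootB_above // => /eqP; rewrite eq_sym oner_eq0.
have sgn0 (b : bool) : (-1) ^+ b != 0 :> R by rewrite expf_neq0 // oppr_eq0 oner_eq0.
have nopair p b i : levB (inl (p, b)) = i -> a (inl (p, b)) <> a (inr i).
  move=> /= <- /(congr1 (fun x : 'rV_n => x 0 (val p).1)).
  rewrite /= rootBlE rootBrE ltpair_neq add0r eqxx mulr1 => /eqP.
  by rewrite (negbTE (sgn0 b)).
move=> q q' e; have := levE _ _ e.
case: q q' e => [[p b]|i] [[p' b']|i'] e; last by move=> /= ->.
- move=> l; have E := congr1 (fun x : 'rV_n => x 0 (val p).1) e.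
  move: E; rewrite /= !rootBlE -[(val p').2]/(levB (inl (p', b'))) -l /=.
  rewrite ltpair_neq !add0r eqxx mulr1; have [pp|_] := eqVneq (val p).1 (val p').1; last first.
    by rewrite mulr0 => /eqP; rewrite (negbTE (sgn0 b)).
  rewrite mulr1 => eb; have -> : p = p'.
    by apply: val_inj; move: pp l => /=; case: (sval p) (sval p') => [? ?] [? ?] /= -> ->.
  by rewrite (sign_inj eb).
- by move=> l; case: (nopair _ _ _ l).
- by move=> l; case: (@nopair p' b' i).
Qed.

Lemma rootB_same q q' : q != q' -> levB q = levB q' ->
  exists2 r, r \in line a q q' & (levB r < levB q)%N.
Proof.
have mixed p b : exists2 r, r \in line a (inl (p, b)) (inr (val p).2) & (levB r < (val p).2)%N.
  exists (inr (val p).1); last by case: p => [[i j] /= ij].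
  apply/lineP; exists ((-1) ^+ b), (- (-1) ^+ b).
  rewrite /rootB scalerDr scalerA -signr_addb addbb expr0 scale1r scaleNr.
  by rewrite addrAC subrr add0r.
have two (i i' k : 'I_n) (ik : (i < k)%N) (ik' : (i' < k)%N) b b' : (i < i')%N ->
    exists2 r, r \in line a (inl (mk_ltpair ik, b)) (inl (mk_ltpair ik', b')) & (levB r < k)%N.
  move=> ii; exists (inl (mk_ltpair ii, b == b')) => //; apply/lineP.
  exists (- (-1) ^+ b'), ((-1) ^+ b').
  by apply/rowP => m; rewrite !mxE /=; case: b; case: b' => /=; rewrite ?expr1 ?expr0; ring.
case: q q' => [[p b]|i] [[p' b']|i'] /=; last by move=> /[swap] ->; rewrite eqxx.
- case: p p' => [[i k] ik] [[i' k'] ik'] /= ne e; subst k'.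
  case: (ltngtP i i') => [ii|ii|/val_inj ii].
  + exact: two ii.
  + by rewrite lineC; exact: two ii.
  subst i'; have ik2 : ik = ik' := bool_irrelevance _ _.
  exists (inr i) => //; apply/lineP.
  exists ((-1) ^+ b / 2), ((-1) ^+ b' / 2); apply/rowP => m; rewrite !mxE /=.
  have {ne} : b != b' by apply: contraNneq ne => ->; rewrite ik2.
  by case: b; case: b' => //= _; rewrite ?expr1 ?expr0; field.
- by move=> _ <-; exact: mixed.
- by move=> _ ->; rewrite lineC; exact: mixed.
Qed.

Lemma rootB_reduce q q' : (levB q < levB q')%N ->
  exists r, [/\ r \in line a q q', levB r = levB q' & a r 0 (levB q) = 0].
Proof.
case: q' => [[[[l k] lk] b]|k] lq; last first.
  exists (inr k); split; first exact: line_r.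
  - by [].
  by rewrite rootBrE -val_eqE /= ltn_eqF.
have nk : (levB q == k) = false by apply/negbTE; rewrite -val_eqE neq_ltn lq.
have [ql|ql] := eqVneq (levB q) l; last first.
  exists (inl (mk_ltpair lk, b)); split=> //; first exact: line_r.
  by rewrite rootBlE /= nk (negbTE ql) mulr0 addr0.
case: q lq nk ql => [[[[i j] ij] c]|j] /= jk nk ql; subst.
  have ik := ltn_trans ij jk; exists (inl (mk_ltpair ik, b == c)); split=> //.
    apply/lineP; exists (- (-1) ^+ b), 1; apply/rowP => m; rewrite !mxE /=.
    by case: b; case: c => /=; rewrite ?expr1 ?expr0; ring.
  rewrite rootBlE /= nk add0r -val_eqE /=.
  by rewrite gtn_eqF // mulr0.
exists (inr k); split=> //; last by rewrite rootBrE nk.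
apply/lineP; exists (- (-1) ^+ b), 1; apply/rowP => m; rewrite !mxE /=; ring.
Qed.

Definition baseB : 'rV[R]_n := \row_k (k.+1%:R).

Lemma lform_rootB p b x :
  lform (a (inl (p, b))) x = x 0 (val p).2 + (-1) ^+ b * x 0 (val p).1.
Proof. by rewrite lformDl lformZl !lform_evec. Qed.

Lemma rootB_base q : 0 < lform (a q) baseB.
Proof.
case: q => [[[[i j] ij] b]|i]; last by rewrite lform_evec mxE ltr0n.
rewrite lform_rootB !mxE /=.
case: b; first by rewrite expr1 mulN1r subr_gt0 ltr_nat.
by rewrite expr0 mul1r -natrD ltr0n.
Qed.

Let e1 : (1 : R) != 0. Proof. exact: oner_neq0. Qed.

Lemma rootB_free q q' : q != q' -> free [:: a q; a q'].
Proof. exact: (echelon_free e1 rootB_lead rootB_above rootB_inj). Qed.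

Lemma rootB_core : core a [set: ltpair n * bool + 'I_n].
Proof. exact: (echelon_core e1 rootB_lead rootB_above rootB_inj rootB_same rootB_base). Qed.

Lemma normB_arrangement : is_arrangement (normB R (n := n)).
Proof.
have [a0 Hinj] := echelon_arrangement e1 rootB_lead rootB_above rootB_inj.
have HE q : H a q = H (normB R (n := n)) q.
  by have [c c0 e] := rootB_scale q; rewrite /H e hyp_scale.
split=> [q|q q']; last by rewrite -!HE; exact: Hinj.
by have [c c0 e] := rootB_scale q; have := a0 q; rewrite e scaler_eq0 negb_or => /andP[].
Qed.

Lemma card_linesB : #|lines a| = (n * (n - 1) * (3 * n ^ 2 + 1 - 5 * n) %/ 6)%N.
Proof.
rewrite (echelon_lines e1 rootB_lead rootB_above rootB_inj rootB_same rootB_reduce).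
pose C p q := (levB p < levB q)%N && (a q 0 (levB p) == 0).
have Cl p q b : C p (inl (q, b)) = (levB p < (val q).2)%N && ((val q).1 != levB p).
  rewrite /C /=; case: ltnP => //= pq; rewrite rootBlE.
  have -> : (levB p == (val q).2) = false by apply/negbTE; rewrite -val_eqE neq_ltn pq.
  by rewrite add0r mulf_eq0 signr_eq0 pnatr_eq0 eqb0 eq_sym.
have Cr p i : C p (inr i) = (levB p < i)%N.
  rewrite /C /=; case: ltnP => //= pi; rewrite rootBrE -val_eqE /= ltn_eqF //.
  by rewrite eqxx.
rewrite -sum1dep_card -(pair_big_dep xpredT C (fun _ _ => 1%N)) /=.
pose G j := (\sum_(k < n) (if j < k then k.*2.-1 else 0))%N.
rewrite -sumB -(sum_exchange n (fun j => j.*2.+1) (fun k => k.*2.-1)).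
(* At level [k], each admissible pair counts for its two signs, and the coordinate hyperplane adds
   one. *)
transitivity (\sum_(p : ltpair n * bool + 'I_n) G (levB p))%N.
  apply: eq_bigr => p _; rewrite big_mkcond big_sumType /=.
  rewrite sum_pair_bool; under eq_bigr => q _ do rewrite !Cl addnn.
  under [X in (_ + X)%N]eq_bigr => i _ do rewrite Cr.
  rewrite -(big_morph _ doubleD double0).
  have -> : (\sum_(q : ltpair n) (if (levB p < (val q).2)%N && ((val q).1 != levB p)
       then 1 else 0) = \sum_(k < n) (if levB p < k then k.-1 else 0))%N.
    by rewrite -sum_ltpair_free; apply: eq_bigr => q _; rewrite val_eqE; case: (_ && _).
  rewrite (big_morph _ doubleD double0) -big_split /=; apply: eq_bigr => k _.
  by case: ltnP => // pk; rewrite addn1; case: (nat_of_ord k) pk.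
rewrite big_sumType /= sum_pair_bool; under eq_bigr => p _ do rewrite /= addnn.
rewrite (sum_ltpair n (fun i j => (G j).*2)) -big_split /=.
by apply: eq_bigr => j _; rewrite sum_nat_const card_ord -/(G j) -muln2 mulSn -muln2; lia.
Qed.

End Roots.

Section Words.
Variable m : nat.
Local Notation a := (@rootB m.+1).

Definition simpleB (k : 'I_m.+1) : ltpair m.+1 * bool + 'I_m.+1 :=
  if unlift ord0 k is Some j then inl (simpleA j, true) else inr ord0.
Local Notation actw := (actw a simpleB).
Local Notation refl := (sreflect a simpleB).

Lemma simpleB0 : simpleB ord0 = inr ord0.
Proof. by rewrite /simpleB unlift_none. Qed.

Lemma simpleBS j : simpleB (lift ord0 j) = inl (simpleA j, true).
Proof. by rewrite /simpleB liftK. Qed.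

Lemma ordB_ind (P : 'I_m.+1 -> Prop) : P ord0 -> (forall j, P (lift ord0 j)) -> forall k, P k.
Proof. by move=> P0 PS k; case: (unliftP ord0 k) => [j|] ->. Qed.

(** The signed coordinates of [x], which signed permutations merely permute. *)
Definition coordB (x : 'rV[R]_m.+1) (q : 'I_m.+1 * bool) : R :=
  if q.2 then x 0 q.1 else - x 0 q.1.

(** A reflection depends only on its hyperplane, so the computations of type A carry over to roots
    of the opposite sign. *)
Lemma refl_scale c v v' x : c != 0 -> v' = c *: v ->
  x - (2 * lform v' x / lform v' v') *: v' =
  x - (2 * lform v x / lform v v) *: v :> 'rV[R]_m.+1.
Proof.
move=> c0 ->; rewrite !lformZl lformZr scalerA; congr (_ - _ *: _).
have [->|v0] := eqVneq (lform v v) 0; first by rewrite !mulr0 invr0 !mulr0 mul0r.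
by move: (lform v x) (lform v v) v0 => p q q0; field; rewrite q0 c0.
Qed.

Lemma refl_rootBS j x : refl (lift ord0 j) x = sreflect (normA R (n := m.+1)) (@simpleA m) j x.
Proof.
apply: (@refl_scale (-1)); first by rewrite oppr_eq0 oner_eq0.
by rewrite simpleBS /rootB expr1 !scaleN1r opprB.
Qed.

Lemma refl_rootB0 x k : refl ord0 x 0 k = if k == ord0 then - x 0 k else x 0 k.
Proof.
rewrite /sreflect simpleB0 /rootB !lform_evec evecE eqxx divr1 !mxE eqxx /=.
by case: eqP => [->|_]; rewrite ?mulr1 ?mulr0 ?subr0 //; ring.
Qed.

Lemma genB0 : genB (m := m) ord0 = tperm (ord0, false) (ord0, true).
Proof. by rewrite /genB eqxx. Qed.

Lemma tperm_pair (T : finType) (u v k : T) (b c : bool) :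
  tperm (u, c) (v, c) (k, b) = if b == c then (tperm u v k, b) else (k, b).
Proof.
rewrite !permE /= !xpair_eqE; have [->|_] := eqVneq b c; rewrite ?andbF // !andbT.
by case: ifP => // _; case: ifP.
Qed.

Lemma genBS (j : 'I_m) q : genB (lift ord0 j) q = (genA j q.1, q.2).
Proof.
rewrite /genB; have -> : (lift ord0 j == ord0) = false by [].
have -> : inord (lift ord0 j).-1 = widen_ord (leqnSn m) j :> 'I_m.+1.
  apply: ord_inj; rewrite lift0 /= inordK //.
  by rewrite ltnS ltnW // ltn_ord.
have -> : inord (lift ord0 j) = lift ord0 j :> 'I_m.+1 by exact: inord_val.
by rewrite permM /genA; case: q => k [] /=; rewrite !tperm_pair.
Qed.

Lemma coordB_refl k x q : coordB (refl k x) q = coordB x (genB k q).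
Proof.
elim/ordB_ind: k => [|j]; case: q => i b.
  rewrite genB0 permE /coordB /= !xpair_eqE refl_rootB0.
  by case: eqVneq => [->|_]; case: b => //=; rewrite opprK.
by rewrite genBS /coordB /= refl_rootBS refl_normA.
Qed.

Lemma coordB_actw w x q : coordB (actw w x) q = coordB x (wprod (genB (m := m)) w q).
Proof.
elim: w q => [|j w IH] q; first by rewrite /wprod big_nil perm1.
by rewrite /= coordB_refl IH wprod_cons permM.
Qed.

Lemma coordB_base_inj : injective (coordB (baseB m.+1)).
Proof.
move=> [i b] [j c]; rewrite /coordB /= !mxE.
have pos (k : 'I_m.+1) : (0 : R) < k.+1%:R by rewrite ltr0n.
have eqn : i.+1%:R = j.+1%:R :> R -> i = j.
  by move/eqP; rewrite eqr_nat eqSS => /eqP/val_inj.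
case: b; case: c => h.
- by rewrite (eqn h).
- by have := pos i; have := pos j; rewrite h oppr_gt0 => /lt_gtF->.
- by have := pos i; have := pos j; rewrite -h oppr_gt0 => /lt_gtF->.
- by rewrite (eqn (oppr_inj h)).
Qed.

Lemma evec_refl0 (k : 'I_m.+1) :
  refl ord0 (evec R k) = if k == ord0 then - evec R k else evec R k.
Proof.
apply/rowP => l; rewrite refl_rootB0 evecE; case: (eqVneq k ord0) => [->|k0].
  by rewrite !mxE eqxx /=; case: eqP => // _; rewrite oppr0.
by rewrite evecE; case: eqVneq => // ->; rewrite eq_sym (negbTE k0) oppr0.
Qed.

Lemma reflB_lin k c x y : refl k (c *: x + y) = c *: refl k x + refl k y.
Proof. exact: refl_lin. Qed.

Lemma refl_rootB_pos k i : i != simpleB k -> exists l, refl k (a i) = a l.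
Proof.
elim/ordB_ind: k => [|j].
  rewrite simpleB0; case: i => [[[[i l] il] b]|i] ne.
    have l0 : (l == ord0) = false.
      by apply/negbTE; rewrite -val_eqE -lt0n; apply: (leq_ltn_trans (leq0n i) il).
    exists (inl (mk_ltpair il, if i == ord0 then ~~ b else b)).
    rewrite /rootB /= addrC reflB_lin !evec_refl0 l0 addrC; case: ifP => // _.
    by case: (b) => /=; rewrite ?expr0 ?expr1 ?scale1r ?scaleN1r ?opprK ?scalerN // .
  exists (inr i); rewrite /rootB evec_refl0; case: eqP => // i0.
  by rewrite i0 eqxx in ne.
rewrite simpleBS refl_rootBS; case: i => [[p b]|i] ne; last first.
  by exists (inr (genA j i)); rewrite /rootB evec_genA.
have e : sreflect (normA R (n := m.+1)) (@simpleA m) j (a (inl (p, b))) =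
    evec R (genA j (val p).2) + (-1) ^+ b *: evec R (genA j (val p).1).
  by rewrite /rootB addrC refl_lin !evec_genA addrC.
(* The pair exchanged by [genA j] occurs only with a plus sign, and its root is then fixed. *)
rewrite e; have [ps|pn] := eqVneq p (simpleA j); last first.
  by exists (inl (mk_ltpair (genA_lt pn), b)).
case: b ne {e} => [|_]; first by rewrite ps eqxx.
have lt : (genA j (val p).2 < genA j (val p).1)%N.
  by rewrite ps /genA /= tpermL tpermR; exact: adj_lt.
by exists (inl (mk_ltpair lt, false)); rewrite /rootB /= expr0 !scale1r addrC.
Qed.

Lemma simple_dualB j : exists y, forall k, lform (a (simpleB k)) y = (k == j)%:R.
Proof.
exists (\row_k (j <= k)%N%:R); elim/ordB_ind => [|k].
  by rewrite simpleB0 lform_evec mxE leqn0 eq_sym.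
rewrite simpleBS lform_rootB !mxE expr1 mulN1r.
rewrite -[LHS]/((j <= k.+1)%N%:R - (j <= k)%N%:R) -[lift ord0 k == j]/(k.+1 == j :> nat).
rewrite leq_eqVlt ltnS eq_sym; have [<-|_] := eqVneq k.+1 (j : nat).
  by rewrite ltnn subr0.
by rewrite subrr.
Qed.

Lemma simple_posB x : (forall j, 0 < lform (a (simpleB j)) x) ->
  forall q, 0 < lform (a q) x.
Proof.
move=> xs; have x0 : 0 < x 0 ord0 by have := xs ord0; rewrite simpleB0 lform_evec.
have xp (p : ltpair m.+1) : x 0 (val p).1 < x 0 (val p).2.
  have /= := @simple_posA R m (- x) _ p; rewrite lform_normA !mxE opprK addrC subr_gt0; apply.
  move=> j; rewrite lform_normA !mxE opprK addrC.
  by have := xs (lift ord0 j); rewrite simpleBS lform_rootB expr1 mulN1r.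
have pos (i : 'I_m.+1) : 0 < x 0 i.
  have [->//|i0] := eqVneq i ord0; apply: lt_trans x0 _.
  have i1 : (@ord0 m < i)%N by rewrite lt0n.
  exact: xp (mk_ltpair i1).
case=> [[p [|]]|i]; rewrite ?lform_evec // lform_rootB.
  by rewrite expr1 mulN1r subr_gt0.
by rewrite expr0 mul1r addr_gt0.
Qed.

Lemma typeB_diameter (w0 : {perm 'I_m.+1 * bool}) : longest (genB (m := m)) w0 ->
  GW_diameter (genB (m := m)) w0 #|lines a|.
Proof.
move=> lg; apply: (@word_diameter _ _ _ a _ simpleB (baseB m.+1)) lg (rootB_core m.+1).
- exact: rootB_base.
- exact: rootB_free.
- exact: refl_rootB_pos.
- exact: simple_dualB.
- exact: simple_posB.
- move=> w w' e x; apply/rowP => k.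
  by have := coordB_actw w x (k, true); rewrite e -coordB_actw.
move=> w pos; apply/permP => q; rewrite perm1.
apply: coordB_base_inj; rewrite -coordB_actw; congr (coordB _ q).
(* Positivity on the coordinate roots forbids sign changes; positivity on the differences makes the
   underlying map increasing. *)
pose f k := wprod (genB (m := m)) w (k, true).
have fE k : actw w (baseB m.+1) 0 k = coordB (baseB m.+1) (f k).
  by rewrite -coordB_actw.
have f2 k : (f k).2 = true.
  have := pos (inr k); rewrite lform_evec fE /coordB !mxE.
  by case: (f k).2 => //; rewrite oppr_gt0 ltrn0.
have fid : (fun k => (f k).1) =1 id.
  apply: ord_increasing_id => i j ij.
  have := pos (inl (mk_ltpair ij, true)); rewrite lform_rootB expr1 mulN1r /= !fE.
  by rewrite /coordB !f2 !mxE subr_gt0 ltr_nat.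
by apply/rowP => k; rewrite fE /coordB f2 fid.
Qed.

End Words.
End TypeB.

Arguments alt : simpl never.

(** * Dihedral groups *)

Section Dihedral.
Local Open Scope group_scope.
Variables (gT : finGroupType) (g : bool -> gT).
Hypothesis g2 : forall b, g b * g b = 1.
Hypothesis g1 : forall b, g b != 1.
Hypothesis gtf : g true != g false.

Let g12 b : g b * g (~~ b) != 1.
Proof.
rewrite -eq_invg_mul; have -> : (g b)^-1 = g b by apply/eqP; rewrite eq_invg_mul g2.
by case: b => //; rewrite eq_sym.
Qed.

Let order_sym b : #[g b * g (~~ b)] = #[g true * g false].
Proof.
case: b => //=; apply/eqP; rewrite eqn_dvd.
by apply/andP; split; apply/(alt_prod_eq g2)/esym/(alt_prod_eq g2).
Qed.

Local Notation m := #[g true * g false].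

Lemma m_gt1 : (1 < m)%N.
Proof. by rewrite ltn_neqAle eq_sym order_eq1 (g12 true) order_gt0. Qed.

Lemma wprod_alt_double i j h : wprod g (alt i j h.*2) = (g i * g j) ^+ h.
Proof.
elim: h => [|h IH]; first by rewrite /wprod big_nil.
by rewrite doubleS !altS !wprod_cons IH expgS mulgA.
Qed.

(** An odd alternating word is a palindrome, hence conjugate to its middle letter. *)
Lemma wprod_alt_odd i j h : wprod g (alt i j h.*2.+1) != 1.
Proof.
elim: h i j => [|h IH] i j; first by rewrite /wprod big_seq1.
rewrite doubleS altS alt_rcons wprod_cons wprod_rcons oddS odd_double /=.
apply: contraNneq (IH j i) => e; apply/eqP/(mulgI (g i)); rewrite mulg1.
by apply: (mulIg (g i)); rewrite -mulgA e g2.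
Qed.

Lemma alt_neq1 b k : (0 < k <= m)%N -> wprod g (alt b (~~ b) k) != 1.
Proof.
case/andP=> k0 km; rewrite -(odd_double_half k).
case: (odd k) (odd_double_half k) => /= ek; first exact: wprod_alt_odd.
rewrite add0n wprod_alt_double -order_dvdn order_sym gtnNdvd //; lia.
Qed.

(** A repeated letter would cancel, and more than [m] alternating letters can be shortened. *)
Lemma reduced_alt h w : reduced g h w ->
  exists2 b, w = alt b (~~ b) (size w) & (size w <= m)%N.
Proof.
case=> ew minw; pose b := head true w.
have wsort : sorted (fun k l => k != l) w.
  case: w ew minw {b} => // j w; elim: w j h => //= k w IH j h ew minw.
  apply/andP; split.
    apply: contraT; rewrite negbK => /eqP jk; have := minw w; rewrite leqNgt ltnS leqnSn.
    by apply; rewrite -ew !wprod_cons jk mulgA g2 mul1g.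
  apply: (IH k (g j * h)); first by rewrite -ew [wprod g (j :: _)]wprod_cons mulgA g2 mul1g.
  by move=> w' ew'; have := minw (j :: w'); rewrite ltnS; apply; rewrite wprod_cons ew' mulgA g2 mul1g.
have walt : w = alt b (~~ b) (size w).
  apply: alternatingE => //; last by case: b.
  - by move=> k _; case: k; case: b; auto.
  - by rewrite /b; case: (w).
exists b => //; rewrite leqNgt; apply/negP => wm; have [v ev] := alt_cat b (~~ b) wm.
have sz : size w = (m.+1 + size v)%N by rewrite {1}walt ev size_cat size_alt.
have e : wprod g (alt (~~ b) b m.-1 ++ v) = h.
  rewrite -ew [in RHS]walt ev !wprod_cat -(order_sym b) alt_shorten ?g12 //.
  by case: (b).
have := minw _ e; rewrite sz size_cat size_alt leq_add2r leqNgt ltnS leq_pred.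
by [].
Qed.

(** A shorter reduced word would be a proper prefix of one of the two alternating words of length
    [m], which have the same product; the remaining letters would have product 1. *)
Lemma alt_reduced b : reduced g (wprod g (alt b (~~ b) m)) (alt b (~~ b) m).
Proof.
split=> // w0 ew0; rewrite size_alt.
have [w ew minw] : exists2 w, wprod g w = wprod g w0 &
    forall w', wprod g w' = wprod g w0 -> (size w <= size w')%N.
  pose P n := `[< exists w, wprod g w = wprod g w0 /\ size w = n >].
  have exP : exists n, P n by exists (size w0); apply/asboolP; exists w0.
  case: (ex_minnP exP) => n /asboolP[w [ew sw]] nmin; exists w => // w' ew'.
  by rewrite sw; apply: nmin; apply/asboolP; exists w'.
apply: leq_trans (minw w0 erefl).
have [c ec wm] : exists2 c, w = alt c (~~ c) (size w) & (size w <= m)%N.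
  by apply: (@reduced_alt (wprod g w0)).
rewrite leqNgt; apply/negP => lt.
have ec' : wprod g (alt c (~~ c) m) = wprod g (alt c (~~ c) (size w)).
  rewrite -ec ew ew0; have [<-//|cb] := eqVneq b c.
  have -> : c = ~~ b by move: cb; case: (b); case: (c).
  by rewrite negbK; apply/(alt_prod_eq g2); case: (b); rewrite ?(order_sym false).
move: ec'; rewrite -{1}(subnKC wm) alt_add wprod_cat -[in RHS](mulg1 (wprod g _)).
have k0 : (0 < m - size w <= m)%N by rewrite subn_gt0 lt leq_subr.
move=> /mulgI/eqP; apply/negP; case: odd; last exact: alt_neq1.
by have := alt_neq1 (~~ c) k0; rewrite negbK.
Qed.

(** The longest element has exactly two reduced words, the alternating ones of length [m], and one
    braid relation joins them. *)
Lemma dihedral_diameter w0 : longest g w0 -> GW_diameter g w0 1.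
Proof.
case=> w [rw maxw]; have [b ew wm] := reduced_alt rw.
have sw : size w = m.
  apply/eqP; rewrite eqn_leq wm /=; have := maxw _ _ (alt_reduced true).
  by rewrite size_alt.
have [ew0 minw] := rw.
have allm w' : reduced g w0 w' -> exists c, w' = alt c (~~ c) m.
  move=> rw'; have [c ec _] := reduced_alt rw'; exists c; rewrite {1}ec; congr alt.
  case: rw' => ew' minw'; apply/eqP; rewrite eqn_leq -{1}sw minw' //.
  by rewrite -sw minw.
have redc c : reduced g w0 (alt c (~~ c) m).
  split; last by move=> w' /minw; rewrite size_alt sw.
  rewrite -ew0 ew sw; have [->//|cb] := eqVneq c b.
  have -> : c = ~~ b by move: cb; case: (b); case: (c).
  by rewrite negbK; apply/(alt_prod_eq g2); case: (b); rewrite ?(order_sym false).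
split=> [x y rx ry|].
  have [c ex] := allm x rx; have [c' ey] := allm y ry.
  have [cc|cc] := eqVneq c c'.
    by exists 0%N => //; apply/nwalk_walk; split=> //; rewrite ex ey cc.
  exists 1%N => //; apply/nwalk_walk; exists y; split=> //.
  exists [::], [::], c, (~~ c); rewrite !cats0 order_sym ex ey.
  by split; [case: (c)| |congr alt; move: cc; case: (c); case: (c')].
exists (alt true false m), (alt false true m); split; try exact: redc.
case=> // _ /nwalk_walk[_]; by case: #[_] m_gt1.
Qed.

End Dihedral.

Section DihedralArrangement.
Import Order.TTheory GRing.Theory Num.Theory.
Local Open Scope ring_scope.
Variable R : realType.

(** In the plane only the zero subspace has codimension 2; it is an intersection because the lines
    at angles 0 and [pi / m] differ, the sine of [pi / m] being positive. *)
Lemma size_L2_dihedral (m : nat) : (2 <= m)%N -> size (L2 (normI2 R (m := m))) = 1%N.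
Proof.
move=> m2; set a := normI2 R (m := m).
suff /perm_size : perm_eq (L2 a) [:: 0%VS] by [].
apply: uniq_perm; rewrite ?filter_uniq ?undup_uniq // => X.
rewrite !inE mem_filter addn2 eqSS eqSS dimv_eq0.
apply/andP/eqP => [[/eqP]//|->]; split; rewrite ?eqxx //.
apply/LsetP; exists [set: 'I_m]; apply/esym/eqP; rewrite -subv0.
apply/subvP => x; rewrite memv0 => xH.
have m0 : (0 < m)%N by exact: ltnW.
have H0 : x \in H a (Ordinal m0).
  by move: x xH; apply/subvP; apply: (bigcapv_inf (Ordinal m0)); rewrite ?inE.
have H1 : x \in H a (Ordinal m2).
  by move: x xH {H0}; apply/subvP; apply: (bigcapv_inf (Ordinal m2)); rewrite ?inE.
move: H0 H1; rewrite !mem_hyp !lformE !big_ord_recl !big_ord0 !mxE /=.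
rewrite !mul0r sin0 cos0 oppr0 mulr0 add0r mulr1 addr0 => /eqP x1.
rewrite x1 mul0r addr0 addr0 mul1r mulf_eq0 oppr_eq0.
have mR : (0 : R) < m%:R by rewrite ltr0n.
rewrite (gt_eqF (sin_gt0_pi _)) ?orbF; last first.
  rewrite divr_gt0 ?pi_gt0 //= ltr_pdivrMr // ltr_pMr ?pi_gt0 //.
  by rewrite ltr1n.
move=> /eqP x0; apply/eqP/rowP => k; rewrite mxE.
by case: (unliftP ord0 k) => [l|] ->; rewrite ?(ord1 l).
Qed.

End DihedralArrangement.

Theorem theorem1p1 :
  (* main statement *)
  (forall (R : realType) (d : nat) (I : finType) (a : I -> 'rV[R]_d)
          (F : nat -> {vspace 'rV[R]_d}) (c0 : classical_sets.set 'rV[R]_d),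
      is_arrangement a -> essential a -> supersolvable a ->
      modular_flag a F -> chamber a c0 -> incident_flag c0 F ->
      has_diameter (G2_vertex a c0) (adj2 a) (size (L2 a))) /\
  (* type A_{n-1}, n = m.+1 *)
  (forall (m : nat) (w0 : {perm 'I_m.+1}),
      longest (genA (m:=m)) w0 ->
      let n := m.+1 in
      GW_diameter (genA (m:=m)) w0 (n * (n - 1) * (n - 2) * (3 * n - 5) %/ 24)) /\
  (* type B_n, n = m.+1 *)
  (forall (m : nat) (w0 : {perm 'I_m.+1 * bool}),
      longest (genB (m:=m)) w0 ->
      let n := m.+1 in
      GW_diameter (genB (m:=m)) w0 (n * (n - 1) * (3 * n ^ 2 + 1 - 5 * n) %/ 6)) /\
  (* dihedral I_2(m): generated by two distinct involutions s, t, #[st] = m *)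
  (forall (gT : finGroupType) (s t : gT) (w0 : gT),
      s != 1%g -> t != 1%g -> s != t -> (s ^+ 2 = 1)%g -> (t ^+ 2 = 1)%g ->
      longest (fun b : bool => if b then s else t) w0 ->
      GW_diameter (fun b : bool => if b then s else t) w0 1) /\
  (* these numbers are |L_2| of the reflection arrangements *)
  (forall (R : realType) (n : nat),
      size (L2 (normA R (n:=n))) = n * (n - 1) * (n - 2) * (3 * n - 5) %/ 24) /\
  (forall (R : realType) (n : nat),
      size (L2 (normB R (n:=n))) = n * (n - 1) * (3 * n ^ 2 + 1 - 5 * n) %/ 6) /\
  (forall (R : realType) (m : nat), (2 <= m)%N ->
      size (L2 (normI2 R (m:=m))) = 1).
Proof.
split=> [R d I a F c0 aP _ _ FP [p0 p0C ->] c0F|]; first exact: supersolvable_diameter FP c0F.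
split=> [m w0 lg n|].
  (* The statement on words mentions no field; any model of the reals supplies the arrangement. *)
  by have := typeA_diameter Rdefinitions.R lg; rewrite card_linesA.
split=> [m w0 lg n|].
  by have := typeB_diameter Rdefinitions.R lg; rewrite card_linesB.
split=> [gT s t w0 s1 t1 st s2 t2 lg|].
  by apply: dihedral_diameter lg => // [] [] //=; rewrite -expg2.
split=> [R n|]; first by rewrite -(card_linesA R) card_lines //; exact: normA_arrangement.
split=> [R n|]; last exact: size_L2_dihedral.
rewrite -(card_linesB R) (lines_scale (@rootB_scale R n)) card_lines //.
exact: normB_arrangement.
Qed.
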